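(* (1) Let $n\ge 5$. If $L$ is a generic $2$-dimensional plane in $\mathbb P^n$, then $\operatorname{trop}F_1(L)\subsetneq F_1(\operatorname{trop}L)$. (2) If $X$ is a toric variety in $\mathbb P^n$, then $F_d(\operatorname{trop}X)=\operatorname{trop}F_d(X)$.
   Context: $\Bbbk$ is a field with a surjective valuation $\mathfrak v:\Bbbk^*\to\mathbb R$, extended by $\mathfrak v(0)=\infty$; all varieties are over $\Bbbk$. The dimension $d$ in (2) is arbitrary. Put $\overline{\mathbb R}=\mathbb R\cup\{\infty\}$, $\mathbf 1=(1,\dots,1)$, and $\operatorname{trop}\mathbb P^m=(\overline{\mathbb R}^{m+1}\setminus\{(\infty,\dots,\infty)\})/\mathbb R\mathbf 1$. Tropicalization: for a proper subset $I\subsetneq\{0,\dots,m\}$, the torus orbit $O\subseteq\mathbb P^m$ is the locus where $x_i=0$ exactly for $i\in I$, and $\operatorname{trop}O\subseteq\operatorname{trop}\mathbb P^m$ is the locus where $x_i=\infty$ exactly for $i\in I$. For a projective variety (or closed subscheme) $Y\subseteq\mathbb P^m$, $\operatorname{trop}Y$ is the union over all orbits $O$ of $\operatorname{trop}Y\cap\operatorname{trop}O:=\operatorname{trop}(Y\cap O)$, the usual tropicalization (min convention) in the torus $O$. Containments and equalities between tropical varieties are between their supports. Fano schemes: $\mathbb G(d,n)$ is the Grassmannian of $d$-dimensional projective subspaces of $\mathbb P^n$, embedded in $\mathbb P^{\binom{n+1}{d+1}-1}$ by the Plücker embedding. For $X\subseteq\mathbb P^n$, $F_d(X)\subseteq\mathbb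 G(d,n)$ is the Fano scheme, the fine moduli space of $d$-dimensional linear spaces contained in $X$; $\operatorname{trop}F_d(X)\subseteq\operatorname{trop}\mathbb G(d,n)$ is its tropicalization. Tropical Fano scheme: to $p\in\operatorname{trop}\mathbb G(d,n)$ corresponds the tropicalized linear space $\Gamma_p$, namely the set of $x\in\operatorname{trop}\mathbb P^n$ such that, for every $\tau\subseteq\{0,\dots,n\}$ with $|\tau|=d+2$, the minimum $\min_{i\in\tau}(p_{\tau\setminus i}+x_i)$ is $\infty$ or is attained at least twice; if $p$ is the coordinatewise valuation of the Plücker vector of a linear space $L$, then $\Gamma_p=\operatorname{trop}L$. Then $F_d(\operatorname{trop}X):=\{p\in\operatorname{trop}\mathbb G(d,n):\Gamma_p\subseteq\operatorname{trop}X\}$. Genericity: the paper uses the word ''generic'' in (1) without a separate formal definition. The planes $L$ treated in its proof are those whose Plücker coordinates all have valuation $0$ and which lie in a Zariski open subset of $\mathbb G(2,n)$ on which the lines $\ell_i=L\cap\{x_i=0\}$, $i=0,\dots,n$, satisfy: no three of the $\ell_i$ with distinct indices have a common point, and the points $w_{i_0,i_1},w_{i_2,i_3},w_{i_4,i_5}$, where $w_{i,j}=\ell_i\cap\ell_j$, are not collinear unless $\{i_0,i_1\}\cap\{i_2,i_3\}\cap\{i_4,i_5\}\neq\emptyset$. Toric varieties: for a set of lattice points $\mathcal A=\{\mathbf a_0,\dots,\mathbf a_n\}\subseteq\mathbb Z^r\times\{1\}$, $X_{\mathcal A}\subseteq\mathbb P^n$ is the closure of the image of the monomial map $\phi_{\mathcal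 A}:(\Bbbk^* )^r\times\Bbbk^*\to\mathbb P^n$, $t\mapsto[t^{\mathbf a_0}:\cdots:t^{\mathbf a_n}]$. A toric variety in $\mathbb P^n$ means one of this form, i.e. embedded by a monomial map. *)

(* Defs.v *)
From HB Require Import structures.
From mathcomp Require Import all_boot all_order all_algebra.
(* mpoly has to be imported before constructive_ereal: in the other order their
   notation levels clash. *)
From mathcomp Require Import mpoly.
From mathcomp Require Import boolp classical_sets constructive_ereal reals.

Set Implicit Arguments.
Unset Strict Implicit.
Unset Printing Implicit Defensive.

Import Order.TTheory GRing.Theory Num.Theory.

Local Open Scope classical_set_scope.
Local Open Scope ring_scope.

Record valuation (k : fieldType) (R : realType) := Valuation {
  vfun :> k -> \bar R;
  vfun0 : vfun 0 = +oo%E;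
  vfun_fin : forall x, x != 0 -> vfun x \is a fin_num;
  vfunM : forall x y, vfun (x * y) = (vfun x + vfun y)%E;
  vfunD : forall x y, (Order.min (vfun x) (vfun y) <= vfun (x + y))%E }.

Definition surjective_valuation (k : fieldType) (R : realType)
    (v : valuation k R) : Prop :=
  forall r : R, exists2 x : k, x != 0 & v x = r%:E.

(* Tropical projective space.  A subset of trop P^(N-1) is represented by its
   preimage in {R u oo}^N, which is invariant under adding a real constant to
   all coordinates.  \bar R also contains -oo, which is excluded. *)

Definition trop_point (R : realType) (N : nat) (w : 'I_N -> \bar R) : Prop :=
  (forall i, w i != -oo%E) /\ exists i, w i != +oo%E.

Definition trop_orbit (R : realType) (N : nat) (I : {set 'I_N}) :
    set ('I_N -> \bar R) :=
  [set w | forall i, w i != -oo%E /\ (w i == +oo%E) = (i \in I)].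

Definition min_oo_or_twice (R : realType) (T : eqType) (s : seq T)
    (F : T -> \bar R) : Prop :=
  (forall t, t \in s -> F t = +oo%E) \/
  exists t1 t2, [/\ t1 \in s, t2 \in s, t1 != t2, F t1 = F t2 &
                    forall t, t \in s -> (F t1 <= F t)%E].

Definition trop_term (k : fieldType) (R : realType) (v : valuation k R)
    (N : nat) (w : 'I_N -> \bar R) (f : {mpoly k[N]}) (u : 'X_{1..N}) : \bar R :=
  (v f@_u + \sum_(i < N) (u i)%:R%:E * w i)%E.

(* Closed subschemes of P^(N-1) are given by homogeneous ideals of k[x].
   The coordinate ring of the torus orbit x_I = 0 is the degree 0 part of
   k[x_i^(+-1) : i \notin I]; clearing denominators, an ideal of it is recorded
   by the homogeneous polynomials in the x_i, i \notin I, that it contains up to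
   a Laurent monomial. *)

Definition restrict_orbit (k : fieldType) (N : nat) (I : {set 'I_N})
    (g : {mpoly k[N]}) : {mpoly k[N]} :=
  g \mPo [tuple (if i \in I then 0 else 'X_i) | i < N].

Definition orbit_ideal (k : fieldType) (N : nat) (J : set {mpoly k[N]})
    (I : {set 'I_N}) : set {mpoly k[N]} :=
  [set f | exists (u : 'X_{1..N}) (g : {mpoly k[N]}),
     [/\ forall i, i \in I -> u i = 0%N, J g &
         'X_[u] * f = restrict_orbit I g]].

(* A Laurent monomial factor shifts all terms equally, so homogeneous
   polynomials suffice. *)
Definition trop_torus (k : fieldType) (R : realType) (v : valuation k R)
    (N : nat) (J : set {mpoly k[N]}) : set ('I_N -> \bar R) :=
  [set w | forall f, J f -> (exists e, f \is e.-homog) ->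
     min_oo_or_twice (msupp f) (trop_term v w f)].

Definition trop (k : fieldType) (R : realType) (v : valuation k R)
    (N : nat) (J : set {mpoly k[N]}) : set ('I_N -> \bar R) :=
  [set w | exists I : {set 'I_N},
     [/\ I \proper [set: 'I_N]%SET, trop_orbit I w &
         trop_torus v (orbit_ideal J I) w]].

(* Homogeneous ideal of the Zariski closure of the set of points of P^(N-1)
   with homogeneous coordinate vectors in Y; k is infinite in all uses, so
   evaluating at all multiples of y tests each homogeneous component of f. *)
Definition closure_ideal (k : fieldType) (N : nat) (Y : set ('I_N -> k)) :
    set {mpoly k[N]} :=
  [set f | forall y c, Y y -> c != 0 -> f.@[fun i => c * y i] = 0].

Definition plucker_index (d n : nat) : finType :=
  {sigma : {set 'I_n.+1} | #|sigma| == d.+1}.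

Definition plucker_num (d n : nat) : nat := #|plucker_index d n|.

Lemma plucker_numE (d n : nat) : plucker_num d n = 'C(n.+1, d.+1).
Proof.
rewrite /plucker_num card_sig -[in RHS](card_ord n.+1) -card_draws.
by apply: eq_card => A; rewrite !inE.
Qed.

(* The elements of sigma in increasing order. *)
Definition plucker_cols (d n : nat) (sigma : plucker_index d n)
    (j : 'I_d.+1) : 'I_n.+1 :=
  enum_val (cast_ord (esym (eqP (valP sigma))) j).

Definition plucker (d n : nat) (S : comNzRingType) (M : 'M[S]_(d.+1, n.+1)) :
    'I_(plucker_num d n) -> S :=
  fun s => \det (colsub (plucker_cols (enum_val s)) M).

(* The rows of M are a basis of a free direct summand of rank d+1 of S^(n+1).
   All S-points of the Grassmannian are of this form locally on Spec S, which
   is enough for testing the vanishing of functions. *)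
Definition linear_space (d n : nat) (S : comNzRingType)
    (M : 'M[S]_(d.+1, n.+1)) : Prop :=
  exists B : 'M[S]_(n.+1, d.+1), M *m B = 1%:M.

(* Every g in J vanishes on the universal combination \sum_j 'X_j * row j M. *)
Definition linear_space_in (k : fieldType) (d n : nat)
    (J : set {mpoly k[n.+1]}) (S : comAlgType k) (M : 'M[S]_(d.+1, n.+1)) :
    Prop :=
  forall g, J g ->
    mmap (fun c : k => (c%:A : S)%:MP)
         (fun i => \sum_(j < d.+1) M j i *: 'X_j : {mpoly S[d.+1]}) g = 0.

Definition grassmann_ideal (k : fieldType) (d n : nat) :
    set {mpoly k[plucker_num d n]} :=
  [set f | forall (S : comAlgType k) (M : 'M[S]_(d.+1, n.+1)),
     linear_space M -> mmap (in_alg S) (plucker M) f = 0].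

(* The ideal of the Fano scheme, from its functor of points: f vanishes on
   F_d(X) iff it vanishes at every S-point, for every commutative k-algebra S. *)
Definition fano_ideal (k : fieldType) (d n : nat) (J : set {mpoly k[n.+1]}) :
    set {mpoly k[plucker_num d n]} :=
  [set f | forall (S : comAlgType k) (M : 'M[S]_(d.+1, n.+1)),
     linear_space M -> linear_space_in J M ->
     mmap (in_alg S) (plucker M) f = 0].

(* p_sigma; the default value +oo is not used on sets of cardinality d+1. *)
Definition plucker_coord (R : realType) (d n : nat)
    (p : 'I_(plucker_num d n) -> \bar R) (sigma : {set 'I_n.+1}) : \bar R :=
  if insub sigma is Some s then p (enum_rank (s : plucker_index d n))
  else +oo%E.

Definition trop_linear_space (R : realType) (d n : nat)
    (p : 'I_(plucker_num d n) -> \bar R) : set ('I_n.+1 -> \bar R) :=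
  [set x | trop_point x /\
     forall tau : {set 'I_n.+1}, #|tau| = d.+2 ->
       min_oo_or_twice (enum tau)
         (fun i => plucker_coord p (tau :\ i)%SET + x i)%E].

Definition trop_fano (k : fieldType) (R : realType) (v : valuation k R)
    (d n : nat) (T : set ('I_n.+1 -> \bar R)) :
    set ('I_(plucker_num d n) -> \bar R) :=
  [set p | trop v (@grassmann_ideal k d n) p /\ trop_linear_space p `<=` T].

Definition linear_ideal (k : fieldType) (d n : nat)
    (M : 'M[k]_(d.+1, n.+1)) : set {mpoly k[n.+1]} :=
  closure_ideal [set y | exists2 c : 'rV[k]_d.+1, c != 0 &
                         y = fun i => (c *m M) 0 i].

(* Linear subspaces of P^n are row spaces; points are row spaces of rank 1. *)

Definition coord_hyperplane (k : fieldType) (n : nat) (i : 'I_n.+1) :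
    'M[k]_n.+1 :=
  kermx (delta_mx i 0 : 'cV[k]_n.+1).

Definition coord_line (k : fieldType) (n : nat) (M : 'M[k]_(3, n.+1))
    (i : 'I_n.+1) : 'M[k]_n.+1 :=
  (M :&: coord_hyperplane k i)%MS.

Definition coord_meet (k : fieldType) (n : nat) (M : 'M[k]_(3, n.+1))
    (i j : 'I_n.+1) : 'M[k]_n.+1 :=
  (coord_line M i :&: coord_line M j)%MS.

Definition collinear (k : fieldType) (n : nat) (w1 w2 w3 : 'M[k]_n.+1) : bool :=
  (\rank (w1 + w2 + w3)%MS <= 2)%N.

(* The three index pairs must be distinct: otherwise two of the three points
   coincide, and the points are always collinear. *)
Definition generic_lines (k : fieldType) (n : nat) (M : 'M[k]_(3, n.+1)) :
    Prop :=
  (forall i j l : 'I_n.+1, uniq [:: i; j; l] ->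
     (coord_line M i :&: coord_line M j :&: coord_line M l)%MS = 0) /\
  (forall i0 i1 i2 i3 i4 i5 : 'I_n.+1,
     i0 != i1 -> i2 != i3 -> i4 != i5 ->
     uniq [:: [set i0; i1]%SET; [set i2; i3]%SET; [set i4; i5]%SET] ->
     ([set i0; i1] :&: [set i2; i3] :&: [set i4; i5])%SET == finset.set0 ->
     ~~ collinear (coord_meet M i0 i1) (coord_meet M i2 i3)
                  (coord_meet M i4 i5)).

(* U is the set of all bases of the members of a Zariski open subset of G(d,n)
   (on k-points): the complement of the common zeros of a set of homogeneous
   polynomials in the Plucker coordinates. *)
Definition zariski_open (k : fieldType) (d n : nat)
    (U : set 'M[k]_(d.+1, n.+1)) : Prop :=
  exists E : set {mpoly k[plucker_num d n]},
    (forall f, E f -> exists e, f \is e.-homog) /\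
    U = [set M | row_free M /\ exists2 f, E f & f.@[plucker M] != 0].

(* A lattice point of Z^r x {1} is a row vector with last entry 1, and the torus
   (k^* )^r x k^* consists of the t with nonzero entries. *)
Definition monomial_map (k : fieldType) (r n : nat)
    (a : 'I_n.+1 -> 'rV[int]_r.+1) (t : 'I_r.+1 -> k) : 'I_n.+1 -> k :=
  fun i => \prod_(j < r.+1) t j ^ a i 0 j.

Definition toric_ideal (k : fieldType) (r n : nat)
    (a : 'I_n.+1 -> 'rV[int]_r.+1) : set {mpoly k[n.+1]} :=
  closure_ideal [set y | exists2 t : 'I_r.+1 -> k, (forall j, t j != 0) &
                         y = monomial_map a t].

(* Main.v *)
(* A point w lies in the tropicalization of J iff no element of J, homogeneous on the torus orbit of w,
   has an isolated term at w, that is, a single term of minimal weight. Isolated terms multiply, so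
   they are transported by substitutions, and they survive small perturbations of w. Working with
   them instead of with lifts of points avoids any assumption on k and on its residue field.

   trop F(X) <= F(trop X), for every X. A point x of the linear space of p is the tropicalization of a
   combination of cocircuits, with coefficients of suitable valuations. Substituting the cocircuits of
   the generic linear space into f in I(X) gives an element of the Fano ideal, and an isolated term of
   f at x would give one of this element at p.

   Toric X, reverse inclusion. If the linear space of p lies in trop X, then two monomials u, u' with
   the same image under A have the same degree on every parallel class of the matroid of p, and the
   constant differences between parallel coordinates come from a torus element with prescribed
   valuations. Replacing each column of a matrix M by a torus multiple of the representative of its
   parallel class sends the row space of M into X. This linear substitution maps the Fano ideal of X
   into the Grassmann ideal and fixes p.

   Planes. A line of L whose Plucker coordinates 01, 23 and 45 vanish would pass through the three
   points x_0 = x_1 = 0, x_2 = x_3 = 0 and x_4 = x_5 = 0 of L, which are not collinear. The tropical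
   line with these three coordinates infinite and all others 0 nevertheless lies in trop L. *)
Require Import Defs.
From mathcomp Require Import all_boot all_order all_algebra fingroup perm.
From mathcomp Require Import mpoly.
From mathcomp Require Import boolp classical_sets constructive_ereal reals.
From mathcomp Require Import ring lra zify.

Set Implicit Arguments.
Unset Strict Implicit.
Unset Printing Implicit Defensive.

Import Order.TTheory GRing.Theory Num.Theory.

Local Open Scope classical_set_scope.
Local Open Scope ring_scope.

(** * Valuations and isolated terms *)

(** Cancellation is the obstacle. A combination of cocircuits that realizes [x] is sure to have an
    isolated term in a coordinate only if a single cocircuit attains the minimum there. Ties are
    broken by moving [x] and the coefficients by multiples of a small real number, for which a
    strict minimum leaves room. Points at infinity are treated together with finite ones: terms of
    infinite weight are ignored, and homogeneity is required of the remaining terms only. In the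
    toric case each binomial of the ideal forces its two monomials to have equal weight at every
    point of the linear space of [p]. Two points that differ by 1 on one parallel class and agree
    elsewhere then compare the degrees on that class. The bound n >= 5 provides six leaves for three
    disjoint pairs. Pairs are small enough for the tropical line to stay in trop L: among any three
    leaves, two are not paired. *)

Lemma EFin_mulrn (R : realType) (r : R) n : r%:E *+ n = (r *+ n)%:E.
Proof. by elim: n => // n IH; rewrite !mulrS IH. Qed.

Section Valuation.
Context (k : fieldType) (R : realType) (v : valuation k R).

Lemma vfun_neqNy x : v x != -oo%E.
Proof.
have [->|x0] := eqVneq x 0; first by rewrite vfun0.
by have /fin_numP[] := vfun_fin v x0.
Qed.

Lemma vfun_eqy x : (v x == +oo%E) = (x == 0).
Proof.
have [->|x0] := eqVneq x 0; first by rewrite vfun0 eqxx.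
by have /fin_numP[_ /negbTE] := vfun_fin v x0.
Qed.

Lemma vfun1 : v 1 = 0%E.
Proof.
have := vfunM v 1 1; rewrite mulr1.
have := vfun_fin v (oner_neq0 k).
case: (v 1) => // r _ [] /eqP; rewrite -subr_eq0 opprD addNKr oppr_eq0.
by move=> /eqP ->.
Qed.

Lemma vfunN x : v (- x) = v x.
Proof.
have vN1 : v (-1) = 0%E.
  have := vfunM v (-1) (-1); rewrite mulrNN mulr1 vfun1.
  case: (v (-1)) => //= r [] /esym/eqP; rewrite -mulr2n mulrn_eq0 /=.
  by move=> /eqP ->.
by rewrite -mulN1r vfunM vN1 add0e.
Qed.

Lemma vfun_sign (b : bool) : v ((-1) ^+ b) = 0%E.
Proof. by case: b; rewrite ?expr1 ?vfunN ?expr0 vfun1. Qed.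

Lemma vfunX x n : v (x ^+ n) = v x *+ n.
Proof.
elim: n => [|n IH]; first by rewrite expr0 vfun1 mulr0n.
by rewrite exprS vfunM IH mulrS.
Qed.

Lemma vfun_prod (I : Type) (s : seq I) (P : pred I) (F : I -> k) :
  v (\prod_(i <- s | P i) F i) = \sum_(i <- s | P i) v (F i).
Proof. by apply: (big_morph v) => [x y|]; [exact: vfunM | exact: vfun1]. Qed.

Lemma vfunV x r : v x = r%:E -> v x^-1 = (- r)%:E.
Proof.
move=> vx.
have x0 : x != 0 by apply/eqP => x0; move: vx; rewrite x0 vfun0.
have := vfunM v x x^-1; rewrite divff // vfun1 vx.
have := vfun_fin v (invr_neq0 x0).
case: (v x^-1) => // s _ [] /esym/eqP; rewrite addrC addr_eq0.
by move=> /eqP ->.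
Qed.

Lemma vfun_exprz x r (z : int) : v x = r%:E -> v (x ^ z) = (r *~ z)%:E.
Proof.
move=> vx; case: z => n; last first.
  rewrite NegzE mulrNz -NegzE; apply: (vfunV (x := x ^+ n.+1)).
  by rewrite vfunX vx EFin_mulrn.
by rewrite -exprnP vfunX vx EFin_mulrn.
Qed.

(** One induction serves all upward closed conditions: weak bounds, strict bounds, and being
    infinite. *)
Lemma vfun_sum (I : Type) (s : seq I) (P : pred I) (F : I -> k)
    (A : \bar R -> Prop) :
  A +oo%E -> (forall x y, (x <= y)%E -> A x -> A y) ->
  (forall i, P i -> A (v (F i))) -> A (v (\sum_(i <- s | P i) F i)).
Proof.
move=> Aoo Aup AF; elim/big_rec: _ => [|i x Pi Ax]; first by rewrite vfun0.
apply: Aup (vfunD v _ _) _.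
by rewrite minElt; case: ifP => _ //; exact: AF.
Qed.

Lemma vfun_neq0 x r : v x = r%:E -> x != 0.
Proof. by move=> vx; rewrite -vfun_eqy vx. Qed.

Lemma vfunD_lt x y : (v x < v y)%E -> v (x + y) = v x.
Proof.
move=> xy; apply/eqP; rewrite eq_le; apply/andP; split; last first.
  by apply: le_trans (vfunD v _ _); rewrite minElt xy.
have := vfunD v (x + y) (- y); rewrite addrK vfunN ge_min.
by move=> /orP[] // yx; move: xy; rewrite ltNge yx.
Qed.

End Valuation.

Section TropicalTerms.
Context (k : fieldType) (R : realType) (v : valuation k R) (N : nat).
Implicit Types (w : 'I_N -> \bar R) (f g : {mpoly k[N]}) (m : 'X_{1..N}).

Definition mnm_weight w m : \bar R := (\sum_(i < N) w i *+ m i)%R.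

Lemma trop_termE w f m : trop_term v w f m = (v f@_m + mnm_weight w m)%E.
Proof. by congr (_ + _)%E; apply: eq_bigr => i _; rewrite mule_natl. Qed.

Lemma mnm_weightD w m1 m2 :
  mnm_weight w (m1 + m2)%MM = (mnm_weight w m1 + mnm_weight w m2)%E.
Proof.
by rewrite -big_split /=; apply: eq_bigr => i _; rewrite mnmDE mulrnDr.
Qed.

Lemma mnm_weight0 w : mnm_weight w 0%MM = 0%E.
Proof. by rewrite /mnm_weight big1 // => i _; rewrite mnm0E. Qed.

Lemma mnm_weightU w i : mnm_weight w U_(i)%MM = w i.
Proof.
rewrite /mnm_weight (bigD1 i) //= mnm1E eqxx mulr1n big1 ?addr0 // => j ji.
by rewrite mnm1E eq_sym (negbTE ji) mulr0n.
Qed.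

Lemma natmul_neqNy (x : \bar R) n : x != -oo%E -> x *+ n != -oo%E.
Proof.
move=> x0; elim: n => // n IH.
by rewrite mulrS adde_eq_ninfty negb_or x0 IH.
Qed.

Lemma mnm_weight_neqNy w m : (forall i, w i != -oo%E) -> mnm_weight w m != -oo%E.
Proof.
move=> w0; apply/negP => /eqP/esum_eqNyP[i [_ _]] /eqP.
by apply/negP/natmul_neqNy.
Qed.

Lemma trop_term_out w f m : (forall i, w i != -oo%E) -> f@_m = 0 ->
  trop_term v w f m = +oo%E.
Proof. by move=> w0 fm; rewrite trop_termE fm vfun0 addye ?mnm_weight_neqNy. Qed.

Lemma trop_term_neqNy w f m : (forall i, w i != -oo%E) ->
  trop_term v w f m != -oo%E.
Proof.
by move=> w0; rewrite trop_termE adde_eq_ninfty negb_or vfun_neqNy mnm_weight_neqNy.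
Qed.

Lemma trop_termX w c m0 m : (forall i, w i != -oo%E) ->
  trop_term v w (c *: 'X_[m0]) m =
  if m0 == m then (v c + mnm_weight w m0)%E else +oo%E.
Proof.
move=> w0; have [<-|m0m] := eqVneq m0 m.
  by rewrite trop_termE mcoeffZ mcoeffX eqxx mulr1.
by rewrite trop_term_out // mcoeffZ mcoeffX (negbTE m0m) mulr0.
Qed.

Lemma trop_termZ w a f m :
  trop_term v w (a *: f) m = (v a + trop_term v w f m)%E.
Proof. by rewrite !trop_termE mcoeffZ vfunM addeA. Qed.

Section Bounds.
Context (w : 'I_N -> \bar R) (w0 : forall i, w i != -oo%E).

Lemma trop_term_sum (A : \bar R -> Prop) (I : Type) (s : seq I) (P : pred I)
    (F : I -> {mpoly k[N]}) m :
  A +oo%E -> (forall x y, (x <= y)%E -> A x -> A y) ->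
  (forall i, P i -> A (trop_term v w (F i) m)) ->
  A (trop_term v w (\sum_(i <- s | P i) F i) m).
Proof.
move=> Aoo Aup AF; rewrite trop_termE raddf_sum /=.
apply: (@vfun_sum _ _ v _ s P (fun i => (F i)@_m)
  (fun x => A (x + mnm_weight w m)%E)).
- by rewrite addye ?mnm_weight_neqNy.
- by move=> x y xy; apply: Aup; rewrite leeD2r.
- by move=> i Pi; rewrite -trop_termE; exact: AF.
Qed.

Lemma trop_termD (A : \bar R -> Prop) f g m :
  (forall x y, (x <= y)%E -> A x -> A y) ->
  A (trop_term v w f m) -> A (trop_term v w g m) ->
  A (trop_term v w (f + g) m).
Proof.
move=> Aup; rewrite !trop_termE mcoeffD => Af Ag.
have := vfunD v f@_m g@_m; rewrite minElt; case: ifP => _ le1.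
  by apply: Aup Af; exact: leeD2r.
by apply: Aup Ag; exact: leeD2r.
Qed.

(** The conditions may depend on the monomial, so that the same expansion of the product controls
    weights and, in [orbit_homog_comp], degrees. *)
Lemma trop_termM (A B C : 'X_{1..N} -> \bar R -> Prop) f g :
  (forall m, C m +oo%E) ->
  (forall m x y, (x <= y)%E -> C m x -> C m y) ->
  (forall m1 m2 x y, A m1 x -> B m2 y -> C (m1 + m2)%MM (x + y)%E) ->
  (forall m, A m (trop_term v w f m)) -> (forall m, B m (trop_term v w g m)) ->
  forall m, C m (trop_term v w (f * g) m).
Proof.
move=> Coo Cup ABC Af Bg m; rewrite mpolyME.
apply: trop_term_sum => // [x y|[m1 m2] _ /=]; first exact: Cup.
rewrite trop_termX //; case: eqP => // <-.
by rewrite vfunM mnm_weightD addeACA -!trop_termE; apply: ABC.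
Qed.

Lemma trop_termC c m : (v c <= trop_term v w c%:MP m)%E.
Proof.
rewrite -alg_mpolyC -mpolyX0 trop_termX //; case: eqP => _; last by rewrite leey.
by rewrite mnm_weight0 adde0.
Qed.

End Bounds.

(** The minimum ranges over all monomials, those outside the support weighing +oo. The value [c] is
    real, so an isolated term involves no infinite coordinate. *)
Definition isolated w f m (c : R) : Prop :=
  trop_term v w f m = c%:E /\
  forall m', m' != m -> (c%:E < trop_term v w f m')%E.

Section Isolated.
Context (w : 'I_N -> \bar R) (w0 : forall i, w i != -oo%E).

Lemma isolatedD f g m c : isolated w f m c ->
  (forall m', c%:E < trop_term v w g m')%E -> isolated w (f + g) m c.
Proof.
move=> [fm fm'] gc; split=> [|m' mm']; last first.
  rewrite trop_termE mcoeffD.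
  have := vfunD v f@_m' g@_m'; rewrite minElt; case: ifP => _ le1.
    apply: lt_le_trans (fm' _ mm') _; rewrite trop_termE; exact: leeD2r.
  apply: lt_le_trans (gc m') _; rewrite trop_termE; exact: leeD2r.
rewrite trop_termE mcoeffD vfunD_lt -?trop_termE //.
have := gc m; rewrite -fm !trop_termE => lt1.
by rewrite ltNge; apply: contraTN lt1 => le1; rewrite -leNgt leeD2r.
Qed.

Lemma isolatedX a m c : (v a + mnm_weight w m)%E = c%:E ->
  isolated w (a *: 'X_[m]) m c.
Proof.
move=> ac; split; first by rewrite trop_termX // eqxx.
by move=> m' mm'; rewrite trop_termX // eq_sym (negbTE mm') ltry.
Qed.

Lemma isolatedZ a r f m c : v a = r%:E -> isolated w f m c ->
  isolated w (a *: f) m (r + c).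
Proof.
move=> ar [fm fm']; split; first by rewrite trop_termZ ar fm.
by move=> m' mm'; rewrite trop_termZ ar EFinD lteD2lE // fm'.
Qed.

Lemma isolated_split f m c : isolated w f m c ->
  exists f', f = f@_m *: 'X_[m] + f' /\ forall m', (c%:E < trop_term v w f' m')%E.
Proof.
move=> [fm fm']; exists (f - f@_m *: 'X_[m]); split; first by rewrite subrKC.
move=> m'; have [->|mm'] := eqVneq m' m.
  by rewrite trop_term_out ?ltry // mcoeffB mcoeffZ mcoeffX eqxx mulr1 subrr.
rewrite trop_termE mcoeffB mcoeffZ mcoeffX eq_sym (negbTE mm') mulr0 subr0.
by rewrite -trop_termE fm'.
Qed.

Lemma isolated_ge f m c : isolated w f m c ->
  forall m', (c%:E <= trop_term v w f m')%E.
Proof.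
move=> [fm fm'] m'; have [->|/fm'/ltW//] := eqVneq m' m.
by rewrite fm.
Qed.

(** Split the isolated term off each factor. The product of the two terms weighs [c + c'] and every
    other partial product weighs strictly more, so nothing can cancel it. *)
Lemma isolatedM f g m m' c c' : isolated w f m c -> isolated w g m' c' ->
  isolated w (f * g) (m + m')%MM (c + c').
Proof.
move=> isof isog.
have [f' [fE f'c]] := isolated_split isof.
have [g' [gE g'c]] := isolated_split isog.
have -> : f * g = (f@_m * g@_m') *: 'X_[m + m'] + (f@_m *: 'X_[m] * g' + f' * g).
  rewrite [in LHS]fE mulrDl [in X in X + _ = _]gE mulrDr -addrA; congr (_ + _).
  by rewrite mpolyXD -scalerAl -scalerAr scalerA.
apply: isolatedD.
  apply: isolatedX; rewrite vfunM mnm_weightD addeACA -!trop_termE.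
  by case: isof => -> _; case: isog => -> _.
move=> m1.
have lt_up x y z : (x <= y -> z < x -> z < y)%E by move=> xy zx; exact: lt_le_trans xy.
pose C (_ : 'X_{1..N}) (x : \bar R) := ((c + c')%:E < x)%E.
apply: (@trop_termD _ (C m1)) => [x y /lt_up||]; first exact; last first.
  apply: (trop_termM w0 (C := C) (A := fun _ x => (c%:E < x)%E) (B := fun _ x => (c'%:E <= x)%E)) => //.
  - by move=> ?; exact: ltry.
  - by move=> ? x y /lt_up; apply.
  - by move=> ? ? x y cx cy; rewrite /C EFinD lte_leD.
  - exact: isolated_ge isog.
apply: (trop_termM w0 (C := C) (A := fun _ x => (c%:E <= x)%E) (B := fun _ x => (c'%:E < x)%E)) => //.
- by move=> ?; exact: ltry.
- by move=> ? x y /lt_up; apply.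
- by move=> ? ? x y cx cy; rewrite /C EFinD lee_ltD.
- apply: (isolated_ge (m := m)); apply: isolatedX; rewrite -trop_termE.
  by case: isof.
Qed.

End Isolated.
End TropicalTerms.

Lemma seq_argmin (R : realType) (T : eqType) (s : seq T) (F : T -> \bar R) t :
  t \in s -> exists2 t1, t1 \in s & forall t2, t2 \in s -> (F t1 <= F t2)%E.
Proof.
elim: s t => // a s IH t _; case: s IH => [|b s] IH.
  by exists a; rewrite ?mem_head // => t2; rewrite inE => /eqP ->.
have [t1 t1s t1P] := IH b (mem_head _ _).
have [le1|/ltW le1] := leP (F a) (F t1).
  exists a; first exact: mem_head.
  by move=> t2; rewrite inE => /predU1P[->//|/t1P]; apply: le_trans.
exists t1; first by rewrite inE t1s orbT.
by move=> t2; rewrite inE => /predU1P[->//|/t1P].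
Qed.

Lemma min_oo_or_twiceP (R : realType) (T : eqType) (s : seq T)
    (F : T -> \bar R) :
  min_oo_or_twice s F <->
  ~ exists t0, [/\ t0 \in s, F t0 != +oo%E &
                   forall t, t \in s -> t != t0 -> (F t0 < F t)%E].
Proof.
split=> [[Foo|[t1 [t2 [t1s t2s t12 F12 Fmin]]]] [t0 [t0s F0 t0P]]|H].
- by move: F0; rewrite Foo ?eqxx.
- have [t10|t10] := eqVneq t1 t0; last first.
    by have := lt_le_trans (t0P _ t1s t10) (Fmin _ t0s); rewrite ltxx.
  have := t0P _ t2s; rewrite eq_sym -t10 t12 F12 ltxx => /(_ isT) //.
- have [Foo|/existsNP[t /not_implyP[ts Ft]]] :=
    pselect (forall t, t \in s -> F t = +oo%E); first by left.
  right; have [t1 t1s t1P] := seq_argmin F ts.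
  have F1 : F t1 != +oo%E.
    by apply/eqP => F1; have := t1P _ ts; rewrite F1 leye_eq => /eqP.
  have /existsNP[t2] : ~ forall t, t \in s -> t != t1 -> (F t1 < F t)%E.
    by move=> t1m; apply: H; exists t1.
  move=> /not_implyP[t2s /not_implyP[t21 /negP]]; rewrite -leNgt => F21.
  exists t1, t2; split=> //; first by rewrite eq_sym.
  by apply/eqP; rewrite eq_le F21 t1P.
Qed.

(** * Membership in a tropicalization, tested on isolated terms *)

Section Tropicalization.
Context (k : fieldType) (R : realType) (v : valuation k R) (N : nat).
Implicit Types (w : 'I_N -> \bar R) (f g : {mpoly k[N]}) (m : 'X_{1..N}).

Lemma mnm_weight_eqy w m i : (forall i, w i != -oo%E) ->
  w i = +oo%E -> m i != 0%N -> mnm_weight w m = +oo%E.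
Proof.
move=> w0 wi; rewrite -lt0n => mi; rewrite /mnm_weight (bigD1 i) //= wi.
have -> : +oo%E *+ m i = +oo%E :> \bar R.
  by case: (m i) mi => // j _; rewrite mulrS addye // natmul_neqNy.
rewrite [LHS]addye //.
apply/negP => /eqP/esum_eqNyP[j [_ _]] /eqP.
by apply/negP/natmul_neqNy.
Qed.

Lemma mnm_weight_fin w m : (forall i, w i != -oo%E) ->
  (forall i, w i = +oo%E -> m i = 0%N) -> mnm_weight w m \is a fin_num.
Proof.
move=> w0 wm; rewrite /mnm_weight; elim/big_ind: _ => // [x y|i _].
  by move=> xf yf; rewrite fin_numD xf yf.
case wi : (w i) => [r||]; first by rewrite EFin_mulrn.
  by rewrite wm.
by have := w0 i; rewrite wi.
Qed.

Lemma mcoeff_restrict_orbit (I : {set 'I_N}) g m :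
  (restrict_orbit I g)@_m = if [forall i in I, m i == 0%N] then g@_m else 0.
Proof.
pose off m := [forall i in I, m i == 0%N].
have prodE (u : 'X_{1..N}) : \prod_(i < N) tnth [tuple (if i \in I then 0 else 'X_i) : {mpoly k[N]} | i < N] i ^+ u i
    = if off u then 'X_[u] else 0.
  case: ifPn => [/forall_inP offu|/forall_inPn[i iI ui]].
    rewrite mpolyXE_id; apply: eq_bigr => i _; rewrite tnth_mktuple.
    by case: ifP => // /offu /eqP ->; rewrite !expr0.
  by rewrite (bigD1 i) //= tnth_mktuple iI expr0n (negbTE ui) mul0r.
rewrite /restrict_orbit comp_mpolyE raddf_sum /=.
under eq_bigr do rewrite prodE mcoeffZ.
rewrite -/(off m); have [mg|mg] := boolP (m \in msupp g); last first.
  rewrite big_seq big1 ?(memN_msupp_eq0 mg) ?if_same // => u ug.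
  case: ifP => _; rewrite ?mcoeff0 ?mulr0 // mcoeffX; case: eqP => [um|]; last by rewrite mulr0.
  by move: mg; rewrite -um ug.
rewrite (bigD1_seq m) ?msupp_uniq //= big1 ?addr0 => [|u um].
  by case: ifP => _; rewrite ?mcoeffX ?eqxx ?mulr1 // mcoeff0 mulr0.
by case: ifP => _; rewrite ?mcoeff0 ?mulr0 // mcoeffX (negbTE um) mulr0.
Qed.

Lemma trop_orbit_neqNy (I : {set 'I_N}) w : trop_orbit I w -> forall i, w i != -oo%E.
Proof. by move=> Iw i; case: (Iw i). Qed.

Lemma trop_term_restrict (I : {set 'I_N}) w g m : trop_orbit I w ->
  trop_term v w (restrict_orbit I g) m = trop_term v w g m.
Proof.
move=> Iw; have w0 := trop_orbit_neqNy Iw.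
rewrite !trop_termE mcoeff_restrict_orbit; case: ifPn => // /forall_inPn[i iI mi].
rewrite (mnm_weight_eqy (i := i)) //; last first.
  by have [_] := Iw i; rewrite iI => /eqP.
by rewrite !addey ?vfun_neqNy.
Qed.

(* Homogeneity of [g] as a function on the torus orbit of [w]. *)
Definition orbit_homog w g :=
  exists e, forall m, trop_term v w g m != +oo%E -> mdeg m = e.

Lemma isolated_msupp w f m c : (forall i, w i != -oo%E) ->
  isolated v w f m c -> m \in msupp f.
Proof.
move=> w0 [fm _]; rewrite mcoeff_msupp; apply/eqP => f0.
by move: fm; rewrite trop_term_out.
Qed.

(** Restriction to the orbit of [w] only removes terms of weight +oo, so it keeps an isolated term
    and turns [orbit_homog] into genuine homogeneity. *)
Lemma trop_not_isolated (J : set {mpoly k[N]}) w g m c :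
  trop v J w -> J g -> orbit_homog w g -> ~ isolated v w g m c.
Proof.
move=> [I [_ Iw Jw]] Jg [e ge] isog; have w0 := trop_orbit_neqNy Iw.
pose f := restrict_orbit I g.
have isof : isolated v w f m c.
  case: isog => [gm gm']; split; first by rewrite trop_term_restrict.
  by move=> m' mm'; rewrite trop_term_restrict // gm'.
have fJ : orbit_ideal J I f.
  by exists 0%MM, g; split=> // [i _|]; rewrite ?mnm0E // mpolyX0 mul1r.
have /(Jw _ fJ)/min_oo_or_twiceP[] : exists e, f \is e.-homog.
  exists e; apply/dhomogP => u uf; apply: ge.
  rewrite -(trop_term_restrict _ _ Iw) -/f; move: uf; rewrite mcoeff_msupp trop_termE => uf.
  rewrite adde_Neq_pinfty ?vfun_neqNy ?mnm_weight_neqNy // vfun_eqy uf /=.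
  have : mnm_weight w u \is a fin_num; last by move=> /fin_numP[].
  apply: mnm_weight_fin => // i wi; apply/eqP; move: uf.
  rewrite mcoeff_restrict_orbit; case: ifP => [/forall_inP offu _|]; last by rewrite eqxx.
  by apply: offu; have [_ <-] := Iw i; rewrite wi.
exists m; case: (isof) => fm fm'; split; first exact: isolated_msupp isof.
  by rewrite fm.
by move=> t tf tm; rewrite fm fm'.
Qed.

(** An isolated term of [f] in the orbit ideal becomes one of [g] after multiplication by ['X_[u]],
    whose weight is finite on the orbit. Only the restriction of [g] to the orbit is known to be
    homogeneous, hence [orbit_homog] in the criterion. *)
Lemma tropI (J : set {mpoly k[N]}) w : trop_point w ->
  (forall g m c, J g -> orbit_homog w g -> ~ isolated v w g m c) -> trop v J w.
Proof.
move=> [w0 [i0 wi0]] H; pose I := [set i | w i == +oo%E]%SET.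
have Iw : trop_orbit I w by move=> i; rewrite inE.
exists I; split=> //.
  by apply/properP; split; [exact: finset.subsetT | exists i0; rewrite inE].
move=> f [u [g [uI Jg fg]]] [e fe]; apply/min_oo_or_twiceP => -[m [mf fm fm']].
have [c fmc] : exists c, trop_term v w f m = c%:E.
  by move: fm (trop_term_neqNy v f m w0); case: trop_term => // r; exists r.
have isof : isolated v w f m c.
  split=> // m' mm'; have [m'f|m'f] := boolP (m' \in msupp f).
    by rewrite -fmc fm'.
  by rewrite trop_term_out ?ltry //; exact: memN_msupp_eq0.
have [d ud] : exists d, mnm_weight w u = d%:E.
  apply/EFin_fin_numP; apply: mnm_weight_fin => // i wi.
  by apply: uI; rewrite inE wi.
have isou : isolated v w 'X_[u] u d.
  by rewrite -[X in isolated _ _ X]scale1r; apply: isolatedX => //; rewrite vfun1 add0e.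
have := isolatedM w0 isou isof; rewrite fg => isor.
apply: (H g (u + m)%MM (d + c) Jg); last first.
  case: isor => [gm gm']; split; first by rewrite -(trop_term_restrict _ _ Iw).
  by move=> m' mm'; rewrite -(trop_term_restrict _ _ Iw) gm'.
exists (mdeg u + e)%N => m1; rewrite -(trop_term_restrict _ _ Iw) -fg => m1P.
have : 'X_[u] * f \is (mdeg u + e).-homog by rewrite dhomogM // dhomogX.
move=> /dhomogP; apply; rewrite mcoeff_msupp; apply: contra m1P => /eqP m1f.
by rewrite trop_term_out.
Qed.

End Tropicalization.

(** * Transport of isolated terms along a substitution *)

Section Substitution.
Context (k : fieldType) (R : realType) (v : valuation k R) (N N' : nat).
Context (w : 'I_N -> \bar R) (w0 : forall i, w i != -oo%E).
Context (x : 'I_N' -> \bar R) (x0 : forall i, x i != -oo%E).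
Context (y : 'I_N' -> {mpoly k[N]}).
Hypothesis y_ge : forall i m, (x i <= trop_term v w (y i) m)%E.

Let ge (f : {mpoly k[N]}) (X : \bar R) := forall m, (X <= trop_term v w f m)%E.

Let geC c : ge c%:MP (v c).
Proof. by move=> m; exact: trop_termC. Qed.

Let geM f g X Y : ge f X -> ge g Y -> ge (f * g) (X + Y)%E.
Proof.
move=> fX gY; apply: (trop_termM w0 (C := fun _ Z => (X + Y <= Z)%E)
  (A := fun _ Z => (X <= Z)%E) (B := fun _ Z => (Y <= Z)%E)) => //.
- by move=> _; rewrite leey.
- by move=> _ a b ab /le_trans; apply.
- by move=> _ _ a b; exact: leeD.
Qed.

Let ge_prod (u : 'X_{1..N'}) : ge (\prod_i y i ^+ u i) (mnm_weight x u).
Proof.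
have ge1 : ge 1 0%E by have := geC 1; rewrite vfun1.
apply: (big_ind2 ge) => [||i _]; [exact: ge1 | move=> *; exact: geM |].
by elim: (u i) => // n IH; rewrite exprS mulrS; apply: geM.
Qed.

Let ge_term c (u : 'X_{1..N'}) : ge (c *: \prod_i y i ^+ u i) (v c + mnm_weight x u)%E.
Proof. by rewrite -mul_mpolyC; apply: geM. Qed.

(** The image of the isolated term is a product of isolated terms, and [y_ge] keeps the images of
    all other terms above [c]. Coordinates with [x i] infinite need no isolated term, since they
    have exponent 0 in [m]. *)
Lemma isolated_comp g m c :
  (forall i, x i != +oo%E -> exists m1 c1, x i = c1%:E /\ isolated v w (y i) m1 c1) ->
  isolated v x g m c ->
  exists m1, isolated v w (g \mPo [tuple y i | i < N']) m1 c.
Proof.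
move=> y_iso isog; have mg := isolated_msupp x0 isog; case: isog => gm gm'.
pose iso f X := exists m1 c1, X = c1%:E /\ isolated v w f m1 c1.
have isoC a : a != 0 -> iso a%:MP (v a).
  move=> a0; have /EFin_fin_numP[r ar] := vfun_fin v a0.
  exists 0%MM, r; split=> //; rewrite -alg_mpolyC -mpolyX0.
  by apply: isolatedX => //; rewrite mnm_weight0 adde0.
have isoM f1 X1 f2 X2 : iso f1 X1 -> iso f2 X2 -> iso (f1 * f2) (X1 + X2)%E.
  move=> [m1 [c1 [-> i1]]] [m2 [c2 [-> i2]]].
  by exists (m1 + m2)%MM, (c1 + c2); split=> //; exact: isolatedM.
have iso1 : iso 1 0%E by have := isoC 1 (oner_neq0 _); rewrite vfun1.
have [m1 [c1 [mc1 isom]]] : iso (g@_m *: \prod_i y i ^+ m i) (trop_term v x g m).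
  rewrite trop_termE -mul_mpolyC; apply: (isoM).
    by apply: (isoC); rewrite -mcoeff_msupp.
  apply: (big_ind2 iso) => // i _.
  have [xi|xi] := eqVneq (x i) +oo%E.
    suff -> : m i = 0%N by rewrite expr0 mulr0n.
    apply/eqP; apply: contraT => mi.
    by move: gm; rewrite trop_termE (mnm_weight_eqy _ xi) // addey ?vfun_neqNy.
  by elim: (m i) => // n IH; rewrite exprS mulrS; apply: (isoM) => //; exact: y_iso.
have cc1 : c = c1 by apply: EFin_inj; rewrite -gm.
exists m1; rewrite comp_mpolyE (bigD1_seq m) ?msupp_uniq //=.
under eq_bigr do rewrite tnth_mktuple.
apply: isolatedD => //; first by rewrite cc1.
move=> m'; apply: (trop_term_sum w0 (A := fun Z => (c%:E < Z)%E)).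
- exact: ltry.
- by move=> a b ab ca; exact: lt_le_trans ab.
move=> u um; under eq_bigr do rewrite tnth_mktuple.
apply: lt_le_trans (ge_term _ _ m'); rewrite -trop_termE; exact: gm'.
Qed.

(** By [y_ge], a term of [g] of infinite weight at [x] contributes only terms of infinite weight at
    [w]. Every other term has degree [e], which linear forms preserve. *)
Lemma orbit_homog_comp g : (forall i, y i \is 1.-homog) -> orbit_homog v x g ->
  orbit_homog v w (g \mPo [tuple y i | i < N']).
Proof.
move=> y1 [e ge_e]; exists e => m1.
pose D e f := forall m, trop_term v w f m = +oo%E \/ mdeg m = e.
suff : D e (g \mPo [tuple y i | i < N']) by move=> /(_ m1)[->|].
have DM e1 e2 f1 f2 : D e1 f1 -> D e2 f2 -> D (e1 + e2)%N (f1 * f2).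
  move=> D1 D2.
  apply: (trop_termM w0 (C := fun m (Z : \bar R) => Z = +oo%E \/ mdeg m = (e1 + e2)%N)
    (A := fun m Z => Z != -oo%E /\ (Z = +oo%E \/ mdeg m = e1))
    (B := fun m Z => Z != -oo%E /\ (Z = +oo%E \/ mdeg m = e2))).
  - by left.
  - by move=> m a b ab [aoo|]; [left; apply/eqP; rewrite -leye_eq -aoo | right].
  - move=> m m' a b [a0 ae] [b0 be].
    case: ae => [->|ae]; first by left; rewrite addye.
    case: be => [->|be]; first by left; rewrite addey.
    by right; rewrite mdegD ae be.
  - by move=> m; split; [exact: trop_term_neqNy | exact: D1].
  - by move=> m; split; [exact: trop_term_neqNy | exact: D2].
have Dhomog e1 f : f \is e1.-homog -> D e1 f.
  move=> /dhomogP fe m; have [mf|mf] := boolP (m \in msupp f).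
    by right; exact: fe.
  by left; apply: trop_term_out => //; exact: memN_msupp_eq0.
rewrite comp_mpolyE => m; apply: (@trop_term_sum _ _ v _ w w0 (fun Z => Z = +oo%E \/ mdeg m = e)).
- by left.
- by move=> a b ab [aoo|]; [left; apply/eqP; rewrite -leye_eq -aoo | right].
move=> u _; under eq_bigr do rewrite tnth_mktuple.
have [gu|gu] := eqVneq (trop_term v x g u) +oo%E.
  left; apply/eqP; rewrite -leye_eq -gu trop_termE; exact: ge_term.
rewrite -(ge_e _ gu) (mdegE u) -mul_mpolyC -[X in mdeg m = X]add0n.
apply: (DM); first by apply: (Dhomog); rewrite -alg_mpolyC; apply/dhomogZ/dhomog1.
apply: (big_ind2 (fun f e => D e f)) => [|*|i _].
- exact/Dhomog/dhomog1.
- exact: DM.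
- by apply: (Dhomog); have := dhomogMn (u i) (y1 i); rewrite mul1n.
Qed.

End Substitution.

Section Perturbation.
Context (R : realType).

Lemma eventually_all (T : eqType) (s : seq T) (P : T -> R -> Prop) :
  (forall t, t \in s -> exists2 e0, 0 < e0 & forall e, 0 < e < e0 -> P t e) ->
  exists2 e0, 0 < e0 & forall e, 0 < e < e0 -> forall t, t \in s -> P t e.
Proof.
elim: s => [|a s IH] H; first by exists 1.
have [e1 e10 e1P] := H a (mem_head _ _).
have [t ts|e2 e20 e2P] := IH; first by apply: H; rewrite inE ts orbT.
exists (Num.min e1 e2); first by rewrite lt_min e10.
move=> e /andP[e0]; rewrite lt_min => /andP[ee1 ee2] t.
by rewrite inE => /predU1P[->|]; [apply: e1P | apply: e2P]; rewrite e0.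
Qed.

Lemma eventually_ltD (a b : \bar R) (p q : R) : (a < b)%E ->
  exists2 e0, 0 < e0 &
    forall e, 0 < e < e0 -> (a + (e * p)%:E < b + (e * q)%:E)%E.
Proof.
case: a b => [r||] [s||] //=; try by exists 1 => // e _; rewrite ?ltry ?ltNyr.
(* The summand 1 keeps the divisor positive when [p] and [q] vanish. *)
rewrite lte_fin => rs; pose d := `|p| + `|q| + 1.
have d0 : 0 < d by rewrite /d; have := normr_ge0 p; have := normr_ge0 q; lra.
exists ((s - r) / d); first by rewrite divr_gt0 // subr_gt0.
move=> e /andP[e0]; rewrite ltr_pdivlMr // => ed.
have hp := ler_norm p; have := ler_norm (- q); rewrite normrN => hq.
rewrite -!EFinD lte_fin.
have : e * (p - q) <= e * (`|p| + `|q|) by rewrite ler_pM2l //; lra.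
by move: ed; rewrite /d !mulrDr mulrN; lra.
Qed.

Lemma isolated_perturb (k : fieldType) (v : valuation k R) (N : nat)
    (w : 'I_N -> \bar R) (b : 'I_N -> R) g m c : (forall i, w i != -oo%E) ->
  isolated v w g m c ->
  exists2 e0, 0 < e0 & forall e, 0 < e < e0 ->
    exists c', isolated v (fun i => w i + (e * b i)%:E)%E g m c'.
Proof.
move=> w0 isog; have mg := isolated_msupp w0 isog; case: isog => gm gm'.
pose B (m : 'X_{1..N}) := \sum_i b i *+ m i.
have tE e u : trop_term v (fun i => w i + (e * b i)%:E)%E g u =
    (trop_term v w g u + (e * B u)%:E)%E.
  rewrite !trop_termE -addeA; congr (_ + _)%E.
  rewrite mulr_sumr -sumEFin -big_split /=; apply: eq_bigr => i _.
  by rewrite mulrnDl EFin_mulrn -mulrnAr.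
have [u ug|e0 e00 e0P] := @eventually_all _ (msupp g)
   (fun u e => u != m -> (c%:E + (e * B m)%:E < trop_term v w g u + (e * B u)%:E)%E).
  have [->|um] := eqVneq u m; first by exists 1.
  by have [e0 e00 e0P] := eventually_ltD (B m) (B u) (gm' _ um); exists e0 => // e ee _; exact: e0P.
exists e0 => // e ee; exists (c + e * B m); split; first by rewrite tE gm.
move=> u um; have [ug|ug] := boolP (u \in msupp g).
  by rewrite tE EFinD; exact: e0P.
rewrite trop_term_out ?ltry ?memN_msupp_eq0 // => i.
by rewrite adde_eq_ninfty negb_or w0.
Qed.

End Perturbation.

(** * Plucker forms *)

Lemma rmorph_mmap (n : nat) (A B : nzRingType) (k : nzRingType) (phi : {rmorphism A -> B})
    (f : k -> A) (h : 'I_n -> A) (g : {mpoly k[n]}) :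
  phi (mmap f h g) = mmap (phi \o f) (phi \o h) g.
Proof.
rewrite /mmap rmorph_sum; apply: eq_bigr => m _ /=.
rewrite rmorphM /mmap1 rmorph_prod; congr (_ * _).
by apply: eq_bigr => i _; rewrite rmorphXn.
Qed.

Lemma eq_mmap (n : nat) (A : nzRingType) (k : nzRingType)
    (f f' : k -> A) (h h' : 'I_n -> A) (g : {mpoly k[n]}) :
  f =1 f' -> h =1 h' -> mmap f h g = mmap f' h' g.
Proof.
move=> ff hh; rewrite /mmap; apply: eq_bigr => m _; rewrite ff; congr (_ * _).
by apply: eq_bigr => i _; rewrite hh.
Qed.

Lemma mmap_in_algE (k : fieldType) N (x : 'I_N -> k) (f : {mpoly k[N]}) :
  mmap (in_alg k^o) x f = f.@[x].
Proof. by rewrite /meval; apply: eq_mmap => // y; rewrite /= [y%:A]mulr1. Qed.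

Section Plucker.
Context (k : fieldType) (d n : nat).

Let plucker_perm (h : 'I_d.+1 -> 'I_n.+1) (s : plucker_index d n) (t : 'S_d.+1) :=
  [forall j, h j == plucker_cols s (t j)].

(* The sign is that of the permutation sorting [h]; the form is 0 if [h] is not injective. *)
Definition plucker_form (h : 'I_d.+1 -> 'I_n.+1) : {mpoly k[plucker_num d n]} :=
  if insub (h @: 'I_d.+1)%SET is Some s then
    (-1) ^+ [exists t : 'S_d.+1, odd_perm t && plucker_perm h s t] *:
      'X_(enum_rank (s : plucker_index d n))
  else 0.

Lemma plucker_cols_inj (s : plucker_index d n) : injective (plucker_cols s).
Proof. by move=> a b /enum_val_inj/cast_ord_inj. Qed.

Lemma plucker_cols_imset (s : plucker_index d n) :
  [set plucker_cols s j | j in 'I_d.+1]%SET = val s.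
Proof.
apply/eqP; rewrite eqEcard (eqP (valP s)) card_imset ?card_ord ?leqnn ?andbT //; last first.
  exact: plucker_cols_inj.
by apply/fintype.subsetP => _ /imsetP[j _ ->]; exact: enum_valP.
Qed.

Lemma plucker_permP (h : 'I_d.+1 -> 'I_n.+1) (s : plucker_index d n) :
  (h @: 'I_d.+1)%SET = val s -> exists t, h =1 plucker_cols s \o (t : 'S_d.+1).
Proof.
move=> hs.
have hin j : h j \in codom (plucker_cols s).
  have : h j \in (h @: 'I_d.+1)%SET by apply: imset_f.
  by rewrite hs -plucker_cols_imset => /imsetP[a _ ->]; exact: codom_f.
pose t j := iinv (hin j).
have ht j : plucker_cols s (t j) = h j by exact: f_iinv.
have t_inj : injective t.
  have h_inj : injective h.
    suff /imset_injP H : #|(h @: 'I_d.+1)%SET| == #|'I_d.+1| by move=> a b; exact: H.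
    by rewrite hs (eqP (valP s)) card_ord.
  by move=> a b tab; apply: h_inj; rewrite -!ht tab.
by exists (perm t_inj) => j /=; rewrite permE ht.
Qed.

(** For unsorted columns the sign is that of the sorting permutation; a repeated column makes both
    sides 0. Minors can thus be written for arbitrary column maps such as [fcons]. *)
Lemma mmap_plucker_form (S : comAlgType k) (M : 'M[S]_(d.+1, n.+1)) h :
  mmap (in_alg S) (plucker M) (plucker_form h) = \det (colsub h M).
Proof.
rewrite /plucker_form; case: insubP => [s _ hs|]; last first.
  have -> : (#|(h @: 'I_d.+1)%SET| == d.+1) = injectiveb h.
    rewrite -[X in _ == X]card_ord.
    by apply/imset_injP/injectiveP => H a b; [exact: H | move=> _ _; exact: H].
  move=> /injectivePn[a [b ab hab]].
  by rewrite mmap0 -det_tr (determinant_alternate ab) // => j; rewrite !mxE hab.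
have [t ht] := plucker_permP (esym hs).
have -> : [exists t : 'S_d.+1, odd_perm t && plucker_perm h s t] = odd_perm t.
  apply/existsP/idP => [[t' /andP[ot /forallP t'P]]|ot]; last first.
    by exists t; rewrite ot; apply/forallP => j; rewrite ht.
  suff <- : t' = t by [].
  by apply/permP => j; apply: (@plucker_cols_inj s); rewrite -(eqP (t'P j)) ht.
rewrite mmapZ mmapX mmap1U rmorph_sign /plucker enum_rankK.
have -> : colsub h M = col_perm t (colsub (plucker_cols s) M).
  by apply/matrixP => a j; rewrite !mxE ht.
by rewrite col_permE det_mulmx det_perm odd_permV mulrC.
Qed.

Lemma meval_plucker_form (M : 'M[k]_(d.+1, n.+1)) h :
  (plucker_form h).@[plucker M] = \det (colsub h M).
Proof. by rewrite -mmap_in_algE (mmap_plucker_form (S := k^o)). Qed.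

Lemma plucker_form_homog h : plucker_form h \is 1.-homog.
Proof.
rewrite /plucker_form; case: insub => [s|]; last exact: dhomog0.
by apply: dhomogZ; rewrite dhomogX /= mdeg1.
Qed.

Section PluckerFormTrop.
Context (R : realType) (v : valuation k R) (p : 'I_(plucker_num d n) -> \bar R).
Hypothesis p0 : forall i, p i != -oo%E.

Lemma plucker_coord_neqNy (sigma : {set 'I_n.+1}) : plucker_coord p sigma != -oo%E.
Proof. by rewrite /plucker_coord; case: insub. Qed.

Lemma plucker_form_ge h m :
  (plucker_coord p (h @: 'I_d.+1)%SET <= trop_term v p (plucker_form h) m)%E.
Proof.
rewrite /plucker_coord /plucker_form; case: insub => [s|]; last first.
  by rewrite trop_term_out ?mcoeff0.
by rewrite trop_termX // vfun_sign add0e mnm_weightU; case: eqP => // _; rewrite leey.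
Qed.

Lemma plucker_form_isolated h c : plucker_coord p (h @: 'I_d.+1)%SET = c%:E ->
  exists m, isolated v p (plucker_form h) m c.
Proof.
rewrite /plucker_coord /plucker_form; case: insub => [s|//] ps.
by eexists; apply: isolatedX => //; rewrite vfun_sign add0e mnm_weightU.
Qed.

Lemma plucker_coord_card sigma : plucker_coord p sigma != +oo%E -> #|sigma| = d.+1.
Proof. by rewrite /plucker_coord; case: insubP => [s /eqP|]; rewrite ?eqxx. Qed.

Lemma plucker_coord_enum (s : plucker_index d n) :
  plucker_coord p (val s) = p (enum_rank s).
Proof. by rewrite /plucker_coord valK. Qed.

End PluckerFormTrop.

Definition fcons (j : 'I_n.+1) (r : 'I_d -> 'I_n.+1) (a : 'I_d.+1) : 'I_n.+1 :=
  oapp r j (unlift ord0 a).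

Lemma fcons_imset j r : (fcons j r @: 'I_d.+1 = j |: r @: 'I_d)%SET.
Proof.
apply/setP => i; rewrite !inE; apply/imsetP/predU1P => [[a _ ->]|[->|/imsetP[a _ ->]]].
- rewrite /fcons; case: unliftP => [b _|_]; last by left.
  by right; apply: imset_f.
- by exists ord0; rewrite // /fcons unlift_none.
- by exists (lift ord0 a); rewrite // /fcons liftK.
Qed.

Definition fcons_cofactor (S : comNzRingType) (M : 'M[S]_(d.+1, n.+1))
    (r : 'I_d -> 'I_n.+1) (a : 'I_d.+1) : S :=
  (-1) ^+ a * \det (row' a (colsub r M)).

(** Expansion along the first column: the coefficients do not depend on [j], so these minors, with
    [j] varying, form a vector of the row space of [M], the cocircuit of [r]. *)
Lemma det_fcons (S : comNzRingType) (M : 'M[S]_(d.+1, n.+1)) j r :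
  \det (colsub (fcons j r) M) = \sum_a M a j * fcons_cofactor M r a.
Proof.
rewrite (expand_det_col _ ord0); apply: eq_bigr => a _.
rewrite /cofactor addn0 !mxE /fcons unlift_none; congr (_ * (_ * _)).
by congr (\det _); apply/matrixP => i l; rewrite !mxE liftK.
Qed.

(** The cocircuit of [r], restricted to the columns [h], is a combination of the rows of [B]. Adding
    it as a first row gives determinant 0, and expansion along that row is the relation. *)
Lemma plucker_relation (S : comNzRingType) (M : 'M[S]_(d.+1, n.+1))
    (r : 'I_d -> 'I_n.+1) (h : 'I_d.+2 -> 'I_n.+1) :
  \sum_(b < d.+2) (-1) ^+ b *
    (\det (colsub (fcons (h b) r) M) * \det (colsub (h \o lift b) M)) = 0.
Proof.
pose C : 'rV[S]_d.+1 := \row_a fcons_cofactor M r a.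
pose B := colsub h M.
pose A : 'M[S]_(1 + d.+1) := col_mx (C *m B) B.
have detA : \det A = 0.
  have : \det (block_mx 1%:M (- C) 0 1%:M *m A) = 0.
    rewrite mul_block_col !mul1mx mul0mx add0r mulNmx subrr.
    rewrite (expand_det_row _ (lshift d.+1 0)) big1 // => j _.
    by rewrite col_mxEu mxE mul0r.
  by rewrite det_mulmx det_ublock !det1 !mul1r.
rewrite -[RHS]detA (expand_det_row _ (lshift d.+1 0)); apply: eq_bigr => b _.
rewrite col_mxEu /cofactor mulrCA; congr (_ * (_ * _)).
  by rewrite det_fcons !mxE; apply: eq_bigr => a _; rewrite !mxE mulrC.
congr (\det _); apply/matrixP => i j; rewrite !mxE.
case: splitP => [i' /= i'E|i' /= /eqP]; first by move: (ltn_ord i'); rewrite -i'E.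
by rewrite /bump /= !add1n eqSS => /eqP/val_inj ->; rewrite mxE.
Qed.

End Plucker.

(** * Tropical linear spaces *)

Lemma dhomog_orbit_homog (k : fieldType) (R : realType) (v : valuation k R) N
    (w : 'I_N -> \bar R) (g : {mpoly k[N]}) e :
  (forall i, w i != -oo%E) -> g \is e.-homog -> orbit_homog v w g.
Proof.
move=> w0 /dhomogP ge; exists e => m gm; apply: ge; apply: contraNT gm => mg.
by rewrite trop_term_out // memN_msupp_eq0.
Qed.

Lemma set_imset_ord (T : finType) (A : {set T}) d : #|A| = d ->
  exists2 r : 'I_d -> T, injective r & (r @: 'I_d)%SET = A.
Proof.
move=> Ad; pose r j := enum_val (cast_ord (esym Ad) j).
have r_inj : injective r by move=> a b /enum_val_inj/cast_ord_inj.
exists r => //; apply/eqP; rewrite eqEcard Ad card_imset // card_ord leqnn andbT.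
by apply/fintype.subsetP => _ /imsetP[j _ ->]; exact: enum_valP.
Qed.

Lemma imset_lift (T : finType) d (h : 'I_d.+1 -> T) b : injective h ->
  ((h \o lift b) @: 'I_d = (h @: 'I_d.+1) :\ h b)%SET.
Proof.
move=> h_inj; apply/setP => i; rewrite !inE; apply/imsetP/andP => [[a _ ->]|[ib /imsetP[a _ ia]]].
  by split; [rewrite (inj_eq h_inj) eq_sym neq_lift | exact: imset_f].
move: ib; rewrite ia (inj_eq h_inj) eq_sym; case/unlift_some => a' aE _.
by exists a' => //=; rewrite aE.
Qed.

Section TropicalLinearSpace.
Context (R : realType) (d n : nat) (p : 'I_(plucker_num d n) -> \bar R).
Implicit Types (x : 'I_n.+1 -> \bar R) (i j : 'I_n.+1) (rho sigma tau : {set 'I_n.+1}).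

Notation pc := (plucker_coord p).

(* Unlike [trop_linear_space], this admits the point with all coordinates +oo. *)
Definition trop_circuits x : Prop := forall tau, #|tau| = d.+2 ->
  min_oo_or_twice (enum tau) (fun i => pc (tau :\ i)%SET + x i)%E.

Lemma trop_circuits_min x y : trop_circuits x -> trop_circuits y ->
  trop_circuits (fun i => Order.min (x i) (y i)).
Proof.
move=> xG yG tau card_tau; apply/min_oo_or_twiceP => -[t [tt Ft tmin]].
wlog xy : x y xG yG Ft tmin / (x t <= y t)%E.
  move=> H; have [|/ltW] := leP (x t) (y t); first exact: (H x y).
  by apply: (H y x) => //; [rewrite minC | move=> u; rewrite ![Order.min (y _) _]minC; exact: tmin].
have /min_oo_or_twiceP[] := xG _ card_tau; exists t.
move: Ft tmin; rewrite (min_idPl xy) => Ft tmin; split=> // u ut u_t.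
apply: lt_le_trans (tmin _ ut u_t) _; apply: leeD2l.
by rewrite ge_min lexx.
Qed.

Lemma trop_circuits_shift x (r : R) : trop_circuits x ->
  trop_circuits (fun i => x i + r%:E)%E.
Proof.
move=> xG tau card_tau; apply/min_oo_or_twiceP => -[t [tt Ft tmin]].
have /min_oo_or_twiceP[] := xG _ card_tau; exists t; split=> //.
  by apply: contra Ft => /eqP; rewrite addeA => ->.
by move=> u ut u_t; have := tmin _ ut u_t; rewrite !addeA lteD2rE.
Qed.

Hypothesis p0 : forall s, p s != -oo%E.

(** In the circuit on [i |: sigma] the term at [i] is finite; since the minimum is attained twice,
    some other term is no larger. *)
Lemma trop_circuits_exchange x sigma i : trop_circuits x ->
  pc sigma != +oo%E -> i \notin sigma -> x i != +oo%E ->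
  exists2 t, t \in sigma &
    (pc (i |: sigma :\ t)%SET + x t <= pc sigma + x i)%E.
Proof.
move=> xG s0 is_ xi; pose tau := (i |: sigma)%SET.
have card_tau : #|tau| = d.+2 by rewrite cardsU1 is_ (plucker_coord_card s0).
have tau_i : (tau :\ i)%SET = sigma by rewrite finset.setU1K.
have Fi : (pc (tau :\ i)%SET + x i != +oo)%E.
  by rewrite tau_i; move: s0 xi; case: (pc sigma) (x i) => [r||] [s||].
have [Foo|[t1 [t2 [t1tau t2tau t12 F12 Fmin]]]] := xG _ card_tau.
  by move: Fi; rewrite Foo ?eqxx // mem_enum setU11.
have [t [ttau ti Ft]] : exists t, [/\ t \in tau, t != i &
    (pc (tau :\ t)%SET + x t <= pc (tau :\ i)%SET + x i)%E].
  have [t1i|t1i] := eqVneq t1 i; last first.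
    by exists t1; split=> //; [rewrite -mem_enum | apply: Fmin; rewrite mem_enum setU11].
  exists t2; split; [by rewrite -mem_enum | by rewrite -t1i eq_sym|].
  by rewrite -F12; apply: Fmin; rewrite mem_enum setU11.
exists t; first by move: ttau; rewrite !inE (negbTE ti).
move: Ft; rewrite tau_i; congr (_ + _ <= _)%E; congr plucker_coord.
by apply/setP => j; rewrite !inE; case: (eqVneq j i) => [->|]; rewrite ?(eq_sym i) ?ti ?orbT //= andbC.
Qed.

(* The basis [i |: rho] minimizes [p_sigma - x(sigma)], where an infinite coordinate of [x] counts as
   larger than every real: this is the matroid of [x], in which [i] is not a loop. *)
Lemma trop_circuits_span x i : (exists s, p s != +oo%E) ->
  trop_point x -> trop_circuits x -> x i != +oo%E ->
  exists2 rho : {set 'I_n.+1}, #|rho| = d & pc (i |: rho)%SET != +oo%E /\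
    forall j, (x j + pc (i |: rho)%SET <= x i + pc (j |: rho)%SET)%E.
Proof.
move=> [s0 ps0] [x0 _] xG xi.
pose I := [set j | x j == +oo%E]%SET.
pose B sigma := pc sigma != +oo%E.
have B0 : B (val (enum_val s0)) by rewrite /B plucker_coord_enum enum_valK.
(* Maximizing the number of infinite coordinates before minimizing [F] is what makes them outweigh
   every real. *)
pose K := #|(([arg max_(s > val (enum_val s0) | B s) #|(s :&: I)%SET|]) :&: I)%SET|.
have [sK BsK Ks] : exists2 s, B s & #|(s :&: I)%SET| = K.
  by rewrite /K; case: arg_maxnP => // s Bs _; exists s.
have Kmax s : B s -> (#|(s :&: I)%SET| <= K)%N.
  by rewrite /K; case: arg_maxnP => // t Bt; apply.
pose O s := B s && (#|(s :&: I)%SET| == K).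
(* [fine +oo] is 0, so only finite coordinates of [x] are subtracted; the infinite ones are equally
   many in all competing bases. *)
pose F s : R := fine (pc s) - \sum_(j in s) fine (x j).
have OK0 : O sK by apply/andP; split=> //; apply/eqP.
have [s Os Fmin] : exists2 s, O s & forall t, O t -> F s <= F t.
  by case: (Order.TotalTheory.arg_minP F OK0) => s Os Fs; exists s.
have pcE sigma : B sigma -> pc sigma = (fine (pc sigma))%:E.
  by move=> Bs; rewrite fineK //; apply/fin_numP; split=> //; exact: plucker_coord_neqNy.
have xE j : x j != +oo%E -> x j = (fine (x j))%:E.
  by move=> xj; rewrite fineK // fin_numE xj x0.
have iI : i \notin I by rewrite inE.
(* A minimizer can be made to contain [i]: the exchange removes some [t] with [x t] finite, which
   keeps the number of infinite coordinates and does not increase [F]. *)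
have {Os Fmin} [s1 Os1 [is1 F1min]] : exists2 s, O s & i \in s /\ forall t, O t -> F s <= F t.
  have [is_|is_] := boolP (i \in s); first by exists s.
  have /andP[Bs /eqP Ks'] := Os.
  have [t ts le_t] := trop_circuits_exchange xG Bs is_ xi.
  have ti : t != i by apply: contraNneq is_ => <-.
  set s' := (i |: s :\ t)%SET in le_t.
  have fin_t : (pc s' != +oo)%E /\ x t != +oo%E.
    move: le_t; rewrite (pcE _ Bs) (xE _ xi).
    have := plucker_coord_neqNy p0 s'; have := x0 t.
    by case: (x t) (pc s') => [a||] [b||].
  have [Bs' xt] := fin_t.
  have Os' : O s'.
    rewrite /O /B Bs' /= -Ks'; apply/eqP; congr #|pred_of_set _|.
    apply/setP => j; rewrite !inE.
    have [->|ji] /= := eqVneq j i; first by rewrite (negbTE xi) andbF.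
    by have [->|jt] /= := eqVneq j t; first by rewrite (negbTE xt) andbF.
  exists s' => //; split; first by rewrite setU11.
  move=> u Ou; apply: le_trans (Fmin _ Ou).
  have its : i \notin (s :\ t)%SET by rewrite !inE (negbTE is_) andbF.
  rewrite /F /s' big_setU1 //= (big_setD1 t ts) /= -/s'.
  have : fine (pc s') + fine (x t) <= fine (pc s) + fine (x i).
    by rewrite -lee_fin !EFinD -!pcE // -!xE.
  by lra.
have /andP[Bs1 /eqP Ks1] := Os1.
pose rho := (s1 :\ i)%SET.
have s1E : (i |: rho)%SET = s1 by rewrite finset.setD1K.
exists rho.
  by apply/eqP; rewrite -eqSS -(plucker_coord_card Bs1) (cardsD1 i s1) is1.
rewrite s1E; split=> // j.
have [->|Bj] := eqVneq (pc (j |: rho)%SET) +oo%E; first by rewrite addey ?x0 ?leey.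
have jrho : j \notin rho.
  have := plucker_coord_card Bj; rewrite cardsU1; case: (j \in rho) => //.
  rewrite add0n => rho_d; have := plucker_coord_card Bs1.
  by rewrite -s1E cardsU1 rho_d !inE eqxx /= => /eqP; rewrite add1n eqn_leq ltnn.
have irho : i \notin rho by rewrite !inE eqxx.
have rhoI : (s1 :&: I)%SET = (rho :&: I)%SET.
  apply/setP => l; rewrite !inE; have [->|//] := eqVneq l i.
  by rewrite (negbTE xi) andbF.
(* Otherwise [j |: rho] would be a basis with [K + 1] infinite coordinates. *)
have xj : x j != +oo%E.
  apply/negP => xj; have := Kmax _ Bj; rewrite -Ks1 rhoI.
  have -> : ((j |: rho) :&: I = j |: (rho :&: I))%SET.
    by apply/setP => l; rewrite !inE; have [->|] //= := eqVneq l j; rewrite xj.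
  by rewrite cardsU1 inE (negbTE jrho) /= add1n ltnn.
have Oj : O (j |: rho)%SET.
  rewrite /O /B Bj /= -Ks1 rhoI; apply/eqP; congr #|pred_of_set _|.
  apply/setP => l; rewrite !inE; have [->|] //= := eqVneq l j.
  by rewrite (negbTE xj) !andbF.
have := F1min _ Oj; rewrite /F -[in X in _ - X <= _]s1E !big_setU1 //=.
rewrite (pcE _ Bj) (pcE _ Bs1) (xE _ xi) (xE _ xj) -!EFinD lee_fin /=; lra.
Qed.

End TropicalLinearSpace.

Section Cocircuits.
Context (k : fieldType) (R : realType) (v : valuation k R) (d n : nat).
Context (p : 'I_(plucker_num d n) -> \bar R).
Hypothesis pG : trop v (@grassmann_ideal k d n) p.

Lemma trop_neqNy N (J : set {mpoly k[N]}) w : trop v J w -> forall i, w i != -oo%E.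
Proof. by move=> [I [_ Iw _]]; exact: trop_orbit_neqNy Iw. Qed.

Lemma trop_exists_fin N (J : set {mpoly k[N]}) w : trop v J w -> exists i, w i != +oo%E.
Proof.
move=> [I [/properP[_ [i _ iI]] Iw _]]; exists i.
by have [_ ->] := Iw i; rewrite (negbTE iI).
Qed.

(** The circuit condition on [tau] is the tropical form of the Plucker relation between [rho] and
    [tau]: a unique finite minimum would be an isolated term of that quadric at [p]. *)
Lemma trop_circuits_cocircuit (rho : {set 'I_n.+1}) : #|rho| = d ->
  trop_circuits p (fun i => plucker_coord p (i |: rho)%SET).
Proof.
move=> card_rho tau card_tau; apply/min_oo_or_twiceP => -[t [tt Ft tmin]].
have p0 := trop_neqNy pG.
have [r _ rE] := set_imset_ord card_rho.
have [h h_inj hE] := set_imset_ord card_tau.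
pose term b : {mpoly k[plucker_num d n]} := (-1) ^+ (odd (nat_of_ord b)) *:
  (plucker_form k (fcons (h b) r) * plucker_form k (h \o lift b)).
pose G := \sum_(b < d.+2) term b.
pose F i := (plucker_coord p (tau :\ i)%SET + plucker_coord p (i |: rho)%SET)%E.
have [b0 hb0] : exists b0, h b0 = t.
  by move: tt; rewrite mem_enum -hE => /imsetP[b _ ->]; exists b.
have [c Fc] : exists c, F t = c%:E.
  move: Ft; rewrite -/(F t) /F.
  have := plucker_coord_neqNy p0 (tau :\ t)%SET; have := plucker_coord_neqNy p0 (t |: rho)%SET.
  by case: plucker_coord => [a||]; case: plucker_coord => [b||] //; exists (b + a).
have cos1 (b : 'I_d.+2) : ((fcons (h b) r) @: 'I_d.+1)%SET = (h b |: rho)%SET by rewrite fcons_imset rE.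
have cos2 b : ((h \o lift b) @: 'I_d.+1)%SET = (tau :\ h b)%SET by rewrite imset_lift // hE.
have term_ge b m : (F (h b) <= trop_term v p (term b) m)%E.
  rewrite trop_termZ vfun_sign add0e.
  apply: (trop_termM p0 (C := fun _ Z => (F (h b) <= Z)%E)
    (A := fun _ Z => (plucker_coord p (h b |: rho)%SET <= Z)%E)
    (B := fun _ Z => (plucker_coord p (tau :\ h b)%SET <= Z)%E)).
  - by move=> _; rewrite leey.
  - by move=> _ a a' aa /le_trans; apply.
  - by move=> _ _ a a' le1 le2; rewrite /F addeC leeD.
  - by move=> m'; rewrite -cos1; exact: plucker_form_ge.
  - by move=> m'; rewrite -cos2; exact: plucker_form_ge.
have [m isoG] : exists m, isolated v p G m c.
  move: (Fc); rewrite /F.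
  case p1 : (plucker_coord p (tau :\ t)%SET) => [a||].
  - case p2 : (plucker_coord p (t |: rho)%SET) => [a'||] //.
    move=> [ca].
    move: p1; rewrite -hb0 -cos2 => /(plucker_form_isolated v p0)[m2 iso2].
    move: p2; rewrite -hb0 -cos1 => /(plucker_form_isolated v p0)[m1 iso1].
    exists (m1 + m2)%MM; rewrite /G (bigD1 b0) //=; apply: isolatedD.
      have := isolatedZ (vfun_sign v (odd b0)) (isolatedM p0 iso1 iso2).
      by rewrite add0r addrC ca.
    move=> m'; apply: (trop_term_sum p0 (A := fun Z => (c%:E < Z)%E)).
    - exact: ltry.
    - by move=> u u' uu /lt_le_trans; apply.
    move=> b bb0; apply: lt_le_trans (term_ge _ _); rewrite -Fc; apply: tmin.
      by rewrite mem_enum -hE imset_f.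
    by rewrite -hb0 (inj_eq h_inj).
  - by rewrite addye // plucker_coord_neqNy.
  - by [].
apply: (trop_not_isolated pG _ _ isoG); last first.
  apply: (dhomog_orbit_homog _ p0 (e := 2)); apply: rpred_sum => b _; apply: dhomogZ.
  by apply: (dhomogM (d := 1) (e := 1)); exact: plucker_form_homog.
move=> S M _; rewrite /G raddf_sum /= -[RHS](plucker_relation M r h).
apply: eq_bigr => b _; rewrite mmapZ rmorph_sign rmorphM /= !mmap_plucker_form.
by rewrite signr_odd.
Qed.

End Cocircuits.

Lemma trop_is_point (k : fieldType) (R : realType) (v : valuation k R) N
    (J : set {mpoly k[N]}) w : trop v J w -> trop_point w.
Proof. by move=> Jw; split; [exact: trop_neqNy Jw | exact: trop_exists_fin Jw]. Qed.

Lemma trop_antitone (k : fieldType) (R : realType) (v : valuation k R) N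
    (J J' : set {mpoly k[N]}) : J `<=` J' -> trop v J' `<=` trop v J.
Proof.
move=> JJ' w J'w; apply: tropI; first exact: trop_is_point J'w.
by move=> g m c /JJ' Jg; exact: trop_not_isolated J'w Jg.
Qed.

Lemma mmap_comp_mpoly (k : fieldType) (S : comAlgType k) N N'
    (h : 'I_N -> S) (y : 'I_N' -> {mpoly k[N]}) g :
  mmap (in_alg S) h (g \mPo [tuple y i | i < N']) =
  mmap (in_alg S) (fun i => mmap (in_alg S) h (y i)) g.
Proof.
rewrite comp_mpolyE raddf_sum /=; apply: eq_bigr => m _.
rewrite mmapZ rmorph_prod /=; congr (_ * _); apply: eq_bigr => i _.
by rewrite rmorphXn /= tnth_mktuple.
Qed.

Lemma linear_space_in_eval (k : fieldType) d n (J : set {mpoly k[n.+1]})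
    (S : comAlgType k) (M : 'M[S]_(d.+1, n.+1)) g (c : 'I_d.+1 -> S) :
  linear_space_in J M -> J g ->
  mmap (in_alg S) (fun i => \sum_j M j i * c j) g = 0.
Proof.
move=> MJ Jg; have := congr1 (meval c) (MJ g Jg).
rewrite meval0 (rmorph_mmap (meval c)) => H; rewrite -[RHS]H; apply: eq_mmap => [a|i] /=.
  by rewrite mevalC.
  by rewrite raddf_sum /=; apply: eq_bigr => j _; rewrite mevalZ mevalXU.
Qed.

(** * The inclusion that holds for every subscheme *)

Section TropFano.
Context (k : fieldType) (R : realType) (v : valuation k R) (d n : nat).
Hypothesis v_surj : surjective_valuation v.

Lemma trop_term_perturb N (w : 'I_N -> \bar R) (b : 'I_N -> R) e
    (g : {mpoly k[N]}) m :
  trop_term v w g m = +oo%E ->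
  trop_term v (fun i => w i + (e * b i)%:E)%E g m = +oo%E.
Proof.
have -> : trop_term v (fun i => w i + (e * b i)%:E)%E g m =
    (trop_term v w g m + (\sum_i e * b i *+ m i)%:E)%E.
  rewrite !trop_termE -addeA; congr (_ + _)%E.
  rewrite -sumEFin -big_split /=; apply: eq_bigr => i _.
  by rewrite mulrnDl EFin_mulrn.
by move=> ->.
Qed.

(** On a linear space with basis [M] the substituted forms take the values [\sum_a M a j * c a] with
    [c] independent of [j]: the coordinates of one point of that space, where [g] vanishes. *)
Lemma fano_ideal_comp (J : set {mpoly k[n.+1]}) g
    (r : 'I_n.+1 -> 'I_d -> 'I_n.+1) (lam : 'I_n.+1 -> k) (P : pred 'I_n.+1) :
  J g ->
  fano_ideal J (g \mPo
    [tuple \sum_(i | P i) lam i *: plucker_form k (fcons j (r i)) | j < n.+1]).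
Proof.
move=> Jg S M _ MJ; rewrite mmap_comp_mpoly.
pose c a := \sum_(i | P i) in_alg S (lam i) * fcons_cofactor M (r i) a.
rewrite -[RHS](linear_space_in_eval c MJ Jg); apply: eq_mmap => // j.
rewrite raddf_sum /=; under [RHS]eq_bigr do rewrite mulr_sumr.
rewrite exchange_big /=; apply: eq_bigr => i _.
rewrite mmapZ mmap_plucker_form det_fcons mulr_sumr; apply: eq_bigr => a _.
by rewrite mulrCA.
Qed.

(* A point [x] of the linear space of [p] is the tropicalization of a linear combination of
   cocircuits. Perturbing [x] makes the minimum in each coordinate unique, so that substituting the
   corresponding combination of Plucker forms sends a polynomial of [J] with an isolated term at [x]
   to an element of the Fano ideal with an isolated term at [p]. *)
Lemma trop_linear_space_sub (J : set {mpoly k[n.+1]}) p :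
  trop v (fano_ideal (d := d) J) p -> trop_linear_space p `<=` trop v J.
Proof.
move=> pJ x [xpt xG]; have p0 := trop_neqNy pJ; have [x0 _] := xpt.
apply: tropI => // g m c Jg g_homog isog.
have /choice[r rP] : forall i, exists r : 'I_d -> 'I_n.+1, x i != +oo%E ->
    let q j := plucker_coord p (j |: (r @: 'I_d))%SET in
    q i != +oo%E /\ forall j, (x j + q i <= x i + q j)%E.
  move=> i; have [xi|xi] := eqVneq (x i) +oo%E; first by exists (fun=> ord0).
  have [rho card_rho rhoP] := trop_circuits_span p0 (trop_exists_fin pJ) xpt xG xi.
  have [r _ rE] := set_imset_ord card_rho.
  by exists r => _ q; rewrite /q rE.
pose q i j := plucker_coord p (j |: (r i @: 'I_d))%SET.
have q0 i j : q i j != -oo%E by exact: plucker_coord_neqNy.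
pose P i := x i != +oo%E.
(* Shifted by [mu i], the cocircuit chosen for [i] meets [x] at coordinate [i] and, by the choice of
   [r i], is nowhere below [x]. *)
pose mu i : R := fine (x i) - fine (q i i).
have xE i : P i -> x i = (fine (x i))%:E.
  by move=> xi; rewrite fineK //; apply/fin_numP.
have xmu i j : P i -> (x j <= (mu i)%:E + q i j)%E.
  move=> Pi; have [qi /(_ j)] := rP i Pi; rewrite -!/(q _ _) (xE _ Pi).
  have -> : q i i = (fine (q i i))%:E by rewrite fineK //; apply/fin_numP.
  rewrite /mu; have := x0 j; have := q0 i j.
  case: (x j) (q i j) => [a||] [b||] // _ _; rewrite -?EFinD ?lee_fin ?leey //; lra.
pose tight j i := P i && (x j == (mu i)%:E + q i j)%E.
have tightx j : P j -> tight j j.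
  move=> Pj; rewrite /tight Pj /= /mu (xE _ Pj) /=.
  have [qj _] := rP j Pj; rewrite -/(q j j) in qj.
  have -> : q j j = (fine (q j j))%:E by rewrite fineK //; apply/fin_numP.
  by rewrite -EFinD subrK.
(* Among the cocircuits attaining [x j], the one of least index is the only minimum once the [i]-th
   coefficient is raised by [e * i]; the coordinate [x j] then moves along by [e * b j]. *)
pose i_ j := [arg min_(i < j | tight j i) (i : nat)].
have i_P j : P j -> tight j (i_ j) /\ forall i, tight j i -> (i_ j <= i)%N.
  by move=> Pj; rewrite /i_; case: arg_minnP => [|i]; first exact: tightx.
pose b j : R := (i_ j : nat)%:R.
have [e1 e10 e1P] := isolated_perturb b x0 isog.
have [ij _|e2 e20 e2P] := @eventually_all R _ (enum {: 'I_n.+1 * 'I_n.+1})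
   (fun ij e => P ij.2 -> P ij.1 -> ij.1 != i_ ij.2 ->
     (x ij.2 + (e * b ij.2)%:E < (mu ij.1)%:E + q ij.1 ij.2 + (e * (ij.1 : nat)%:R)%:E)%E).
  case: ij => i j /=; have [Pj|_] := boolP (P j); last by exists 1.
  have [Pi|_] := boolP (P i); last by exists 1.
  have [->|ii] := eqVneq i (i_ j); first by exists 1.
  have [tij|ntij] := boolP (tight j i).
    exists 1 => // e /andP[e0 _] _ _ _; move: (tij) => /andP[_ /eqP <-].
    rewrite (xE _ Pj) -!EFinD lte_fin ltrD2l ltr_pM2l // ltr_nat ltn_neqAle eq_sym.
    by rewrite -val_eqE in ii; rewrite ii; have [_] := i_P j Pj; apply.
  have lt1 : (x j < (mu i)%:E + q i j)%E.
    by rewrite lt_neqAle xmu // andbT; move: ntij; rewrite /tight Pi.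
  have [e0 e00 e0P] := eventually_ltD (b j) (i : nat)%:R lt1.
  by exists e0 => // e ee _ _ _; exact: e0P.
pose e := Num.min e1 e2 / 2.
have e0 : 0 < e by rewrite divr_gt0 // lt_min e10.
have ee1 : 0 < e < e1.
  rewrite e0 /= ltr_pdivrMr // gt_min; apply/orP; left; lra.
have ee2 : 0 < e < e2.
  rewrite e0 /= ltr_pdivrMr // gt_min; apply/orP; right; lra.
have [c' isog'] := e1P e ee1; have {e2P} lt_e i j := e2P e ee2 (i, j) (mem_enum _ _).
have /choice[lam lamP] : forall i : 'I_n.+1, exists l, v l = (mu i + e * (i : nat)%:R)%:E.
  by move=> i; have [l _ vl] := v_surj (mu i + e * (i : nat)%:R); exists l.
pose x' j := (x j + (e * b j)%:E)%E.
pose y j := \sum_(i | P i) lam i *: plucker_form k (fcons j (r i)).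
have qE i j : q i j = plucker_coord p (fcons j (r i) @: 'I_d.+1)%SET by rewrite fcons_imset.
have term_ge i j m1 : ((mu i)%:E + q i j + (e * (i : nat)%:R)%:E <=
    trop_term v p (lam i *: plucker_form k (fcons j (r i))) m1)%E.
  rewrite trop_termZ lamP (EFinD (mu i)) -!addeA leeD2lE // addeC leeD2lE //.
  by rewrite qE plucker_form_ge.
have x'0 j : x' j != -oo%E by rewrite adde_eq_ninfty negb_or x0.
have x'_lt i j : P j -> P i -> i != i_ j ->
  (x' j < (mu i)%:E + q i j + (e * (i : nat)%:R)%:E)%E by exact: lt_e.
have x'_eq j : P j -> x' j = ((mu (i_ j))%:E + q (i_ j) j + (e * (i_ j : nat)%:R)%:E)%E.
  by move=> Pj; have [/andP[_ /eqP <-] _] := i_P j Pj.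
have y_ge j m1 : (x' j <= trop_term v p (y j) m1)%E.
  apply: (trop_term_sum p0 (A := fun Z => (x' j <= Z)%E)).
  - by rewrite leey.
  - by move=> u u' uu /le_trans; apply.
  move=> i Pi; apply: le_trans (term_ge _ _ _).
  have [Pj|/negPn/eqP xj] := boolP (P j).
    have [->|ii] := eqVneq i (i_ j); first by rewrite -x'_eq.
    by apply/ltW/x'_lt.
  have := xmu i j Pi; rewrite xj leye_eq => /eqP ->.
  by rewrite /x' xj.
have y_iso j : x' j != +oo%E -> exists m1 c1, x' j = c1%:E /\ isolated v p (y j) m1 c1.
  move=> x'j; have Pj : P j by apply: contraNneq x'j => xj; rewrite /x' xj.
  have [tij _] := i_P j Pj; have /andP[Pij _] := tij.
  have [c1 x'c] : exists c1, x' j = c1%:E.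
    by move: x'j (x'0 j); case: (x' j) => // c1; exists c1.
  have [c2 qc] : exists c2, q (i_ j) j = c2%:E.
    move: x'j; rewrite x'_eq //; have := q0 (i_ j) j.
    by case: (q (i_ j) j) => // c2; exists c2.
  have [m1 iso1] := plucker_form_isolated v p0 (etrans (esym (qE _ _)) qc).
  exists m1, c1; split=> //; rewrite /y (bigD1 (i_ j)) //=; apply: isolatedD.
    have -> : c1 = mu (i_ j) + e * (i_ j : nat)%:R + c2.
      apply: EFin_inj; rewrite -x'c x'_eq // qc -!EFinD; congr (_%:E); ring.
    exact: isolatedZ (lamP _) iso1.
  move=> m2; apply: (trop_term_sum p0 (A := fun Z => (c1%:E < Z)%E)).
  - exact: ltry.
  - by move=> u u' uu /lt_le_trans; apply.
  by move=> i /andP[Pi ii]; apply: lt_le_trans (term_ge _ _ _); rewrite -x'c; apply: x'_lt.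
have [m1 isoy] := isolated_comp p0 x'0 y_ge y_iso isog'.
apply: (trop_not_isolated pJ _ _ isoy); first exact: fano_ideal_comp.
apply: (orbit_homog_comp p0 y_ge) => [j|].
  by apply: rpred_sum => i _; apply: dhomogZ; exact: plucker_form_homog.
have [ee gee] := g_homog; exists ee => m2 m2g; apply: gee.
by apply: contraNneq m2g => gm2; rewrite trop_term_perturb.
Qed.

Lemma trop_fano_ideal_sub (J : set {mpoly k[n.+1]}) :
  trop v (fano_ideal (d := d) J) `<=` trop_fano v (trop v J).
Proof.
move=> p pJ; split; last exact: trop_linear_space_sub.
by apply: trop_antitone pJ => f fG S M MS _; exact: fG.
Qed.

End TropFano.

(** * Toric ideals *)

Section Nonvanishing.
Context (k : fieldType) (R : realType) (v : valuation k R).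

(** At a point with these valuations, the isolated term has strictly the smallest valuation in the
    sum and cannot be cancelled. *)
Lemma isolated_meval N (z : 'I_N -> k) f m c :
  isolated v (fun i => v (z i)) f m c -> f.@[z] != 0.
Proof.
move=> isof; have z0 i : v (z i) != -oo%E by exact: vfun_neqNy.
have mf := isolated_msupp z0 isof.
have vE u : v (f@_u * \prod_i z i ^+ u i) = trop_term v (fun i => v (z i)) f u.
  rewrite trop_termE vfunM vfun_prod; congr (_ + _)%E.
  by apply: eq_bigr => i _; rewrite vfunX.
case: isof => fm fm'; apply: (@vfun_neq0 _ _ v _ c).
rewrite mevalE (bigD1_seq m) ?msupp_uniq //= vfunD_lt vE fm //.
apply: (@vfun_sum _ _ v _ _ _ _ (fun Z => (c%:E < Z)%E)).
- exact: ltry.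
- by move=> x y xy /lt_le_trans; apply.
- by move=> u um; rewrite vE fm'.
Qed.

Lemma poly_exists_nroot (p : {poly R}) : p != 0 -> exists t, p.[t] != 0.
Proof.
move=> p0; apply/notP => H.
have := max_poly_roots (rs := [seq i%:R | i <- iota 0 (size p)]) p0.
rewrite size_map size_iota ltnn => F; have : false; last by [].
apply: F.
  apply/allP => _ /mapP[i _ ->]; apply/rootP/eqP.
  by apply: contra_notT H => pi; exists i%:R.
by rewrite map_inj_uniq ?iota_uniq // => a b /eqP; rewrite eqr_nat => /eqP.
Qed.

(* Along the curve of weights [t, t^2, .., t^N], two given terms of [f] have equal weight only for
   finitely many [t]. *)
Lemma exists_isolated N (f : {mpoly k[N]}) : f != 0 ->
  exists (w : 'I_N -> R) m c, isolated v (fun i => (w i)%:E) f m c.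
Proof.
move=> f0; pose F m := fine (v f@_m).
have FE m : m \in msupp f -> v f@_m = (F m)%:E.
  by rewrite mcoeff_msupp => /(vfun_fin v) fm; rewrite fineK.
(* Evaluated at [t], [q m m'] is the difference of the weights of the two terms: the constant
   coefficient comes from the coefficients of [f], the coefficient of index i+1 from the exponents
   of variable i. *)
pose q (m m' : 'X_{1..N}) : {poly R} := \poly_(j < N.+1)
  (if unlift ord0 (inord j) is Some i then (m (i : 'I_N))%:R - (m' i)%:R else F m - F m').
have q0 m m' : m != m' -> q m m' != 0.
  apply: contraNneq => qmm; apply/eqP/mnmP => i.
  have := congr1 (fun p : {poly R} => p`_(lift ord0 i)) qmm.
  rewrite coef_poly coef0 ltn_ord inord_val liftK => /eqP.
  by rewrite subr_eq0 eqr_nat => /eqP.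
pose Q := \prod_(mm <- [seq (m, m') | m <- msupp f, m' <- msupp f] | mm.1 != mm.2) q mm.1 mm.2.
have [t Qt] : exists t, Q.[t] != 0.
  apply: poly_exists_nroot; rewrite prodf_seq_neq0.
  by apply/allP => -[m m'] _ /=; apply/implyP; exact: q0.
have q_t m m' : m \in msupp f -> m' \in msupp f -> m != m' -> (q m m').[t] != 0.
  move=> mf m'f mm'; move: Qt; rewrite /Q horner_prod prodf_seq_neq0 => /allP /(_ (m, m')).
  by rewrite /= mm'; apply; apply/allpairsP; exists (m, m').
pose w (i : 'I_N) := t ^+ i.+1.
have tE m : m \in msupp f -> trop_term v (fun i => (w i)%:E) f m =
    (F m + \sum_i (w i) *+ m i)%:E.
  move=> mf; rewrite trop_termE FE // [RHS]EFinD; congr (_ + _)%E.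
  by rewrite -sumEFin; apply: eq_bigr => i _; rewrite EFin_mulrn.
have qE m m' : (q m m').[t] =
    (F m + \sum_i (w i) *+ m i) - (F m' + \sum_i (w i) *+ m' i).
  rewrite horner_poly big_ord_recl expr0 mulr1 (_ : inord _ = ord0); last first.
    by apply: val_inj; rewrite /= inordK.
  rewrite unlift_none opprD addrACA; congr (_ + _); rewrite -sumrB.
  apply: eq_bigr => i _; rewrite inord_val liftK.
  by rewrite mulrBl !mulr_natl.
have [m0 m0f] : exists m0, m0 \in msupp f.
  by case E : (msupp f) => [|m0 s]; [move: f0; rewrite -msupp_eq0 E | exists m0; rewrite mem_head].
have [m mf m_min] := seq_argmin (trop_term v (fun i => (w i)%:E) f) m0f.
exists w, m, (F m + \sum_i (w i) *+ m i); split; first exact: tE.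
move=> m' mm'; have [m'f|m'f] := boolP (m' \in msupp f); last first.
  by rewrite trop_term_out ?ltry ?memN_msupp_eq0.
have := m_min m' m'f; rewrite !tE // lte_fin lee_fin => le_mm'.
rewrite lt_neqAle le_mm' andbT -subr_eq0 -qE; apply: q_t => //.
by rewrite eq_sym.
Qed.

Hypothesis v_surj : surjective_valuation v.

(** A nonzero polynomial has an isolated term at some real weight, and surjectivity of [v] lifts
    this weight to a torus point, where the polynomial does not vanish. *)
Lemma mpoly_eq0_torus N (f : {mpoly k[N]}) :
  (forall z, (forall i, z i != 0) -> f.@[z] = 0) -> f = 0.
Proof.
move=> fz; apply/eqP; apply: contraT => /exists_isolated[w [m [c isof]]].
have /choice[z zP] : forall i, exists z, z != 0 /\ v z = (w i)%:E.
  by move=> i; have [z z0 vz] := v_surj (w i); exists z.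
have zw : (fun i => v (z i)) = (fun i => (w i)%:E).
  by apply/funext => i; case: (zP i).
have := isolated_meval (z := z) (m := m) (c := c) (f := f).
rewrite zw => /(_ isof); rewrite fz ?eqxx // => i; by case: (zP i).
Qed.

End Nonvanishing.

Section ToricIdeal.
Context (k : fieldType) (R : realType) (v : valuation k R).
Hypothesis v_surj : surjective_valuation v.
Context (r n : nat) (a : 'I_n.+1 -> 'rV[int]_r.+1).
Hypothesis a_last : forall i, a i 0 ord_max = 1.

Definition mnm_image (u : 'X_{1..n.+1}) (j : 'I_r.+1) : int :=
  \sum_i a i 0 j *+ u i.

Lemma mnm_image_last u : mnm_image u ord_max = (mdeg u)%:Z.
Proof.
rewrite /mnm_image mdegE; under [LHS]eq_bigr do rewrite a_last.
by rewrite (big_morph Posz PoszD (erefl _)); apply: eq_bigr => i _; rewrite natz.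
Qed.

Lemma monomial_map_exp (t : 'I_r.+1 -> k) (u : 'X_{1..n.+1}) :
  (forall j, t j != 0) ->
  \prod_i monomial_map a t i ^+ u i = \prod_j t j ^ mnm_image u j.
Proof.
move=> t0; rewrite /monomial_map; under eq_bigr do rewrite -prodrXl.
rewrite exchange_big /=; apply: eq_bigr => j _.
rewrite /mnm_image (big_morph (fun z : int => t j ^ z) (id1 := 1) (op1 := *%R)) //.
  by apply: eq_bigr => i _; rewrite -mulr_natr -exprz_exp natz exprnP.
by move=> x y; rewrite expfzDr.
Qed.

Lemma binomial_toric_ideal u u' : mnm_image u = mnm_image u' ->
  toric_ideal (k := k) a ('X_[u] - 'X_[u']).
Proof.
move=> uu y c [t t0 ->] c0; have deg_uu : mdeg u = mdeg u'.
  by have /(congr1 (fun f => f ord_max)) := uu; rewrite !mnm_image_last => -[].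
rewrite mevalB !mevalX; under [X in X - _]eq_bigr do rewrite exprMn.
under [X in _ - X]eq_bigr do rewrite exprMn.
by rewrite !big_split /= !monomial_map_exp // !prodrXr -!mdegE uu deg_uu subrr.
Qed.

(* Shifting the exponents by [K] makes them natural numbers; in the closure ideal this is a rescaling
   of the points of the torus. *)
Lemma toric_ideal_sum (A : nzRingType) (f : {rmorphism k -> A})
    (phi : 'X_{1..n.+1} -> A) g :
  (forall u u', mnm_image u = mnm_image u' -> phi u = phi u') ->
  toric_ideal a g -> \sum_(u <- msupp g) f g@_u * phi u = 0.
Proof.
move=> phiE gJ; pose K := (\sum_i \sum_j `|a i 0%R j|%N)%N.
have aK i j : 0 <= a i 0 j + K%:Z.
  have : (`|a i 0%R j| <= K)%N.
    by rewrite /K (bigD1 i) //= (bigD1 j) //= -addnA leq_addr.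
  lia.
pose e i : 'X_{1..r.+1} := [multinom absz (a i 0 j + K%:Z)%R | j < r.+1].
pose b (u : 'X_{1..n.+1}) : 'X_{1..r.+1} := (\sum_i e i *+ u i)%MM.
have bE u j : (b u j)%:Z = mnm_image u j + (K * mdeg u)%:Z.
  rewrite /b mnm_sumE (big_morph Posz PoszD (erefl _)) mdegE.
  rewrite big_distrr /= (big_morph Posz PoszD (erefl _)) -big_split /=.
  apply: eq_bigr => i _; rewrite mulmnE mnmE PoszM gez0_abs // mulrDl.
  by rewrite PoszM -mulr_natr natz.
(* The last entry of [b u] is [(K + 1) * mdeg u], so [b u] determines the degree and then all
   entries of the image. *)
have b_image u u' : b u = b u' -> mnm_image u = mnm_image u'.
  move=> buu; apply/funext => j; have bj l : (b u l)%:Z = (b u' l)%:Z by rewrite buu.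
  have := bj ord_max; rewrite !bE !mnm_image_last -!PoszD -!mulSn => -[] /eqP.
  rewrite eqn_mul2l /= => /eqP deg_uu.
  by have := bj j; rewrite !bE deg_uu => /addIr.
have G0 : g \mPo [tuple 'X_[e i] | i < n.+1] = 0 :> {mpoly k[r.+1]}.
  apply: (mpoly_eq0_torus v_surj) => t t0; rewrite comp_mpoly_meval.
  rewrite -[RHS](gJ (monomial_map a t) (\prod_j t j ^+ K)); last first.
  - by apply/prodf_neq0 => j _; rewrite expf_neq0.
  - by exists t.
  apply: meval_eq => i; rewrite tnth_mktuple mevalX /monomial_map -big_split /=.
  apply: eq_bigr => j _; rewrite !exprnP -expfzDr // mnmE gez0_abs //.
  by rewrite addrC.
have coef0 m : \sum_(u <- msupp g | b u == m) g@_u = 0.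
  have := congr1 (mcoeff m) G0; rewrite comp_mpolyE raddf_sum /= mcoeff0 => H.
  rewrite -[RHS]H [LHS]big_mkcond; apply: eq_bigr => u _.
  have -> : \prod_i tnth [tuple 'X_[e i0] | i0 < n.+1] i ^+ u i = 'X_[b u] :> {mpoly k[r.+1]}.
    rewrite /b (big_morph (fun m => 'X_[m] : {mpoly k[r.+1]}) (id1 := 1) (op1 := *%R)) ?mpolyX0 //; last first.
      by move=> m1 m2; rewrite mpolyXD.
    by apply: eq_bigr => i _; rewrite tnth_mktuple mpolyXn.
  by rewrite mcoeffZ mcoeffX; case: eqP; rewrite ?mulr1 ?mulr0.
(* Group the terms by [b u]: [phi] is constant on a group, and the coefficients of a group add up to
   0. *)
pose s := undup [seq b u | u <- msupp g].
transitivity (\sum_(m <- s) \sum_(u <- msupp g | b u == m) f g@_u * phi u).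
  rewrite (exchange_big_dep xpredT) //= big_seq [RHS]big_seq; apply: eq_bigr => u ug.
  rewrite big_mkcond (bigD1_seq (b u)) ?undup_uniq ?mem_undup ?map_f //= eqxx.
  by rewrite big1 ?addr0 // => m mb; rewrite eq_sym (negbTE mb).
rewrite big_seq; apply: big1 => m ms.
have /mapP[u0 _ mE] : m \in [seq b u | u <- msupp g] by rewrite -mem_undup.
transitivity (\sum_(u <- msupp g | b u == m) f g@_u * phi u0).
  apply: eq_bigr => u /eqP um; congr (_ * _).
  by apply/phiE/b_image; rewrite um mE.
by rewrite -mulr_suml -rmorph_sum /= coef0 rmorph0 mul0r.
Qed.

End ToricIdeal.

(** * Parallel classes of a tropical linear space *)

Section ParallelClasses.
Context (k : fieldType) (R : realType) (v : valuation k R) (d n : nat).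
Context (p : 'I_(plucker_num d n) -> \bar R).
Hypothesis pG : trop v (@grassmann_ideal k d n) p.

Notation pc := (plucker_coord p).

Let p0 : forall s, p s != -oo%E. Proof. exact: trop_neqNy pG. Qed.

Let pc0 sigma : pc sigma != -oo%E. Proof. exact: plucker_coord_neqNy. Qed.

(** The all-infinite point is included so that an empty family has a minimum, as in
    [bigmin_affine]. *)
Definition affine_points : set ('I_n.+1 -> \bar R) :=
  [set x | (forall i, x i != -oo%E) /\ trop_circuits p x].

Definition nonloop (i : 'I_n.+1) : bool :=
  [exists rho : {set 'I_n.+1}, (#|rho| == d) && (pc (i |: rho)%SET != +oo%E)].

(** Stated on the linear space rather than on bases, which provides the constant difference
    directly. Any two loops are parallel, both coordinates being always +oo. *)
Definition parallel (i j : 'I_n.+1) : Prop :=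
  exists c : R, forall x, affine_points x -> x j = (x i + c%:E)%E.

Lemma affine_points_cocircuit (rho : {set 'I_n.+1}) : #|rho| = d ->
  affine_points (fun i => pc (i |: rho)%SET).
Proof. by move=> card_rho; split=> [i|]; [exact: pc0 | exact: (trop_circuits_cocircuit pG)]. Qed.

Lemma exists_basis : exists sigma, pc sigma != +oo%E.
Proof.
have [s ps] := trop_exists_fin pG.
by exists (val (enum_val s)); rewrite plucker_coord_enum enum_valK.
Qed.

Lemma basis_nonloop (sigma : {set 'I_n.+1}) i : pc sigma != +oo%E -> i \in sigma -> nonloop i.
Proof.
move=> Bs is_; apply/existsP; exists (sigma :\ i)%SET; rewrite finset.setD1K // Bs andbT.
by rewrite -eqSS -(plucker_coord_card Bs) (cardsD1 i sigma) is_.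
Qed.

(** A finite [x i] would allow [i] to be exchanged into a basis. *)
Lemma loop_oo x i : affine_points x -> ~~ nonloop i -> x i = +oo%E.
Proof.
move=> [x0 xG] iloop; apply/eqP; apply: contraNT iloop => xi.
have [sigma Bs] := exists_basis.
have [is_|is_] := boolP (i \in sigma); first exact: basis_nonloop is_.
have [t ts le_t] := trop_circuits_exchange xG Bs is_ xi.
apply/existsP; exists (sigma :\ t)%SET; apply/andP; split.
  by rewrite -eqSS -(plucker_coord_card Bs) (cardsD1 t sigma) ts.
apply/eqP => B'; move: le_t; rewrite B' addye ?x0 // leye_eq.
have := pc0 sigma; have := x0 i; move: Bs xi.
by case: (pc sigma) (x i) => [b||] [c||].
Qed.

Lemma bigmin_affine (T : eqType) (s : seq T) (f : T -> 'I_n.+1 -> \bar R) :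
  (forall t, t \in s -> affine_points (f t)) ->
  exists2 x, affine_points x &
    forall j, x j != +oo%E <-> exists2 t, t \in s & f t j != +oo%E.
Proof.
elim: s => [|t s IH] fG.
  exists (fun=> +oo%E) => [|j]; last by split=> [/eqP//|[]].
  by split=> // tau _; left=> i _; rewrite addey.
have [u us|x [x0 xG] xP] := IH; first by apply: fG; rewrite inE us orbT.
have [t0 tG] := fG t (mem_head _ _).
exists (fun j => Order.min (f t j) (x j)) => [|j].
  split=> [i|]; last exact: trop_circuits_min.
  by rewrite minElt; case: ifP.
split=> [|[u]].
  rewrite minElt; case: ifP => _; first by exists t; rewrite ?mem_head.
  by move=> /xP[u us fu]; exists u; rewrite // inE us orbT.
rewrite inE -[X in _ -> _ -> is_true X]ltey gt_min !ltey => /predU1P[->->//|us fu].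
by apply/orP; right; apply/xP; exists u.
Qed.

Lemma exists_nonloop_point :
  exists2 x, affine_points x & forall j, (x j != +oo%E) = nonloop j.
Proof.
have [|x xG xP] := @bigmin_affine _ (enum [pred rho : {set 'I_n.+1} | #|rho| == d])
    (fun rho i => pc (i |: rho)%SET).
  by move=> rho; rewrite mem_enum inE => /eqP; exact: affine_points_cocircuit.
exists x => // j; apply/idP/idP => [/xP[rho]|/existsP[rho /andP[card_rho Brho]]].
  rewrite mem_enum inE => card_rho Brho.
  by apply/existsP; exists rho; rewrite card_rho.
by apply/xP; exists rho; rewrite // mem_enum inE.
Qed.

(** If no basis contains both indices, the circuit on [i], [j] and [rho] has only two terms that can
    be finite; their equality at every point is a constant difference. *)
Lemma nonparallel_basis i j : nonloop i -> nonloop j -> ~ parallel i j ->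
  exists rho : {set 'I_n.+1}, [/\ #|rho| = d, i \in rho & pc (j |: rho)%SET != +oo%E].
Proof.
move=> /existsP[rho /andP[/eqP card_rho Bi]] jnl nij.
have ij : i != j.
  by apply/eqP => ij; apply: nij; rewrite ij; exists 0 => x _; rewrite adde0.
apply/notP => H; apply: nij.
have noB (sigma : {set 'I_n.+1}) : i \in sigma -> j \in sigma -> pc sigma = +oo%E.
  move=> is_ js; apply/eqP; apply: contraT => Bs; exfalso; apply: H.
  exists (sigma :\ j)%SET; split.
  - by apply/eqP; rewrite -eqSS -(plucker_coord_card Bs) (cardsD1 j sigma) js.
  - by rewrite !inE ij.
  - by rewrite finset.setD1K.
have irho : i \notin rho.
  have := plucker_coord_card Bi; rewrite cardsU1 card_rho; case: (i \in rho) => //.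
  by rewrite add0n => /eqP; rewrite eqn_leq ltnn andbF.
have jrho : j \notin rho.
  by apply/negP => jr; move: Bi; rewrite noB ?setU11 // !inE jr orbT.
pose tau := (i |: (j |: rho))%SET.
have card_tau : #|tau| = d.+2.
  by rewrite !cardsU1 !inE negb_or ij irho jrho card_rho.
have tau_i : (tau :\ i = j |: rho)%SET.
  by rewrite finset.setU1K // !inE negb_or ij.
have tau_j : (tau :\ j = i |: rho)%SET.
  apply/setP => l; rewrite !inE; have [->|lj] //= := eqVneq l j.
  by rewrite eq_sym (negbTE ij) (negbTE jrho).
have relij x : affine_points x -> (pc (j |: rho)%SET + x i = pc (i |: rho)%SET + x j)%E.
  move=> [x0 xG]; rewrite -tau_i -tau_j.
  have Foo l : l \in tau -> l != i -> l != j -> (pc (tau :\ l)%SET + x l)%E = +oo%E.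
    move=> ltau li lj; rewrite noB ?addye // !inE ?eqxx ?orbT ?andbT //.
      by rewrite eq_sym.
    by rewrite eq_sym.
  have itau : i \in enum tau by rewrite mem_enum !inE eqxx.
  have jtau : j \in enum tau by rewrite mem_enum !inE eqxx orbT.
  have [oo|[t1 [t2 [t1t t2t t12 F12 Fmin]]]] := xG _ card_tau.
    by rewrite !oo.
  have all_oo l : l \in tau -> l != i -> l != j -> (l == t1) || (l == t2) ->
      (pc (tau :\ i)%SET + x i = pc (tau :\ j)%SET + x j)%E.
    move=> ltau li lj l12; have Ft1 : (pc (tau :\ t1)%SET + x t1)%E = +oo%E.
      by move: l12 => /orP[/eqP <-|/eqP l2]; [exact: Foo | rewrite F12 -l2; exact: Foo].
    have := Fmin _ itau; have := Fmin _ jtau.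
    by rewrite Ft1 !leye_eq => /eqP -> /eqP ->.
  rewrite !mem_enum in t1t t2t.
  have [t1i|t1i] := eqVneq t1 i.
    have [t2j|t2j] := eqVneq t2 j; first by rewrite -t1i -t2j.
    by apply: (all_oo t2); rewrite ?eqxx ?orbT // -t1i eq_sym.
  have [t1j|t1j] := eqVneq t1 j; last by apply: (all_oo t1); rewrite ?eqxx.
  have [t2i|t2i] := eqVneq t2 i; first by rewrite -t1j -t2i.
  by apply: (all_oo t2); rewrite ?eqxx ?orbT // -t1j eq_sym.
(* Evaluate [relij] at a cocircuit that is finite at [j]: its right side is finite, hence so is its
   left side. *)
have Bj : pc (j |: rho)%SET != +oo%E.
  move: jnl => /existsP[rho' /andP[/eqP card_rho' Bj']].
  have := relij _ (affine_points_cocircuit card_rho').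
  apply: contra_eqN => /eqP ->; rewrite addye ?pc0 //.
  have := pc0 (i |: rho)%SET; have := pc0 (j |: rho')%SET; move: Bi Bj'.
  by case: (pc (i |: rho)%SET) (pc (j |: rho')%SET) => [b||] [c||].
exists (fine (pc (j |: rho)%SET) - fine (pc (i |: rho)%SET)) => x xG.
have := relij x xG; have [x0 _] := xG; have := x0 i; have := x0 j.
have := pc0 (i |: rho)%SET; have := pc0 (j |: rho)%SET; move: Bi Bj.
case: (pc (i |: rho)%SET) (pc (j |: rho)%SET) => [b||] [c||] //= _ _ _ _.
case: (x i) (x j) => [e||] [f||] //= _ _ [] H1.
by rewrite -EFinD; congr (_%:E); lra.
Qed.

(** The cocircuit of [sigma :\ i] is finite at [i] and infinite at [j]. *)
Lemma basis_nonparallel (sigma : {set 'I_n.+1}) i j : pc sigma != +oo%E -> i \in sigma ->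
  j \in sigma -> i != j -> ~ parallel i j.
Proof.
move=> Bs is_ js ij [c ijc]; have card_rho : #|(sigma :\ i)%SET| = d.
  by apply/eqP; rewrite -eqSS -(plucker_coord_card Bs) (cardsD1 i sigma) is_.
have := ijc _ (affine_points_cocircuit card_rho).
rewrite finset.setD1K //.
have -> : pc (j |: sigma :\ i)%SET = +oo%E.
  apply/eqP; apply: contraT => /plucker_coord_card.
  by rewrite cardsU1 !inE eq_sym ij js card_rho add0n => /eqP; rewrite eqn_leq ltnn andbF.
by move: Bs (pc0 sigma); case: (pc sigma).
Qed.

Lemma parallel_refl i : parallel i i.
Proof. by exists 0 => x _; rewrite adde0. Qed.

Lemma parallel_sym i j : parallel i j -> parallel j i.
Proof.
by move=> [c ijc]; exists (- c) => x xG; rewrite (ijc x xG) -addeA -EFinD subrr adde0.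
Qed.

Lemma parallel_trans i j l : parallel i j -> parallel j l -> parallel i l.
Proof.
move=> [c ijc] [c' jlc]; exists (c + c') => x xG.
by rewrite (jlc x xG) (ijc x xG) EFinD addeA.
Qed.

(** [pick] sees only the predicate, so parallel indices share one representative. The default [i] is
    never reached, as [i] is parallel to itself. *)
Definition class_rep (i : 'I_n.+1) : 'I_n.+1 := odflt i [pick j | `[< parallel i j >]].

Lemma parallel_rep i : parallel i (class_rep i).
Proof.
rewrite /class_rep; case: pickP => [j /asboolP //|_] /=; exact: parallel_refl.
Qed.

Lemma class_repP i j : class_rep i = class_rep j <-> parallel i j.
Proof.
split=> [ij|ij].
  apply: (parallel_trans (parallel_rep i)); rewrite ij.
  exact/parallel_sym/parallel_rep.
rewrite /class_rep.
have -> : [pick l | `[< parallel i l >]] = [pick l | `[< parallel j l >]].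
  apply: eq_pick => l; apply/asboolP/asboolP; last exact: parallel_trans.
  exact/parallel_trans/parallel_sym.
case: pickP => //= /(_ j); case: asboolP => // -[]; exact: parallel_refl.
Qed.

Lemma parallel_nonloop i j : parallel i j -> nonloop i = nonloop j.
Proof.
move=> [c ijc]; have [x xG xP] := exists_nonloop_point.
rewrite -!xP (ijc x xG); have [x0 _] := xG; have := x0 i.
by case: (x i).
Qed.

(* With [x] finite at all nonloops and [y] infinite exactly on the class of [i] and the loops, take
   the points min(y, x + t) for two large values of [t]. *)
Lemma class_direction i : nonloop i -> exists z z' : 'I_n.+1 -> R,
  let ext (z : 'I_n.+1 -> R) j := if nonloop j then (z j)%:E else +oo%E in
  [/\ affine_points (ext z), affine_points (ext z') &
      forall j, z' j = z j + (class_rep j == class_rep i)%:R].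
Proof.
move=> inl; have [x [x0 xG] xP] := exists_nonloop_point.
have [|y [y0 yG] yP] := @bigmin_affine _ (enum [pred rho : {set 'I_n.+1} | (#|rho| == d) && (i \in rho)])
    (fun rho i => pc (i |: rho)%SET).
  by move=> rho; rewrite mem_enum inE => /andP[/eqP card_rho _]; exact: affine_points_cocircuit.
pose C j := class_rep j == class_rep i.
have yC j : nonloop j -> (y j != +oo%E) = ~~ C j.
  move=> jnl; have [cj|ncj] := boolP (C j).
    have ij : parallel i j by apply/class_repP; rewrite (eqP cj).
    apply/negbTE; rewrite negbK.
    have [c ijc] := ij; rewrite (ijc y) //; suff -> : y i = +oo%E by [].
    apply/eqP; apply: contraT => /yP[rho]; rewrite mem_enum inE => /andP[/eqP card_rho ir].
    move=> /plucker_coord_card; rewrite cardsU1 ir card_rho => /eqP.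
    by rewrite add0n eqn_leq ltnn andbF.
  have nij : ~ parallel i j by move=> /class_repP ij; move: ncj; rewrite /C ij eqxx.
  have [rho [card_rho ir Bj]] := nonparallel_basis inl jnl nij.
  by apply/yP; exists rho; rewrite // mem_enum inE card_rho eqxx.
(* From [t0] on, [x + t] is at least [y] at every nonloop outside the class of [i], so the minimum
   is [y] there and [x + t] on the class, where [y] is infinite. *)
pose t0 : R := \sum_(j | nonloop j && ~~ C j) `|fine (y j) - fine (x j)|.
have t0P j : nonloop j -> ~~ C j -> fine (y j) <= fine (x j) + t0.
  move=> jnl ncj; rewrite -lerBlDl; apply: le_trans (ler_norm _) _.
  by rewrite /t0 (bigD1 j) ?jnl //= lerDl sumr_ge0.
pose z t j := if C j then fine (x j) + t else fine (y j).
have zE t : t0 <= t -> (fun j => if nonloop j then (z t j)%:E else +oo%E) =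
    (fun j => Order.min (y j) (x j + t%:E)%E).
  move=> tt; apply/funext => j.
  have xE : nonloop j -> x j = (fine (x j))%:E.
    by move=> jnl; rewrite fineK //; apply/fin_numP; split; rewrite ?xP.
  have [jnl|jl] := boolP (nonloop j); last first.
    have -> : y j = +oo%E by apply: loop_oo.
    have -> : x j = +oo%E by apply: loop_oo.
    by rewrite addye // minxx.
  rewrite /z; have := yC j jnl; case: ifP => [cj|/negbT ncj].
    move=> /negbT; rewrite negbK => /eqP ->.
    by rewrite minye xE.
  move=> yj; have -> : y j = (fine (y j))%:E by rewrite fineK //; apply/fin_numP.
  rewrite (xE jnl) -EFinD -EFin_min /=; congr (_%:E); apply/esym/min_idPl.
  by apply: le_trans (t0P j jnl ncj) _; rewrite lerD2l.
exists (z t0), (z (t0 + 1)).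
have zG t : t0 <= t -> affine_points (fun j => if nonloop j then (z t j)%:E else +oo%E).
  move=> tt; rewrite zE //; split=> [j|].
    by rewrite minElt; case: ifP => // _; rewrite adde_eq_ninfty negb_or x0.
  by apply: trop_circuits_min => //; exact: trop_circuits_shift.
split; [exact: zG | by apply: zG; rewrite lerDl ler01 |].
by move=> j; rewrite /z -/(C j); case: (C j); rewrite ?addr0 // addrA.
Qed.

End ParallelClasses.

(** * Linear spaces in toric varieties *)

(** The kernel of an integer matrix is spanned by rational vectors, the columns of [cokermx] over
    the rationals; clearing denominators turns each of them into an integer [w]. *)
Lemma int_orthogonal_submx (R : realFieldType) m n (A : 'M[int]_(m, n)) (c : 'rV[R]_n) :
  (forall w : 'cV[int]_n, A *m w = 0 -> c *m map_mx intr w = 0) ->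
  exists y, c = y *m map_mx intr A.
Proof.
move=> cA; apply/submxP; rewrite submxE.
have -> : map_mx intr A = map_mx (ratr : rat -> R) (map_mx intr A).
  by apply/matrixP => i j; rewrite !mxE ratr_int.
rewrite -map_cokermx; set K := cokermx _; apply/eqP/matrixP => i0 l; rewrite ord1 mxE [RHS]mxE.
pose N := \prod_(i < n) denq (K i l).
have N0 : N != 0 by apply/prodf_neq0 => i _; exact: denq_neq0.
pose w : 'cV[int]_n := \col_i (numq (K i l) * \prod_(j | j != i) denq (K j l)).
have wE i : (w i 0)%:~R = N%:~R * K i l.
  rewrite mxE /N [in RHS](bigD1 i) //= !rmorphM /= mulrAC; congr (_ * _).
  by rewrite mulrC -[X in _ = X * _]divq_num_den divfK // intr_eq0 denq_neq0.
have Aw : A *m w = 0.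
  apply/matrixP => i j; rewrite ord1 !mxE; apply/eqP; rewrite -(intr_eq0 rat).
  have /matrixP/(_ i l) := mulmx_coker (map_mx (intr : int -> rat) A).
  rewrite !mxE => /(congr1 (fun q : rat => N%:~R * q)); rewrite mulr0 => H.
  rewrite rmorph_sum /= -[X in _ == X]H mulr_sumr; apply/eqP/eq_bigr => e _.
  by rewrite rmorphM /= wE mulrCA [in RHS]mxE.
have /matrixP/(_ 0 0) := cA w Aw; rewrite !mxE => cw.
apply: (mulfI (x := N%:~R)); first by rewrite intr_eq0.
rewrite mulr0 -[RHS]cw mulr_sumr; apply: eq_bigr => i _.
have wR : (w i 0)%:~R = N%:~R * ratr (K i l) :> R.
  by rewrite -[LHS]ratr_int wE rmorphM /= ratr_int.
by rewrite [X in _ = _ * X]mxE wR [X in _ * (_ * X)]mxE mulrCA.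
Qed.

Lemma linear_space_minor (k : fieldType) d n (M : 'M[k^o]_(d.+1, n.+1))
    (h : 'I_d.+1 -> 'I_n.+1) : \det (colsub h M) != 0 -> linear_space M.
Proof.
move=> detM; have Qu : colsub h (M : 'M[k]_(_, _)) \in unitmx by rewrite unitmxE unitfE.
exists ((\matrix_(i, j) (i == h j)%:R) *m invmx (colsub h (M : 'M[k]_(_, _)))).
rewrite mulmxA -[RHS](mulmxV Qu); congr (_ *m _).
apply/matrixP => i j; rewrite !mxE (bigD1 (h j)) //= mxE eqxx mulr1 big1 ?addr0 // => l lj.
by rewrite mxE (negbTE lj) mulr0.
Qed.

Section ToricFano.
Context (k : fieldType) (R : realType) (v : valuation k R).
Hypothesis v_surj : surjective_valuation v.
Context (d n r : nat) (a : 'I_n.+1 -> 'rV[int]_r.+1).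
Hypothesis a_last : forall i, a i 0 ord_max = 1.
Context (p : 'I_(plucker_num d n) -> \bar R).
Hypothesis pG : trop v (@grassmann_ideal k d n) p.
Hypothesis pX : trop_linear_space p `<=` trop v (@toric_ideal k r n a).

Notation pc := (plucker_coord p).
Notation nonloop := (nonloop p).
Notation class_rep := (class_rep p).

Let p0 : forall s, p s != -oo%E. Proof. exact: trop_neqNy pG. Qed.

Lemma exists_nonloop : exists i, nonloop i.
Proof.
have [sigma Bs] := exists_basis pG.
have /card_gt0P[i is_] : (0 < #|sigma|)%N by rewrite (plucker_coord_card Bs).
by exists i; exact: basis_nonloop is_.
Qed.

(** Otherwise the lighter monomial would be an isolated term of a binomial of the toric ideal. *)
Lemma binomial_weight x u u' : affine_points p x -> (exists i, x i != +oo%E) ->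
  mnm_image a u = mnm_image a u' -> mnm_weight x u = mnm_weight x u'.
Proof.
move=> [x0 xG] xfin uu.
wlog lt_uu : u u' uu / (mnm_weight x u < mnm_weight x u')%E.
  move=> H; case: (boolP (mnm_weight x u < mnm_weight x u')%E) => [|nlt]; first exact: H.
  case: (boolP (mnm_weight x u' < mnm_weight x u)%E) => [gt|ngt]; first by apply/esym/H.
  by apply/eqP; rewrite eq_le !leNgt nlt ngt.
have xX : trop v (toric_ideal a) x by apply: pX; split=> //; split.
have [c uc] : exists c, mnm_weight x u = c%:E.
  have := mnm_weight_neqNy u x0; move: lt_uu; case: (mnm_weight x u) => [c||] //; last first.
    by rewrite ltNge leey.
  by exists c.
have isou : isolated v x ('X_[u] - 'X_[u']) u c.
  apply: isolatedD => //.
    by rewrite -[X in isolated _ _ X]scale1r; apply: isolatedX => //; rewrite vfun1 add0e.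
  move=> m; rewrite -scaleN1r trop_termX // vfunN vfun1 add0e.
  by case: eqP => _; rewrite ?ltry // -uc.
case: (trop_not_isolated xX (binomial_toric_ideal a_last uu) _ isou).
apply: (dhomog_orbit_homog _ x0 (e := mdeg u)); apply: rpredB; rewrite dhomogX //=.
have /(congr1 (fun f => f ord_max)) := uu; rewrite !mnm_image_last // => -[->].
by rewrite eqxx.
Qed.

Definition off_loops (u : 'X_{1..n.+1}) : bool := [forall i, ~~ nonloop i ==> (u i == 0%N)].

Lemma off_loopsP (u : 'X_{1..n.+1}) : reflect (forall i, ~~ nonloop i -> u i = 0%N) (off_loops u).
Proof.
by apply: (iffP forallP) => H i; [move=> /(implyP (H i))/eqP | apply/implyP => /H ->].
Qed.

Lemma mnm_weight_off (x : 'I_n.+1 -> \bar R) (z : 'I_n.+1 -> R) (u : 'X_{1..n.+1}) :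
  (forall i, nonloop i -> x i = (z i)%:E) -> off_loops u ->
  mnm_weight x u = (\sum_i z i *+ u i)%:E.
Proof.
move=> xz /off_loopsP uoff; rewrite -sumEFin; apply: eq_bigr => i _.
have [inl|il] := boolP (nonloop i); first by rewrite xz // EFin_mulrn.
by rewrite uoff.
Qed.

(** At a point finite exactly on the nonloops, a monomial has finite weight iff it avoids the loops,
    and monomials with equal image have equal weight. *)
Lemma off_loops_image u u' : mnm_image a u = mnm_image a u' -> off_loops u -> off_loops u'.
Proof.
move=> uu uoff; have [x xG xP] := exists_nonloop_point pG; have [x0 _] := xG.
have xfin : exists i, x i != +oo%E.
  by have [i inl] := exists_nonloop; exists i; rewrite xP.
have xE i : nonloop i -> x i = (fine (x i))%:E.
  by move=> inl; rewrite fineK //; apply/fin_numP; split; rewrite ?xP.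
have := binomial_weight xG xfin uu; rewrite (mnm_weight_off xE uoff) => u'w.
apply/off_loopsP => i il; apply/eqP; apply: contraT => u'i.
have xi : x i = +oo%E by apply/eqP; rewrite -[_ == _]negbK xP.
by move: u'w; rewrite (mnm_weight_eqy x0 xi u'i).
Qed.

(** The points of [class_direction] differ by 1 exactly on the class, so the two weights of a
    monomial differ by its degree on the class. A class of loops contributes 0 on both sides. *)
Lemma class_sum_eq (u u' : 'X_{1..n.+1}) l : mnm_image a u = mnm_image a u' ->
  off_loops u -> (\sum_(j | class_rep j == l) u j = \sum_(j | class_rep j == l) u' j)%N.
Proof.
move=> uu uoff; have u'off := off_loops_image uu uoff.
have [[i [inl <-]]|nl] := pselect (exists i, nonloop i /\ class_rep i = l); last first.
  rewrite !big1 // => j /eqP jl; apply: (off_loopsP _ _); rewrite //;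
  by apply/negP => jnl; apply: nl; exists j.
have [z [z' [zG z'G zz']]] := class_direction pG inl.
have fin (y : 'I_n.+1 -> R) : exists j, (if nonloop j then (y j)%:E else +oo%E) != +oo%E.
  by exists i; rewrite inl.
have ext (y : 'I_n.+1 -> R) j : nonloop j -> (if nonloop j then (y j)%:E else +oo%E) = (y j)%:E.
  by move=> ->.
have := binomial_weight zG (fin _) uu; have := binomial_weight z'G (fin _) uu.
rewrite !(mnm_weight_off (ext _)) // => -[z'uu] -[zuu].
have sumE (w : 'X_{1..n.+1}) : \sum_j z' j *+ w j =
    \sum_j z j *+ w j + (\sum_(j | class_rep j == class_rep i) w j)%:R.
  rewrite natr_sum [X in _ + X]big_mkcond -big_split /=; apply: eq_bigr => j _.
  rewrite zz' mulrnDl; congr (_ + _); case: eqP => _; first by rewrite mulr1n.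
  by rewrite mulr0n mul0rn.
by move: z'uu; rewrite !sumE zuu => /addrI /eqP; rewrite eqr_nat => /eqP.
Qed.

Lemma exists_class_shift : exists c : 'I_n.+1 -> R, forall i x, affine_points p x ->
  x i = (x (class_rep i) + (c i)%:E)%E.
Proof.
have /choice[c cP] : forall i, exists c : R, forall x, affine_points p x ->
    x i = (x (class_rep i) + c%:E)%E.
  by move=> i; exact: (parallel_sym (parallel_rep p i)).
by exists c.
Qed.

(** On nonloops [c i] is [x i] minus the value of [x] at the representative, so the sum is the
    weight of [u] minus a function of its class degrees; both depend only on the image. *)
Lemma class_shift_image (c : 'I_n.+1 -> R) (u u' : 'X_{1..n.+1}) :
  (forall i x, affine_points p x -> x i = (x (class_rep i) + (c i)%:E)%E) ->
  mnm_image a u = mnm_image a u' -> off_loops u ->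
  \sum_i c i *+ u i = \sum_i c i *+ u' i.
Proof.
move=> cP uu uoff; have u'off := off_loops_image uu uoff.
have [x xG xP] := exists_nonloop_point pG; have [x0 _] := xG.
have xfin : exists i, x i != +oo%E.
  by have [i inl] := exists_nonloop; exists i; rewrite xP.
have xE i : nonloop i -> x i = (fine (x i))%:E.
  by move=> inl; rewrite fineK //; apply/fin_numP; split; rewrite ?xP.
have cE i : nonloop i -> c i = fine (x i) - fine (x (class_rep i)).
  move=> inl; have := cP i x xG.
  rewrite (xE i inl) (xE (class_rep i)); last first.
    by rewrite -(parallel_nonloop pG (parallel_rep p i)).
  by rewrite -EFinD => -[->] /=; rewrite addrC addKr.
have sumE (w : 'X_{1..n.+1}) : off_loops w -> \sum_i c i *+ w i =
    \sum_i fine (x i) *+ w i - \sum_l fine (x l) *+ (\sum_(j | class_rep j == l) w j)%N.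
  move=> /off_loopsP woff.
  have -> : \sum_l fine (x l) *+ (\sum_(j | class_rep j == l) w j)%N =
      \sum_j fine (x (class_rep j)) *+ w j.
    rewrite [RHS](partition_big class_rep xpredT) //=; apply: eq_bigr => l _.
    by rewrite -sumrMnr; apply: eq_bigr => j /eqP <-.
  rewrite -sumrB; apply: eq_bigr => i _.
  have [inl|il] := boolP (nonloop i); first by rewrite cE // mulrnBl.
  by rewrite woff // !mulr0n subr0.
have := binomial_weight xG xfin uu.
rewrite !(mnm_weight_off xE) // => -[xuu].
rewrite !sumE // xuu; congr (_ - _); apply: eq_bigr => l _.
by rewrite (class_sum_eq _ uu).
Qed.

(** The valuations of [t] must solve a linear system with right side [c]. By [int_orthogonal_submx]
    it is solvable once [c] kills the integer relations between the nonloop columns; the positive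
    and negative parts of a relation are two monomials with equal image. *)
Lemma exists_torus_element (c : 'I_n.+1 -> R) :
  (forall i x, affine_points p x -> x i = (x (class_rep i) + (c i)%:E)%E) ->
  exists2 t : 'I_r.+1 -> k, (forall j, t j != 0) &
    forall i, nonloop i -> v (monomial_map a t i) = (c i)%:E.
Proof.
(* Loop columns are set to 0, since no valuation is prescribed there. *)
move=> cP; pose A : 'M[int]_(r.+1, n.+1) := \matrix_(j, i) if nonloop i then a i 0 j else 0.
have [w Aw|y cy] := @int_orthogonal_submx R _ _ A (\row_i if nonloop i then c i else 0).
  pose u : 'X_{1..n.+1} := [multinom if nonloop i && (0 <= w i 0)%R then `|w i 0%R|%N else 0%N | i < n.+1].
  pose u' : 'X_{1..n.+1} := [multinom if nonloop i && (w i 0 < 0)%R then `|w i 0%R|%N else 0%N | i < n.+1].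
  have wE i : nonloop i -> w i 0 = (u i)%:Z - (u' i)%:Z.
    move=> inl; rewrite !mnmE inl /=; case: (leP 0 (w i 0)) => wi; lia.
  have u_loop i : ~~ nonloop i -> u i = 0%N /\ u' i = 0%N.
    by move=> /negbTE il; rewrite !mnmE il.
  have uu : mnm_image a u = mnm_image a u'.
    apply/funext => j; apply/eqP; rewrite -subr_eq0 -sumrB; apply/eqP.
    have /matrixP/(_ j 0) := Aw; rewrite !mxE => H; rewrite -[RHS]H; apply: eq_bigr => i _.
    rewrite mxE; case: ifPn => [inl|/u_loop[-> ->]]; last by rewrite mul0r subr0.
    by rewrite wE // mulrBr; congr (_ - _); rewrite -mulr_natr natz.
  have uoff : off_loops u by apply/off_loopsP => i /u_loop[].
  have cuu := class_shift_image cP uu uoff.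
  apply/matrixP => i0 j0; rewrite !ord1 !mxE.
  transitivity (\sum_i c i *+ u i - \sum_i c i *+ u' i); last by rewrite cuu subrr.
  rewrite -sumrB; apply: eq_bigr => i _; rewrite !mxE.
  case: ifPn => [inl|/u_loop[-> ->]]; last by rewrite mul0r subr0.
  by rewrite wE // rmorphB /= mulrBr !mulr_natr.
have /choice[t tP] : forall j, exists t, t != 0 /\ v t = (y 0 j)%:E.
  by move=> j; have [t t0 vt] := v_surj (y 0 j); exists t.
exists t => [j|i inl]; first by case: (tP j).
rewrite /monomial_map vfun_prod.
have /matrixP/(_ 0 i) := cy; rewrite !mxE inl => ->; rewrite -sumEFin.
apply: eq_bigr => j _; rewrite (vfun_exprz _ (proj2 (tP j))) !mxE inl.
by rewrite mulrzr.
Qed.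

Section Twist.
Context (c : 'I_n.+1 -> R) (t : 'I_r.+1 -> k).
Hypothesis cP : forall i x, affine_points p x -> x i = (x (class_rep i) + (c i)%:E)%E.
Hypothesis t0 : forall j, t j != 0.
Hypothesis tc : forall i, nonloop i -> v (monomial_map a t i) = (c i)%:E.

Let alpha i : k := if nonloop i then monomial_map a t i else 0.

(* Columns in the same parallel class become proportional with ratios in the torus, so that the row
   space lands in the toric variety. *)
Definition twist (S : comAlgType k) (M : 'M[S]_(d.+1, n.+1)) : 'M[S]_(d.+1, n.+1) :=
  \matrix_(b, i) ((alpha i)%:A * M b (class_rep i)).

(** On the universal row a monomial [u] off the loops becomes a monomial in [t], with exponent the
    image of [u], times powers of one linear form per class, with exponents the class degrees. Both
    depend only on the image, so [toric_ideal_sum] applies; the monomials meeting a loop become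
    0. *)
Lemma twist_linear_space_in (S : comAlgType k) (M : 'M[S]_(d.+1, n.+1)) :
  linear_space_in (toric_ideal a) (twist M).
Proof.
move=> g gJ; pose f : {rmorphism k -> {mpoly S[d.+1]}} := @mpolyC d.+1 S \o in_alg S.
rewrite /mmap -[RHS](toric_ideal_sum v_surj a_last f (g := g)
  (phi := mmap1 (fun i => \sum_(j < d.+1) twist M j i *: 'X_j))) //.
move=> u u' uu; pose z l : {mpoly S[d.+1]} := \sum_(j < d.+1) M j l *: 'X_j.
have hE i : \sum_(j < d.+1) twist M j i *: 'X_j = f (alpha i) * z (class_rep i).
  rewrite /z mulr_sumr; apply: eq_bigr => j _ /=.
  by rewrite mxE mul_mpolyC scalerA.
rewrite /mmap1; under eq_bigr do rewrite hE exprMn.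
under [RHS]eq_bigr do rewrite hE exprMn.
have loop0 (w w' : 'X_{1..n.+1}) : mnm_image a w = mnm_image a w' -> ~~ off_loops w ->
    \prod_i (f (alpha i) ^+ w' i * z (class_rep i) ^+ w' i) = 0.
  move=> ww woff; have : ~~ off_loops w' by apply: contra woff; apply: off_loops_image.
  move=> /forallPn[i]; rewrite negb_imply => /andP[/negbTE il wi].
  have fi0 : f (alpha i) = 0 by rewrite /alpha il; exact: rmorph0.
  by rewrite (bigD1 i) // fi0 expr0n (negbTE wi) /= !mul0r.
have [uoff|uoff] := boolP (off_loops u); last by rewrite !(loop0 u).
have u'off := off_loops_image uu uoff.
rewrite !big_split /=; congr (_ * _).
  have alphaE (w : 'X_{1..n.+1}) : off_loops w ->
      \prod_i f (alpha i) ^+ w i = f (\prod_i monomial_map a t i ^+ w i).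
    move=> /off_loopsP woff; rewrite rmorph_prod; apply: eq_bigr => i _; rewrite rmorphXn /=.
    have [inl|il] := boolP (nonloop i); first by rewrite /alpha inl.
    by rewrite woff // !expr0.
  by rewrite !alphaE // !monomial_map_exp // uu.
have zE (w : 'X_{1..n.+1}) : \prod_i z (class_rep i) ^+ w i =
    \prod_l z l ^+ (\sum_(j | class_rep j == l) w j)%N.
  rewrite (partition_big class_rep xpredT) //=; apply: eq_bigr => l _.
  by rewrite -prodrXr; apply: eq_bigr => j /eqP ->.
by rewrite !zE; apply: eq_bigr => l _; rewrite (class_sum_eq _ uu).
Qed.

Lemma det_twist (S : comAlgType k) (M : 'M[S]_(d.+1, n.+1)) (h : 'I_d.+1 -> 'I_n.+1) :
  \det (colsub h (twist M)) = (\prod_j alpha (h j))%:A * \det (colsub (class_rep \o h) M).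
Proof.
have -> : colsub h (twist M) = colsub (class_rep \o h) M *m diag_mx (\row_j (alpha (h j))%:A).
  by apply/matrixP => i j; rewrite mul_mx_diag !mxE mulrC.
rewrite det_mulmx det_diag mulrC; congr (_ * _).
rewrite -[RHS]/(in_alg S (\prod_j alpha (h j))) rmorph_prod; apply: eq_bigr => j _.
by rewrite mxE.
Qed.

Definition twist_form (s : 'I_(plucker_num d n)) : {mpoly k[plucker_num d n]} :=
  (\prod_j alpha (plucker_cols (enum_val s) j)) *:
    plucker_form k (class_rep \o plucker_cols (enum_val s)).

Lemma mmap_twist_form (S : comAlgType k) (M : 'M[S]_(d.+1, n.+1)) s :
  mmap (in_alg S) (plucker M) (twist_form s) = plucker (twist M) s.
Proof. by rewrite mmapZ mmap_plucker_form /plucker det_twist. Qed.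

Lemma alpha_neq0 i : nonloop i -> alpha i != 0.
Proof. by move=> inl; rewrite /alpha inl; apply/prodf_neq0 => j _; rewrite expfz_neq0. Qed.

(* By density it suffices to test the points with entries in [k] whose twist has full rank. *)
Lemma twist_fano_ideal g : fano_ideal (d := d) (@toric_ideal k r n a) g ->
  grassmann_ideal (g \mPo [tuple twist_form s | s < plucker_num d n]).
Proof.
move=> gF S M _; rewrite mmap_comp_mpoly (eq_mmap (f' := in_alg S) (h' := plucker (twist M))) //; last first.
  by move=> s; exact: mmap_twist_form.
pose N := (d.+1 * n.+1)%N.
pose Z : 'M[{mpoly k[N]}]_(d.+1, n.+1) := \matrix_(b, i) 'X_(mxvec_index b i).
(* The claim is reduced to [G = 0] for the generic matrix. A twist may drop rank, so [G] is
   multiplied by a minor [D] of the twist before it is tested at points over [k]. *)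
pose G : {mpoly k[N]} := mmap (in_alg _) (plucker (twist Z)) g.
have specE (S' : comAlgType k) (M' : 'M[S']_(d.+1, n.+1)) (h : 'I_d.+1 -> 'I_n.+1)
    (ev := mmap (in_alg S') (fun x => mxvec M' 0 x)) :
    ev (\det (colsub h (twist Z))) = \det (colsub h (twist M')).
  rewrite /ev -det_map_mx.
  congr (\det _); apply/matrixP => b i; rewrite !mxE rmorphM /= mmapX mmap1U mxvecE.
  by congr (_ * _); rewrite mmapZ rmorph1 mulr1.
have specG (S' : comAlgType k) (M' : 'M[S']_(d.+1, n.+1)) :
    mmap (in_alg S') (fun x => mxvec M' 0 x) G = mmap (in_alg S') (plucker (twist M')) g.
  rewrite /G rmorph_mmap; apply: eq_mmap => [x|s] /=; last exact: specE.
  by rewrite mmapZ rmorph1 mulr1.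
rewrite -specG; suff -> : G = 0 by rewrite raddf0.
have [sigma Bs] := exists_basis pG.
have [h h_inj hE] := set_imset_ord (plucker_coord_card Bs).
have hs j : h j \in sigma by rewrite -hE imset_f.
pose D := \det (colsub h (twist Z)).
have GD : G * D = 0.
  apply: (mpoly_eq0_torus v_surj) => x _; rewrite mevalM -!mmap_in_algE.
  pose M' : 'M[k^o]_(d.+1, n.+1) := vec_mx (\row_i x i).
  have -> : x = fun i => mxvec M' 0 i by apply/funext => i; rewrite vec_mxK mxE.
  rewrite specG specE.
  have [->|detM] := eqVneq (\det (colsub h (twist M'))) 0; first by rewrite mulr0.
  rewrite (gF _ (twist M')) ?mul0r //; first exact: linear_space_minor detM.
  exact: twist_linear_space_in.
(* The elements of the basis [sigma] are nonloops in distinct classes, so some matrix has the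
   identity in the columns of their representatives. *)
have D0 : D != 0.
  pose M' : 'M[k^o]_(d.+1, n.+1) := \matrix_(b, i) (i == class_rep (h b))%:R.
  have : mmap (in_alg k^o) (fun x => mxvec M' 0 x) D != 0.
    rewrite specE det_twist.
    have -> : colsub (class_rep \o h) M' = 1%:M.
      apply/matrixP => b i; rewrite !mxE /= eq_sym; congr (nat_of_bool _)%:R.
      apply/eqP/eqP => [/class_repP bi|->//]; apply/eqP; apply: contraT => nbi.
      by case: (basis_nonparallel pG Bs (hs b) (hs i)); rewrite ?(inj_eq h_inj).
    rewrite det1 mulr1 [_%:A]mulr1; apply/prodf_neq0 => j _; apply: alpha_neq0.
    exact: basis_nonloop (hs j).
  by apply: contra_neq => ->; rewrite raddf0.
by have /eqP := GD; rewrite mulf_eq0 (negbTE D0) orbF => /eqP.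
Qed.

(** For [rho] of size [d] this is [cP] at the cocircuit of [rho]; a smaller set gives +oo on both
    sides. *)
Lemma plucker_coord_rep i (rho : {set 'I_n.+1}) : (#|rho| <= d)%N ->
  pc (i |: rho)%SET = (pc (class_rep i |: rho)%SET + (c i)%:E)%E.
Proof.
rewrite leq_eqVlt => /predU1P[card_rho|lt_d].
  exact: cP (affine_points_cocircuit pG card_rho).
have oo j : pc (j |: rho)%SET = +oo%E.
  apply/eqP; apply: contraT => /plucker_coord_card; rewrite cardsU1 => card_j.
  by move: lt_d; rewrite -ltnS -card_j; case: (j \in rho); rewrite /= ?add0n ?add1n ?ltnn ?ltnNge // leqnSn.
by rewrite !oo.
Qed.

(** On nonloops the sum of the [c (h j)] is the valuation of the coefficient of the twisted form:
    tropically, the twist fixes [p]. *)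
Lemma plucker_coord_class_rep (h : 'I_d.+1 -> 'I_n.+1) :
  pc (h @: 'I_d.+1)%SET = (pc ((class_rep \o h) @: 'I_d.+1)%SET + (\sum_j c (h j))%:E)%E.
Proof.
(* Only the first [m] columns are replaced by their representatives, so each step of the induction
   changes one column. *)
pose hm m j := if (nat_of_ord j < m)%N then class_rep (h j) else h j.
suff H m : (m <= d.+1)%N -> pc (h @: 'I_d.+1)%SET =
    (pc (hm m @: 'I_d.+1)%SET + (\sum_(j < d.+1 | (j < m)%N) c (h j))%:E)%E.
  rewrite (H d.+1) //; congr (_ + _%:E)%E; last by apply: eq_bigl => j; rewrite ltn_ord.
  by congr plucker_coord; apply: eq_imset => j; rewrite /hm ltn_ord.
elim: m => [_|m IH md].
  by rewrite big_pred0 ?adde0 //; congr plucker_coord; apply: eq_imset => j; rewrite /hm.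
rewrite IH ?(ltnW md) //; pose b := Ordinal md.
have split_im (f : 'I_d.+1 -> 'I_n.+1) : (f @: 'I_d.+1 = f b |: (f \o lift b) @: 'I_d)%SET.
  apply/setP => i; rewrite !inE; apply/imsetP/predU1P => [[j _ ->]|[->|/imsetP[j _ ->]]].
  - by case: (unliftP b j) => [j' ->|->]; [right; apply/imsetP; exists j' | left].
  - by exists b.
  - by exists (lift b j).
have lift_eq : (hm m \o lift b) =1 (hm m.+1 \o lift b).
  move=> j; rewrite /hm /=; have := neq_lift b j; rewrite -val_eqE /= => bj.
  by rewrite [in RHS]ltnS [in RHS]leq_eqVlt eq_sym (negbTE bj).
rewrite (split_im (hm m)) (split_im (hm m.+1)) (eq_imset _ lift_eq).
rewrite plucker_coord_rep; last by rewrite (leq_trans (leq_imset_card _ _)) // card_ord.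
have -> : hm m.+1 b = class_rep (hm m b) by rewrite /hm /= ltnn ltnSn.
rewrite -addeA; congr (_ + _)%E; rewrite -EFinD; congr (_%:E).
rewrite [RHS](bigD1 b) //=; congr (_ + _); first by rewrite /hm /= ltnn.
by apply: eq_bigl => j; rewrite ltnS -val_eqE /= [in RHS]leq_eqVlt; case: ltngtP.
Qed.

Lemma trop_fano_twist : trop v (fano_ideal (d := d) (@toric_ideal k r n a)) p.
Proof.
have v_alpha h : (forall j : 'I_d.+1, nonloop (h j)) ->
    v (\prod_j alpha (h j)) = (\sum_j c (h j))%:E.
  move=> hnl; rewrite vfun_prod -sumEFin; apply: eq_bigr => j _.
  by rewrite /alpha hnl tc.
have pcE s : p s = pc (plucker_cols (enum_val s) @: 'I_d.+1)%SET.
  by rewrite plucker_cols_imset plucker_coord_enum enum_valK.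
apply: tropI; first exact: trop_is_point pG.
move=> g m e gF g_homog isog.
have y_ge s m' : (p s <= trop_term v p (twist_form s) m')%E.
  rewrite trop_termZ; set h := plucker_cols (enum_val s).
  have [/forallP hnl|/forallPn[j jl]] := boolP [forall j, nonloop (h j)]; last first.
    rewrite (bigD1 j) //= /alpha (negbTE jl) mul0r vfun0 addye ?leey //.
    exact: trop_term_neqNy.
  rewrite v_alpha // pcE plucker_coord_class_rep addeC leeD2l //.
  exact: plucker_form_ge.
have y_iso s : p s != +oo%E -> exists m1 c1, p s = c1%:E /\ isolated v p (twist_form s) m1 c1.
  set h := plucker_cols (enum_val s) => ps.
  have hnl j : nonloop (h j).
    move: ps; rewrite pcE => Bs; apply: (basis_nonloop Bs); exact: imset_f.
  have [b hb] : exists b, pc ((class_rep \o h) @: 'I_d.+1)%SET = b%:E.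
    move: ps; rewrite pcE plucker_coord_class_rep.
    have := plucker_coord_neqNy p0 ((class_rep \o h) @: 'I_d.+1)%SET.
    by case: plucker_coord => // b; exists b.
  have [m1 iso1] := plucker_form_isolated v p0 hb.
  exists m1, (\sum_j c (h j) + b); split.
    by rewrite pcE plucker_coord_class_rep hb addeC.
  exact: isolatedZ (v_alpha _ hnl) iso1.
have [m1 iso1] := isolated_comp p0 p0 y_ge y_iso isog.
apply: (trop_not_isolated pG (twist_fano_ideal gF) _ iso1).
apply: (orbit_homog_comp p0 y_ge) => // s.
by apply: dhomogZ; exact: plucker_form_homog.
Qed.

End Twist.

Lemma trop_fano_toric_sub : trop v (fano_ideal (d := d) (@toric_ideal k r n a)) p.
Proof.
have [c cP] := exists_class_shift.
have [t t0 tc] := exists_torus_element cP.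
exact: trop_fano_twist cP t0 tc.
Qed.

End ToricFano.

(** * Points and lines of a plane *)

Lemma det_mx2 (S : comNzRingType) (A : 'M[S]_2) :
  \det A = A 0 0 * A 1 1 - A 0 1 * A 1 0.
Proof.
rewrite (expand_det_row _ 0) !big_ord_recl big_ord0 /cofactor !det_mx11 !mxE /=.
have -> : lift (0 : 'I_2) (0 : 'I_1) = 1 by exact: val_inj.
have -> : lift (1 : 'I_2) (0 : 'I_1) = 0 by exact: val_inj.
by rewrite addr0 addn0 expr0 mul1r expr1 mulN1r mulrN.
Qed.

Lemma det_mx3 (S : comNzRingType) (A : 'M[S]_3) :
  \det A = A 0 0 * (A 1 1 * A 2 2 - A 1 2 * A 2 1)
         - A 0 1 * (A 1 0 * A 2 2 - A 1 2 * A 2 0)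
         + A 0 2 * (A 1 0 * A 2 1 - A 1 1 * A 2 0).
Proof.
rewrite (expand_det_row _ 0) !big_ord_recl big_ord0 /cofactor !det_mx2 !mxE /=.
have o1 : lift (0 : 'I_3) (0 : 'I_2) = 1 by exact: val_inj.
have o2 : lift (0 : 'I_3) (1 : 'I_2) = 2 by exact: val_inj.
have o3 : lift (1 : 'I_3) (0 : 'I_2) = 0 by exact: val_inj.
have o4 : lift (1 : 'I_3) (1 : 'I_2) = 2 by exact: val_inj.
have o5 : lift (2 : 'I_3) (0 : 'I_2) = 0 by exact: val_inj.
have o6 : lift (2 : 'I_3) (1 : 'I_2) = 1 by exact: val_inj.
have o7 : lift (0 : 'I_2) (0 : 'I_1) = 1 by exact: val_inj.
rewrite !(o7, o1, o2, o3, o4, o5, o6) /=.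
ring.
Qed.

Lemma sum_ord3 (V : nmodType) (F : 'I_3 -> V) : \sum_a F a = F 0 + F 1 + F 2.
Proof.
rewrite !big_ord_recl big_ord0 addr0 addrA.
have -> : lift (ord0 : 'I_3) (ord0 : 'I_2) = 1 by exact: val_inj.
by have -> : lift (ord0 : 'I_3) (lift (ord0 : 'I_2) (ord0 : 'I_1)) = 2 by exact: val_inj.
Qed.

Lemma ord3E (a : 'I_3) : [|| a == 0, a == 1 | a == 2].
Proof. by case: a => -[|[|[|m]]] lt_m. Qed.

Section Brackets.
Context (S : comNzRingType) (n : nat) (L : 'M[S]_(3, n.+1)).
Implicit Types i j l : 'I_n.+1.

Definition triple i j l : 'I_3 -> 'I_n.+1 := fun a => tnth [tuple i; j; l] a.

Definition bracket i j l : S := \det (colsub (triple i j l) L).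

(* In the basis of rows of [L], the coordinates of the point of [L] where x_i = x_j = 0. *)
Definition cross i j : 'rV[S]_3 := \row_a tnth
  [tuple L 1 i * L 2 j - L 2 i * L 1 j; L 2 i * L 0 j - L 0 i * L 2 j;
         L 0 i * L 1 j - L 1 i * L 0 j] a.

Lemma bracketE i j l : bracket i j l =
  L 0 i * (L 1 j * L 2 l - L 1 l * L 2 j) - L 0 j * (L 1 i * L 2 l - L 1 l * L 2 i)
  + L 0 l * (L 1 i * L 2 j - L 1 j * L 2 i).
Proof. by rewrite /bracket det_mx3 !mxE. Qed.

Lemma cross_coords i j :
  [/\ cross i j 0 0 = L 1 i * L 2 j - L 2 i * L 1 j,
      cross i j 0 1 = L 2 i * L 0 j - L 0 i * L 2 j &
      cross i j 0 2 = L 0 i * L 1 j - L 1 i * L 0 j].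
Proof. by split; rewrite mxE. Qed.

Lemma crossE i j l : (cross i j *m L) 0 l = bracket i j l.
Proof.
rewrite bracketE mxE sum_ord3; have [-> -> ->] := cross_coords i j; ring.
Qed.

Definition cross_mx i0 i1 i2 i3 i4 i5 : 'M[S]_3 :=
  \matrix_(a, b) tnth [tuple cross i0 i1; cross i2 i3; cross i4 i5] a 0 b.

(** Collinearity of the three meeting points in terms of brackets: as a polynomial in maximal
    minors, it makes genericity an open condition on the Grassmannian. *)
Lemma det_cross_mx i0 i1 i2 i3 i4 i5 : \det (cross_mx i0 i1 i2 i3 i4 i5) =
  bracket i0 i2 i3 * bracket i1 i4 i5 - bracket i0 i4 i5 * bracket i1 i2 i3.
Proof.
have rE0 b : cross_mx i0 i1 i2 i3 i4 i5 0 b = cross i0 i1 0 b by rewrite mxE.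
have rE1 b : cross_mx i0 i1 i2 i3 i4 i5 1 b = cross i2 i3 0 b by rewrite mxE.
have rE2 b : cross_mx i0 i1 i2 i3 i4 i5 2 b = cross i4 i5 0 b by rewrite mxE.
have [c00 c01 c02] := cross_coords i0 i1.
have [c10 c11 c12] := cross_coords i2 i3.
have [c20 c21 c22] := cross_coords i4 i5.
rewrite det_mx3 !(rE0, rE1, rE2) c00 c01 c02 c10 c11 c12 c20 c21 c22 !bracketE.
ring.
Qed.

End Brackets.

Lemma tripleE n (i j l : 'I_n.+1) (a : 'I_3) :
  triple i j l a = if a == 0 then i else if a == 1 then j else l.
Proof. by case: a => -[|[|[|m]]] lt_m //. Qed.

Lemma triple_inj n (i j l : 'I_n.+1) : uniq [:: i; j; l] -> injective (triple i j l).
Proof.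
by move=> /(tuple_uniqP [tuple i; j; l]).
Qed.

Section PlaneGeometry.
Context (k : fieldType) (n : nat) (L : 'M[k]_(3, n.+1)).
Implicit Types i j l : 'I_n.+1.

Lemma sub_coord_hyperplane (u : 'rV[k]_n.+1) i :
  (u <= coord_hyperplane k i)%MS = (u 0 i == 0).
Proof.
apply/sub_kermxP/eqP => [/matrixP/(_ 0 0)|ui].
  rewrite !mxE (bigD1 i) //= mxE !eqxx mulr1 big1 ?addr0 // => j ji.
  by rewrite mxE (negbTE ji) mulr0.
apply/matrixP => a b; rewrite !ord1 !mxE (bigD1 i) //= mxE !eqxx mulr1 ui add0r.
by rewrite big1 // => j ji; rewrite mxE (negbTE ji) mulr0.
Qed.

Lemma sub_coord_meet (u : 'rV[k]_n.+1) i j :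
  (u <= coord_meet L i j)%MS = [&& (u <= L)%MS, u 0 i == 0 & u 0 j == 0].
Proof.
rewrite /coord_meet /coord_line !sub_capmx !sub_coord_hyperplane.
by case: (u <= L)%MS; rewrite ?andbT ?andbF //=.
Qed.

Lemma mulmx_triple0 (c : 'rV[k]_3) i j l : bracket L i j l != 0 ->
  (c *m L) 0 i = 0 -> (c *m L) 0 j = 0 -> (c *m L) 0 l = 0 -> c = 0.
Proof.
move=> b0 ci cj cl; have Qu : colsub (triple i j l) L \in unitmx by rewrite unitmxE unitfE.
have cQ : c *m colsub (triple i j l) L = 0.
  apply/matrixP => a b; rewrite ord1.
  have -> : (c *m colsub (triple i j l) L) 0 b = (c *m L) 0 (triple i j l b).
    by rewrite !mxE; apply: eq_bigr => e _; rewrite mxE.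
  by rewrite tripleE [RHS]mxE; case: ifP => // _; case: ifP.
by rewrite -[c](mulmxK Qu) cQ mul0mx.
Qed.

(** A nonzero bracket makes the meet a single point: subtracting [s] times the cross product kills
    coordinate [l] as well, and only 0 has all three coordinates zero. *)
Lemma coord_meet_cross i j l : bracket L i j l != 0 ->
  (coord_meet L i j <= cross L i j *m L)%MS.
Proof.
move=> b0; apply/rV_subP => u; rewrite sub_coord_meet => /and3P[/submxP[c ->] /eqP ci /eqP cj].
pose s := (c *m L) 0 l / bracket L i j l.
have brE m : (cross L i j *m L) 0 m = bracket L i j m by exact: crossE.
have cE m : ((c - s *: cross L i j) *m L) 0 m = (c *m L) 0 m - s * bracket L i j m.
  rewrite mulmxBl -scalemxAl -brE.
  by move: (c *m L) (cross L i j *m L) => A B; rewrite !mxE.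
suff -> : c = s *: cross L i j by rewrite -scalemxAl scalemx_sub.
apply/eqP; rewrite -subr_eq0; apply/eqP; apply: (mulmx_triple0 b0).
- by rewrite cE ci bracketE; ring.
- by rewrite cE cj bracketE; ring.
- by rewrite cE /s divfK // subrr.
Qed.

Lemma cross_coord_meet i j : (cross L i j *m L <= coord_meet L i j)%MS.
Proof.
rewrite sub_coord_meet submxMl !crossE !bracketE /=; apply/andP; split; apply/eqP; ring.
Qed.

Lemma cross_mx_rows i0 i1 i2 i3 i4 i5 :
  [/\ row 0 (cross_mx L i0 i1 i2 i3 i4 i5) = cross L i0 i1,
      row 1 (cross_mx L i0 i1 i2 i3 i4 i5) = cross L i2 i3 &
      row 2 (cross_mx L i0 i1 i2 i3 i4 i5) = cross L i4 i5].
Proof. by split; apply/matrixP => a b; rewrite !ord1 !mxE. Qed.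

Lemma collinear_cross_mx i0 i1 i2 i3 i4 i5 : row_free L ->
  \det (cross_mx L i0 i1 i2 i3 i4 i5) != 0 ->
  ~~ collinear (coord_meet L i0 i1) (coord_meet L i2 i3) (coord_meet L i4 i5).
Proof.
move=> Lfree W0; set W := cross_mx _ _ _ _ _ _ _ in W0.
have Wu : row_free W by rewrite row_free_unit unitmxE unitfE.
have [r0 r1 r2] := cross_mx_rows i0 i1 i2 i3 i4 i5.
have rW : \rank (W *m L) = 3%N by rewrite mxrankMfree //; exact/eqP.
rewrite /collinear -ltnNge -rW; apply: mxrankS; apply/row_subP => a; rewrite row_mul.
case/or3P: (ord3E a) => /eqP ->; rewrite /W ?r0 ?r1 ?r2.
- apply: submx_trans (cross_coord_meet _ _) _.
  by apply: submx_trans (addsmxSl _ _) (addsmxSl _ _).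
- apply: submx_trans (cross_coord_meet _ _) _.
  by apply: submx_trans (addsmxSr _ _) (addsmxSl _ _).
- by apply: submx_trans (cross_coord_meet _ _) (addsmxSr _ _).
Qed.

Lemma noncollinear_cross_mx i0 i1 i2 i3 i4 i5 :
  (exists l, bracket L i0 i1 l != 0) -> (exists l, bracket L i2 i3 l != 0) ->
  (exists l, bracket L i4 i5 l != 0) ->
  ~~ collinear (coord_meet L i0 i1) (coord_meet L i2 i3) (coord_meet L i4 i5) ->
  \det (cross_mx L i0 i1 i2 i3 i4 i5) != 0.
Proof.
move=> [l0 b0] [l1 b1] [l2 b2]; apply: contraNneq => W0.
set W := cross_mx _ _ _ _ _ _ _ in W0.
have [r0 r1 r2] := cross_mx_rows i0 i1 i2 i3 i4 i5.
have W2 : (\rank W <= 2)%N.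
  rewrite -ltnS ltn_neqAle rank_leq_row andbT; apply/negP => Wfree.
  by have : W \in unitmx; [rewrite -row_free_unit | rewrite unitmxE W0 unitr0].
rewrite /collinear; apply: leq_trans W2; apply: leq_trans (mxrankM_maxl W L).
apply: mxrankS; rewrite !addsmx_sub -!andbA; apply/and3P; split.
- by apply: submx_trans (coord_meet_cross b0) _; rewrite -r0 -row_mul row_sub.
- by apply: submx_trans (coord_meet_cross b1) _; rewrite -r1 -row_mul row_sub.
- by apply: submx_trans (coord_meet_cross b2) _; rewrite -r2 -row_mul row_sub.
Qed.

End PlaneGeometry.

(** * Generic planes form a nonempty open set *)

Section Genericity.
Context (k : fieldType) (R : realType) (v : valuation k R).
Hypothesis v_surj : surjective_valuation v.

(** Each form pulls back to a nonzero polynomial in the matrix entries; the product of these is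
    nonzero, hence nonzero at some point. *)
Lemma common_nonvanishing d n (T : eqType) (s : seq T)
    (F : T -> {mpoly k[plucker_num d n]}) :
  (forall t, t \in s -> exists M : 'M[k]_(d.+1, n.+1), (F t).@[plucker M] != 0) ->
  exists M : 'M[k]_(d.+1, n.+1), forall t, t \in s -> (F t).@[plucker M] != 0.
Proof.
move=> sF; pose N := (d.+1 * n.+1)%N.
pose Z : 'M[{mpoly k[N]}]_(d.+1, n.+1) := \matrix_(b, i) 'X_(mxvec_index b i).
pose G t : {mpoly k[N]} := F t \mPo [tuple plucker Z i | i < plucker_num d n].
have GE t (M : 'M[k]_(d.+1, n.+1)) : (G t).@[fun x => mxvec M 0 x] = (F t).@[plucker M].
  rewrite comp_mpoly_meval; apply: meval_eq => i; rewrite tnth_mktuple /plucker.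
  rewrite -det_map_mx; congr (\det _); apply/matrixP => b j.
  by rewrite !mxE /= mevalXU mxvecE.
have G0 : \prod_(t <- s) G t != 0.
  rewrite prodf_seq_neq0; apply/allP => t ts; have [M Mt] := sF t ts.
  by apply: contraNneq Mt => Gt; rewrite -GE Gt meval0.
have [x] : exists x, (\prod_(t <- s) G t).@[x] != 0.
  apply/notP => H; move/eqP: G0; apply; apply: (mpoly_eq0_torus v_surj) => z _.
  by apply/eqP/negPn/negP => Gz; apply: H; exists z.
rewrite rmorph_prod /= prodf_seq_neq0 => /allP sG.
exists (vec_mx (\row_i x i)) => t ts; rewrite -GE.
have -> : (fun i => mxvec (vec_mx (\row_i x i) : 'M_(d.+1, n.+1)) 0 i) = x.
  by apply/funext => i; rewrite vec_mxK mxE.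
exact: sG.
Qed.

Definition cross_form n i0 i1 i2 i3 i4 i5 : {mpoly k[plucker_num 2 n]} :=
  let pf i j l := plucker_form k (triple i j l : 'I_3 -> 'I_n.+1) in
  pf i0 i2 i3 * pf i1 i4 i5 - pf i0 i4 i5 * pf i1 i2 i3.

Lemma cross_formE n (M : 'M[k]_(3, n.+1)) i0 i1 i2 i3 i4 i5 :
  (cross_form i0 i1 i2 i3 i4 i5).@[plucker M] = \det (cross_mx M i0 i1 i2 i3 i4 i5).
Proof. by rewrite mevalB !mevalM !meval_plucker_form -det_cross_mx. Qed.

Lemma cross_form_homog n (i0 i1 i2 i3 i4 i5 : 'I_n.+1) :
  cross_form i0 i1 i2 i3 i4 i5 \is 2.-homog.
Proof.
by apply: rpredB; apply: (dhomogM (d := 1) (e := 1)); exact: plucker_form_homog.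
Qed.

Lemma exists_bracket_neq0 n (i j l : 'I_n.+1) : uniq [:: i; j; l] ->
  exists M : 'M[k]_(3, n.+1), bracket M i j l != 0.
Proof.
move=> /triple_inj t_inj; exists (\matrix_(a, m) (m == triple i j l a)%:R).
rewrite /bracket (_ : colsub _ _ = 1%:M) ?det1 ?oner_eq0 //.
by apply/matrixP => a b; rewrite !mxE (inj_eq t_inj) eq_sym.
Qed.

Lemma exists_cross_neq0 n (i0 i1 i2 i3 i4 i5 : 'I_n.+1) :
  uniq [:: i0; i1; i2; i3; i4; i5] ->
  exists M : 'M[k]_(3, n.+1), \det (cross_mx M i0 i1 i2 i3 i4 i5) != 0.
Proof.
move=> /(tuple_uniqP [tuple i0; i1; i2; i3; i4; i5]).
set t := [tuple _; _; _; _; _; _] => t_inj.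
(* The columns are e0, e1; e1, e2; e0, e2. The cross products of the three pairs are, up to sign,
   the three unit vectors. *)
pose g : 6.-tuple 'I_3 := [tuple 0; 1; 1; 2; 0; 2].
pose M : 'M[k]_(3, n.+1) := \matrix_(a, m)
  (if [pick j | tnth t j == m] is Some j then tnth g j == a else false)%:R.
have ME a j : M a (tnth t j) = (tnth g j == a)%:R.
  rewrite mxE; case: pickP => [j' /eqP/t_inj -> //|/(_ j)]; by rewrite eqxx.
exists M; rewrite det_cross_mx !bracketE.
have M0 a : M a i0 = (0 == a)%:R := ME a 0.
have M1 a : M a i1 = (1 == a)%:R := ME a 1.
have M2 a : M a i2 = (1 == a)%:R := ME a 2.
have M3 a : M a i3 = (2 == a)%:R := ME a 3.
have M4 a : M a i4 = (0 == a)%:R := ME a 4.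
have M5 a : M a i5 = (2 == a)%:R := ME a 5.
have e01 : (0 == 1 :> 'I_3) = false by [].
have e02 : (0 == 2 :> 'I_3) = false by [].
have e12 : (1 == 2 :> 'I_3) = false by [].
have e10 : (1 == 0 :> 'I_3) = false by [].
have e20 : (2 == 0 :> 'I_3) = false by [].
have e21 : (2 == 1 :> 'I_3) = false by [].
rewrite !(M0, M1, M2, M3, M4, M5) !(eqxx, e01, e02, e12, e10, e20, e21).
rewrite -[nat_of_bool true]/1%N -[nat_of_bool false]/0%N !mulr1n !mulr0n.
rewrite !(mul0r, mulr0, mul1r, mulr1, subr0, sub0r, addr0, add0r, oppr0, mulrN1).
by rewrite oppr_eq0 oner_eq0.
Qed.

Lemma det_cross_mx_shared n (M : 'M[k]_(3, n.+1)) a b d e f :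
  \det (cross_mx M a b a d e f) = bracket M a e f * bracket M a b d.
Proof. rewrite det_cross_mx !bracketE; ring. Qed.

Lemma det_cross_mx_swap1 n (M : 'M[k]_(3, n.+1)) i0 i1 i2 i3 i4 i5 :
  \det (cross_mx M i1 i0 i2 i3 i4 i5) = - \det (cross_mx M i0 i1 i2 i3 i4 i5).
Proof. rewrite !det_cross_mx !bracketE; ring. Qed.

Lemma det_cross_mx_swap2 n (M : 'M[k]_(3, n.+1)) i0 i1 i2 i3 i4 i5 :
  \det (cross_mx M i0 i1 i3 i2 i4 i5) = - \det (cross_mx M i0 i1 i2 i3 i4 i5).
Proof. rewrite !det_cross_mx !bracketE; ring. Qed.

Lemma det_cross_mx_swap12 n (M : 'M[k]_(3, n.+1)) i0 i1 i2 i3 i4 i5 :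
  \det (cross_mx M i2 i3 i0 i1 i4 i5) = - \det (cross_mx M i0 i1 i2 i3 i4 i5).
Proof. rewrite !det_cross_mx !bracketE; ring. Qed.

Lemma det_cross_mx_swap23 n (M : 'M[k]_(3, n.+1)) i0 i1 i2 i3 i4 i5 :
  \det (cross_mx M i0 i1 i4 i5 i2 i3) = - \det (cross_mx M i0 i1 i2 i3 i4 i5).
Proof. rewrite !det_cross_mx !bracketE; ring. Qed.

(* If two of the three pairs share an index, the determinant is a product of two brackets. *)
Lemma det_cross_mx_neq0 n (M : 'M[k]_(3, n.+1)) i0 i1 i2 i3 i4 i5 :
  (forall i j l, uniq [:: i; j; l] -> bracket M i j l != 0) ->
  i0 != i1 -> i2 != i3 -> i4 != i5 ->
  uniq [:: [set i0; i1]%SET; [set i2; i3]%SET; [set i4; i5]%SET] ->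
  ([set i0; i1] :&: [set i2; i3] :&: [set i4; i5])%SET == finset.set0 ->
  ~~ uniq [:: i0; i1; i2; i3; i4; i5] ->
  \det (cross_mx M i0 i1 i2 i3 i4 i5) != 0.
Proof.
move=> br0.
have base a b c d e f : a != b -> c != d -> e != f ->
    [set a; b]%SET != [set c; d]%SET ->
    ([set a; b] :&: [set c; d] :&: [set e; f])%SET == finset.set0 ->
    has (mem [:: c; d]) [:: a; b] -> \det (cross_mx M a b c d e f) != 0.
  wlog ac : a b c d / a = c => [H ab cd ef abcd abcdef sh|].
    have sab : [set b; a]%SET = [set a; b]%SET by rewrite finset.setUC.
    have scd : [set d; c]%SET = [set c; d]%SET by rewrite finset.setUC.
    have ba : b != a by rewrite eq_sym.
    have dc : d != c by rewrite eq_sym.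
    have hs a' b' c' d' : a' = c' -> has (mem [:: c'; d']) [:: a'; b'].
      by move=> ->; rewrite /= !inE eqxx.
    move: (sh); rewrite /= !inE orbF => /orP[/orP[/eqP E|/eqP E]|/orP[/eqP E|/eqP E]].
    - exact: H.
    - rewrite -oppr_eq0 -det_cross_mx_swap2; apply: (H a b d c E) => //; rewrite ?scd //.
      exact: hs.
    - rewrite -oppr_eq0 -det_cross_mx_swap1; apply: (H b a c d E) => //; rewrite ?sab //.
      exact: hs.
    - rewrite -oppr_eq0 -det_cross_mx_swap1 -oppr_eq0 -det_cross_mx_swap2.
      by apply: (H b a d c E) => //; rewrite ?sab ?scd //; exact: hs.
  rewrite -{}ac => ab ad ef abad abef _.
  have bd : b != d by apply: contraNneq abad => ->.
  have /eqP/setP/(_ a) := abef; rewrite !inE eqxx /= => /negbT; rewrite negb_or => /andP[ae af].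
  by rewrite det_cross_mx_shared mulf_neq0 // br0 //= !inE !negb_or ?ae ?af ?ef ?ad ?ab ?bd.
move=> i01 i23 i45; rewrite /= !inE !negb_or andbT => /andP[/andP[nAB nAC] nBC] ABC nu.
have ACB : ([set i0; i1] :&: [set i4; i5] :&: [set i2; i3])%SET == finset.set0.
  by rewrite -finset.setIA [X in _ :&: X]finset.setIC finset.setIA.
have BCA : ([set i2; i3] :&: [set i4; i5] :&: [set i0; i1])%SET == finset.set0.
  by rewrite finset.setIC finset.setIA.
have [sAB|nsAB] := boolP (has (mem [:: i2; i3]) [:: i0; i1]); first exact: base.
have [sAC|nsAC] := boolP (has (mem [:: i4; i5]) [:: i0; i1]).
  by rewrite -oppr_eq0 -det_cross_mx_swap23; exact: base.
have [sBC|nsBC] := boolP (has (mem [:: i4; i5]) [:: i2; i3]).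
  rewrite -oppr_eq0 -det_cross_mx_swap12 -oppr_eq0 -det_cross_mx_swap23.
  exact: base.
case/negP: nu; move: nsAB nsAC nsBC; rewrite /= !inE !negb_or !andbT.
move=> /andP[/andP[? ?] /andP[? ?]] /andP[/andP[? ?] /andP[? ?]] /andP[/andP[? ?] /andP[? ?]].
by do ![apply/andP; split].
Qed.

Lemma generic_lines_cross n (M : 'M[k]_(3, n.+1)) : row_free M ->
  (forall i j l, uniq [:: i; j; l] -> bracket M i j l != 0) ->
  (forall i0 i1 i2 i3 i4 i5, uniq [:: i0; i1; i2; i3; i4; i5] ->
     \det (cross_mx M i0 i1 i2 i3 i4 i5) != 0) ->
  generic_lines M.
Proof.
move=> Mfree br0 cr0; split=> [i j l ijl|i0 i1 i2 i3 i4 i5 i01 i23 i45 ABC ABC0].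
  apply/eqP; rewrite -submx0; apply/rV_subP => u.
  rewrite /coord_line !sub_capmx !sub_coord_hyperplane.
  move=> /andP[/andP[/andP[/submxP[c ->] /eqP ci] /andP[_ /eqP cj]] /andP[_ /eqP cl]].
  by rewrite (mulmx_triple0 (br0 _ _ _ ijl) ci cj cl) mul0mx sub0mx.
apply: collinear_cross_mx => //.
have [iu|iu] := boolP (uniq [:: i0; i1; i2; i3; i4; i5]); first exact: cr0.
exact: det_cross_mx_neq0.
Qed.

(** The open set is the complement of one hypersurface: [Phi] multiplies the brackets of distinct
    indices and the cross forms of six distinct indices. Pairs sharing an index are covered by the
    brackets. *)
Lemma exists_generic_open n : (2 <= n)%N -> exists U : set 'M[k]_(3, n.+1),
  [/\ zariski_open (d := 2) U, U !=set0 & forall M, U M -> generic_lines M].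
Proof.
move=> n2.
pose T3 := [seq f : 3.-tuple 'I_n.+1 <- enum {: 3.-tuple 'I_n.+1} | uniq f].
pose T6 := [seq f : 6.-tuple 'I_n.+1 <- enum {: 6.-tuple 'I_n.+1} | uniq f].
pose F3 (f : 3.-tuple 'I_n.+1) := plucker_form k (tnth f).
pose F6 (f : 6.-tuple 'I_n.+1) :=
  cross_form (tnth f 0) (tnth f 1) (tnth f 2) (tnth f 3) (tnth f 4) (tnth f 5).
pose Phi := \prod_(f <- T3) F3 f * \prod_(f <- T6) F6 f.
have PhiE (M : 'M[k]_(3, n.+1)) : Phi.@[plucker M] != 0 <->
    (forall f, f \in T3 -> (F3 f).@[plucker M] != 0) /\
    (forall f, f \in T6 -> (F6 f).@[plucker M] != 0).
  rewrite mevalM mulf_eq0 negb_or !rmorph_prod /= !prodf_seq_neq0.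
  split=> [/andP[/allP ? /allP ?]//|[H3 H6]].
  by apply/andP; split; apply/allP.
have Phi_homog : exists e, Phi \is e.-homog.
  pose hom (f : {mpoly k[plucker_num 2 n]}) := exists e, f \is e.-homog.
  have homM f g : hom f -> hom g -> hom (f * g).
    by move=> [e fe] [e' ge]; exists (e + e')%N; exact: dhomogM.
  have hom1 : hom 1 by exists 0%N; exact: dhomog1.
  apply: (homM); apply: (big_ind hom) => // f _; first by exists 1%N; exact: plucker_form_homog.
  by exists 2%N; exact: cross_form_homog.
have Phi_bracket (M : 'M[k]_(3, n.+1)) : Phi.@[plucker M] != 0 ->
    forall i j l, uniq [:: i; j; l] -> bracket M i j l != 0.
  move=> /PhiE[H3 _] i j l ijl; rewrite -[bracket _ _ _ _]meval_plucker_form.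
  by apply: (H3 [tuple i; j; l]); rewrite mem_filter mem_enum andbT.
have Phi_free (M : 'M[k]_(3, n.+1)) : Phi.@[plucker M] != 0 -> row_free M.
  move=> /Phi_bracket M0; pose o (m : nat) : 'I_n.+1 := inord m.
  have : uniq [:: o 0%N; o 1%N; o 2%N].
    by rewrite /= !inE /o -!val_eqE /= !inordK // ltnS ltnW.
  move=> /M0/(linear_space_minor (M := M : 'M[k^o]_(_, _)))[B MB].
  by apply/row_freeP; exists B.
exists [set M | row_free M /\ exists2 f, f = Phi & f.@[plucker M] != 0]; split.
- by exists [set Phi]; split=> // f ->.
- have [|M MP] := @common_nonvanishing 2 n _ [:: Phi] id; last first.
    by exists M; have := MP Phi (mem_head _ _); split; [exact: Phi_free | exists Phi].
  move=> f; rewrite inE => /eqP ->.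
  pose F (f : 3.-tuple 'I_n.+1 + 6.-tuple 'I_n.+1) :=
    match f with inl f => F3 f | inr f => F6 f end.
  have [|M MP] := @common_nonvanishing 2 n _ ([seq inl f | f <- T3] ++ [seq inr f | f <- T6]) F.
    move=> f'; rewrite mem_cat => /orP[]/mapP[f''] + ->; rewrite mem_filter => /andP[fu _] /=.
      have := @exists_bracket_neq0 n (tnth f'' 0) (tnth f'' 1) (tnth f'' 2).
      have fE : f'' = [tuple tnth f'' 0; tnth f'' 1; tnth f'' 2].
        by apply/eq_from_tnth => -[[|[|[|m]]] lt_m] //; congr tnth; exact: val_inj.
      rewrite fE in fu; move=> /(_ fu)[M M0]; exists M.
      by rewrite /F3 meval_plucker_form fE.
    have fE : f'' = [tuple tnth f'' 0; tnth f'' 1; tnth f'' 2; tnth f'' 3; tnth f'' 4; tnth f'' 5].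
      by apply/eq_from_tnth => -[[|[|[|[|[|[|m]]]]]] lt_m] //; congr tnth; exact: val_inj.
    rewrite fE in fu; have [M M0] := exists_cross_neq0 fu.
    by exists M; rewrite /F6 cross_formE.
  exists M; apply/PhiE; split=> f' f'T.
    by apply: (MP (inl f')); rewrite mem_cat map_f.
  by apply: (MP (inr f')); rewrite mem_cat map_f ?orbT.
- move=> M [Mfree [f -> M0]]; apply: generic_lines_cross => //; first exact: Phi_bracket.
  move=> i0 i1 i2 i3 i4 i5 iu; rewrite -cross_formE; have [_ H6] := (PhiE M).1 M0.
  by apply: (H6 [tuple i0; i1; i2; i3; i4; i5]); rewrite mem_filter mem_enum andbT.
Qed.

End Genericity.

(** * A tropical line in a plane that does not lift *)

Section LinearIdeal.
Context (k : fieldType) (R : realType) (v : valuation k R).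
Hypothesis v_surj : surjective_valuation v.
Context (d n : nat) (L : 'M[k]_(d.+1, n.+1)).

Lemma linear_ideal_self : linear_space_in (linear_ideal L) (L : 'M[k^o]_(d.+1, n.+1)).
Proof.
move=> g gL; apply: (mpoly_eq0_torus v_surj) => z z0.
rewrite [LHS](rmorph_mmap (meval z)).
pose c : 'rV[k]_d.+1 := \row_j z j.
have c0 : c != 0.
  by apply/eqP => /matrixP/(_ 0 0); rewrite !mxE; apply/eqP.
rewrite -[RHS](gL (fun i => (c *m L) 0 i) 1 _ (oner_neq0 k)); last by exists c.
rewrite /meval; apply: eq_mmap => [x|i] /=; first by rewrite mevalC [x%:A]mulr1.
rewrite raddf_sum mul1r mxE; apply: eq_bigr => j _.
by rewrite /= mevalZ mevalXU mxE mulrC.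
Qed.

(** [Q] is a projection onto the row space of [L], so the coordinates of [x - x Q] are linear forms
    in the ideal and force [M = M Q] over any algebra. *)
Lemma linear_ideal_factor (S : comAlgType k) e (M : 'M[S]_(e.+1, n.+1)) :
  row_free L -> linear_space_in (linear_ideal L) M ->
  exists N, M = N *m map_mx (in_alg S) L.
Proof.
move=> /row_freeP[B LB] ML; exists (M *m map_mx (in_alg S) B).
rewrite -mulmxA -map_mxM; set Q := B *m L.
pose g i : {mpoly k[n.+1]} := 'X_i - \sum_l Q l i *: 'X_l.
have gL i : linear_ideal L (g i).
  move=> _ c [w _ ->] _; rewrite mevalB mevalXU (rmorph_sum (meval _)) /=.
  have -> : (w *m L) 0 i = ((w *m L) *m Q) 0 i by rewrite mulmxA -(mulmxA w) LB mulmx1.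
  rewrite [X in c * X - _]mxE mulr_sumr -sumrB big1 // => l _.
  by rewrite mevalZ mevalXU; ring.
apply/matrixP => a i; apply/eqP; rewrite -subr_eq0; apply/eqP.
rewrite -[RHS](linear_space_in_eval (fun j => (j == a)%:R) ML (gL i)).
have rowE l : \sum_j M j l * (j == a)%:R = M a l.
  rewrite (bigD1 a) //= eqxx mulr1 big1 ?addr0 // => j ja.
  by rewrite (negbTE ja) mulr0.
rewrite /g mmapB mmapX mmap1U rowE; congr (_ - _).
rewrite [LHS]mxE raddf_sum /=; apply: eq_bigr => l _; rewrite mmapZ mmapX mmap1U rowE mxE.
by rewrite mulrC.
Qed.

End LinearIdeal.

Lemma trop_point_of_kpoint (k : fieldType) (R : realType) (v : valuation k R) N
    (J : set {mpoly k[N]}) (z : 'I_N -> k) :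
  (exists i, z i != 0) -> (forall g, J g -> g.@[z] = 0) -> trop v J (fun i => v (z i)).
Proof.
move=> [i zi] Jz; apply: tropI.
  by split=> [j|]; [exact: vfun_neqNy | exists i; rewrite vfun_eqy].
by move=> g m c /Jz gz _ /isolated_meval; rewrite gz eqxx.
Qed.

Section StrictInclusion.
Context (k : fieldType) (R : realType) (v : valuation k R).
Hypothesis v_surj : surjective_valuation v.
Context (n : nat).
Hypothesis n5 : (5 <= n)%N.

(* The tropical line with center at the origin, on which the leaves 0 and 1, 2 and 3, 4 and 5 meet at
   infinity. *)
Definition leaf_class (i : 'I_n.+1) : nat := if (i < 6)%N then i./2 else i.

Definition tripod (s : 'I_(plucker_num 1 n)) : \bar R :=
  if leaf_class (plucker_cols (enum_val s) 0) == leaf_class (plucker_cols (enum_val s) 1)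
  then +oo%E else 0%E.

Lemma tripod_coord i j : plucker_coord tripod [set i; j]%SET =
  if leaf_class i == leaf_class j then +oo%E else 0%E.
Proof.
rewrite /plucker_coord; case: insubP => [s _ sE|]; last first.
  by rewrite cards2; have [->|//] := eqVneq i j; rewrite eqxx.
rewrite /tripod enum_rankK.
have sij : [set plucker_cols s 0; plucker_cols s 1]%SET = [set i; j]%SET.
  rewrite -sE -plucker_cols_imset; apply/setP => l; rewrite !inE.
  apply/orP/imsetP => [[/eqP ->|/eqP ->]|[a _ ->]]; [by exists 0 | by exists 1|].
  have : a \in [:: 0; 1] by case: a => -[|[|m]] lt_m.
  by rewrite !inE => /orP[] /eqP ->; rewrite eqxx; [left | right].
have s01 : plucker_cols s 0 != plucker_cols s 1 by rewrite (inj_eq (@plucker_cols_inj _ _ s)).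
have : plucker_cols s 0 \in [set i; j]%SET by rewrite -sij !inE eqxx.
have : plucker_cols s 1 \in [set i; j]%SET by rewrite -sij !inE eqxx orbT.
rewrite !inE => /orP[] /eqP s1 /orP[] /eqP s0; move: s01; rewrite s0 s1.
- by rewrite eqxx.
- by move=> _; rewrite eq_sym.
- by [].
- by rewrite eqxx.
Qed.

Lemma tripod_neqNy s : tripod s != -oo%E.
Proof. by rewrite /tripod; case: ifP. Qed.

Let o (m : nat) : 'I_n.+1 := inord m.

Let o_val m : (m < 6)%N -> o m = m :> nat.
Proof. by move=> m6; rewrite inordK // (leq_trans m6). Qed.

Let o_class m : (m < 6)%N -> leaf_class (o m) = m./2.
Proof. by move=> m6; rewrite /leaf_class o_val // m6. Qed.

Let o_neq m m' : (m < 6)%N -> (m' < 6)%N -> m != m' -> o m != o m'.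
Proof. by move=> m6 m6'; rewrite -val_eqE /= !o_val. Qed.

(* [tripod] is a limit of the tropicalizations of the lines spanned by (1, .., 1) and
   (s^c(0), .., s^c(n)), where c is [leaf_class] and the valuation of s tends to 0. *)
Lemma trop_tripod : trop v (@grassmann_ideal k 1 n) tripod.
Proof.
have leaf02 : leaf_class (o 0) != leaf_class (o 2) by rewrite !o_class.
apply: tropI.
  split; first exact: tripod_neqNy.
  have : plucker_coord tripod [set o 0; o 2]%SET != +oo%E.
    by rewrite tripod_coord (negbTE leaf02).
  by rewrite /plucker_coord; case: insub => // s ps; exists (enum_rank s).
move=> g m c gG _ isog.
pose col (s : 'I_(plucker_num 1 n)) (a : 'I_2) := leaf_class (plucker_cols (enum_val s) a).
(* The perturbation matches the minors of the spanning vectors: s^a - s^b has valuation min(a, b)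
   times that of s when a and b differ. *)
have [e0 e00 e0P] := isolated_perturb (fun s => (minn (col s 0) (col s 1))%:R) tripod_neqNy isog.
pose e := e0 / 2; have e_pos : 0 < e by rewrite divr_gt0.
have ee0 : 0 < e < e0 by rewrite e_pos /= /e; lra.
have [c' isog'] := e0P e ee0.
have [t t0 vt] := v_surj e.
pose M : 'M[k]_(2, n.+1) := \matrix_(b, i) if b == 0 then 1 else t ^+ leaf_class i.
have minorE h : \det (colsub h M) = t ^+ leaf_class (h 1) - t ^+ leaf_class (h 0).
  by rewrite det_mx2 !mxE /= mul1r mul1r.
have v_minor a b : (a < b)%N -> v (t ^+ a - t ^+ b) = (e * a%:R)%:E.
  move=> ab; rewrite vfunD_lt vfunX vt EFin_mulrn ?mulr_natr //.
  by rewrite vfunN vfunX vt EFin_mulrn lte_fin ltr_pMn2l.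
have M_weight : (fun s => v (plucker M s)) = (fun s => tripod s + (e * (minn (col s 0) (col s 1))%:R)%:E)%E.
  apply/funext => s; rewrite /plucker minorE /tripod -!/(col s _).
  have [ab|ab|->] := ltngtP (col s 0) (col s 1).
  - by rewrite -vfunN opprB v_minor // add0e.
  - by rewrite v_minor // add0e.
  - by rewrite subrr vfun0.
have gM : g.@[plucker M] != 0 by move: isog'; rewrite -M_weight; exact: isolated_meval.
have Mlin : linear_space (M : 'M[k^o]_(2, n.+1)).
  apply: (linear_space_minor (h := fun a : 'I_2 => if a == 0 then o 0 else o 2)).
  rewrite minorE (o_class (m := 2)) // (o_class (m := 0)) // -opprB oppr_eq0.
  exact: vfun_neq0 (v_minor 0%N 1%N isT).
by move: gM; rewrite -mmap_in_algE (gG k^o M Mlin) eqxx.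
Qed.

Context (L : 'M[k]_(3, n.+1)).
Hypothesis L_free : row_free L.
Hypothesis vL : forall s, v (plucker (d := 2) L s) = 0%E.
Hypothesis L_generic : generic_lines L.

(** The zero vector is the valuation of the point that [L] defines in its own Fano scheme of planes,
    so [trop_linear_space_sub] puts the uniform tropical plane inside trop L. *)
Lemma uniform_plane : trop v (fano_ideal (d := 2) (linear_ideal L)) (fun=> 0%E).
Proof.
have Lz : (fun s => v (plucker (d := 2) L s)) = (fun=> 0%E) by apply/funext.
have o012 : uniq [:: o 0; o 1; o 2] by rewrite /= !inE negb_or !o_neq.
have card_o : #|(triple (o 0) (o 1) (o 2) @: 'I_3)%SET| = 3%N.
  by rewrite card_imset ?card_ord //; exact: triple_inj.
rewrite -Lz; apply: trop_point_of_kpoint => [|g gF].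
  exists (enum_rank (Sub (triple (o 0) (o 1) (o 2) @: 'I_3)%SET (introT eqP card_o) : plucker_index 2 n)).
  by rewrite -(vfun_eqy v) vL.
rewrite -mmap_in_algE; apply: (gF k^o (L : 'M[k^o]_(3, n.+1))).
  by have [B LB] := row_freeP L_free; exists B.
exact: (linear_ideal_self v_surj).
Qed.

Lemma uniform_bracket_neq0 i j l : uniq [:: i; j; l] -> bracket L i j l != 0.
Proof.
move=> /triple_inj t_inj; rewrite /bracket -meval_plucker_form.
have Lz : (fun s => v (plucker (d := 2) L s)) = (fun=> 0%E) by apply/funext.
have card_t : #|(triple i j l @: 'I_3)%SET| = 3%N by rewrite card_imset ?card_ord.
have [||m] := @plucker_form_isolated k 2 n R v (fun s => v (plucker (d := 2) L s)) _ (triple i j l) 0.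
- by move=> s; exact: vfun_neqNy.
- by rewrite Lz /plucker_coord insubT ?card_t.
- exact: isolated_meval.
Qed.

(** Suppose that on four leaves [x] has its unique minimum at [t]. Two of the other three, [j] and
    [l], lie in different leaf classes, and the circuit of the tripod on [t], [j], [l] then has its
    unique minimum at [t]. *)
Lemma tripod_sub : trop_linear_space tripod `<=` trop v (linear_ideal L).
Proof.
move=> x [xpt xG]; apply: (trop_linear_space_sub v_surj uniform_plane); split=> // tau card_tau.
apply/min_oo_or_twiceP => -[t [tt Ft tmin]]; rewrite mem_enum in tt.
have pc3 i : i \in tau -> plucker_coord (d := 2) (fun=> 0%E : \bar R) (tau :\ i)%SET = 0%E.
  move=> itau; rewrite /plucker_coord insubT //.
  by rewrite -eqSS -card_tau (cardsD1 i tau) itau.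
have x_lt u : u \in tau -> u != t -> (x t < x u)%E.
  by move=> utau ut; have := tmin u; rewrite mem_enum !pc3 // !add0e; apply.
rewrite pc3 // add0e in Ft.
have card3 : #|(tau :\ t)%SET| = 3%N by apply/eqP; rewrite -eqSS -card_tau (cardsD1 t tau) tt.
have [q q_inj qE] := set_imset_ord card3.
have q_in a : q a \in (tau :\ t)%SET by rewrite -qE imset_f.
(* A leaf class has at most two members, so three distinct leaves cannot share one. *)
have [j [l [jt lt jl]]] : exists j l, [/\ j \in (tau :\ t)%SET, l \in (tau :\ t)%SET &
    leaf_class j != leaf_class l].
  have [q01|q01] := eqVneq (leaf_class (q 0)) (leaf_class (q 1)); last by exists (q 0), (q 1).
  exists (q 0), (q 2); split=> //.
  have : q 0 != q 1 by rewrite (inj_eq q_inj).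
  have : q 0 != q 2 by rewrite (inj_eq q_inj).
  have : q 1 != q 2 by rewrite (inj_eq q_inj).
  move: q01; rewrite -!val_eqE /leaf_class /=.
  move: (q 0) (q 1) (q 2) => a b c.
  case: ifP; case: ifP; case: ifP; lia.
rewrite !inE in jt lt; have /andP[jnt jtau] := jt; have /andP[lnt ltau] := lt.
have jnl : j != l by apply: contraNneq jl => ->.
pose sigma := [set t; j; l]%SET.
have card_sigma : #|sigma| = 3%N.
  have tjl : t \notin [set j; l]%SET by rewrite !inE negb_or ![t == _]eq_sym jnt lnt.
  by rewrite /sigma -finset.setUA cardsU1 tjl cards2 jnl.
have sigma_t : (sigma :\ t = [set j; l])%SET.
  apply/setP => u; rewrite !inE; have [->|] //= := eqVneq u t.
  by rewrite ![t == _]eq_sym (negbTE jnt) (negbTE lnt).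
have tripod_ge (rho : {set 'I_n.+1}) : (0 <= plucker_coord tripod rho)%E.
  rewrite /plucker_coord; case: insub => [s|]; last by rewrite leey.
  by rewrite /tripod; case: ifP; rewrite ?leey.
have /min_oo_or_twiceP[] := xG _ card_sigma; exists t.
rewrite mem_enum sigma_t tripod_coord (negbTE jl) add0e !inE eqxx; split=> // u.
rewrite mem_enum => us ut; have utau : u \in tau.
  by move: us; rewrite !inE (negbTE ut) /= => /orP[]/eqP ->.
apply: lt_le_trans (x_lt u utau ut) _.
by rewrite -[X in (X <= _)%E]add0e leeD2r.
Qed.

Definition pair_cols (i j : 'I_n.+1) : 'I_2 -> 'I_n.+1 := fun a => tnth [tuple i; j] a.

(** Cauchy-Binet for a 2x3 times a 3x2 matrix. The minor is linear in [cross L i j] with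
    coefficients depending only on the line [N], so linear relations between cross products become
    linear relations between Plucker coordinates. *)
Lemma det_pair_cols (S : comAlgType k) (N : 'M[S]_(2, 3)) i j :
  \det (colsub (pair_cols i j) (N *m map_mx (in_alg S) L)) =
  (cross N^T 0 1 *m (map_mx (in_alg S) (cross L i j))^T) 0 0.
Proof.
set L' := map_mx _ L.
have -> : map_mx (in_alg S) (cross L i j) = cross L' i j.
  apply/matrixP => a b; rewrite ord1 [LHS]mxE.
  have [c0 c1 c2] := cross_coords L i j; have [c'0 c'1 c'2] := cross_coords L' i j.
  case/or3P: (ord3E b) => /eqP ->; rewrite ?(c0, c1, c2, c'0, c'1, c'2) rmorphB !rmorphM /= !mxE //.
have [N0 N1 N2] := cross_coords N^T 0 1; have [L0 L1 L2] := cross_coords L' i j.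
have trE a : (cross L' i j)^T a 0 = cross L' i j 0 a by rewrite mxE.
have nE a b : N^T a b = N b a by rewrite mxE.
rewrite det_mx2 [RHS]mxE sum_ord3 !trE N0 N1 N2 L0 L1 L2 !nE.
have colE a b : colsub (pair_cols i j) (N *m L') a b =
    N a 0 * L' 0 (pair_cols i j b) + N a 1 * L' 1 (pair_cols i j b) + N a 2 * L' 2 (pair_cols i j b).
  by rewrite [LHS]mxE [LHS]mxE sum_ord3.
rewrite !colE -[pair_cols i j 0]/i -[pair_cols i j 1]/j; ring.
Qed.

(* A line of [L] through the points where the pairs of leaves meet would join three non-collinear
   points: P_02 is a combination of P_01, P_23 and P_45 on the Fano scheme. *)
Lemma tripod_not_fano : ~ trop v (fano_ideal (d := 1) (linear_ideal L)) tripod.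
Proof.
move=> tF; pose W := cross_mx L (o 0) (o 1) (o 2) (o 3) (o 4) (o 5).
have br i j : (i < 6)%N -> (j < 6)%N -> i != j -> exists l, bracket L (o i) (o j) l != 0.
  move=> i6 j6 ij; have [m [m6 mi mj]] : exists m, [/\ (m < 6)%N, i != m & j != m].
    have [|] := boolP [&& i != 0 & j != 0]%N; first by move=> /andP[? ?]; exists 0%N.
    have [|] := boolP [&& i != 1 & j != 1]%N; first by move=> /andP[? ?]; exists 1%N.
    by move=> ? ?; exists 2%N; split=> //; lia.
  exists (o m); apply: uniform_bracket_neq0.
  by rewrite /= !inE negb_or !o_neq.
have detW : \det W != 0.
  apply: noncollinear_cross_mx; try exact: br.
  have [_ noncol] := L_generic.
  have neq_set (a b c d : nat) : (a < 6)%N -> (b < 6)%N -> (c < 6)%N -> (d < 6)%N ->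
      a != c -> a != d -> [set o a; o b]%SET != [set o c; o d]%SET.
    move=> a6 b6 c6 d6 ac ad; apply/eqP => /setP/(_ (o a)).
    by rewrite !inE eqxx (negbTE (o_neq a6 c6 ac)) (negbTE (o_neq a6 d6 ad)).
  apply: noncol; rewrite ?o_neq //.
    by rewrite /= !inE negb_or !neq_set.
  apply/eqP/setP => u; rewrite !inE; apply/negbTE/negP => /andP[/andP[h01 h23] _].
  by move: h01 h23 => /orP[]/eqP ->; rewrite !(negbTE (o_neq _ _ _)).
pose w : 'rV[k]_3 := cross L (o 0) (o 2) *m invmx W.
have wW : cross L (o 0) (o 2) = w *m W by rewrite mulmxKV // unitmxE unitfE.
pose pf i j := plucker_form k (pair_cols (o i) (o j)).
(* At [tripod] the form 02 weighs 0 and the three subtracted forms weigh +oo, so [g] has an isolated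
   term. *)
pose g : {mpoly k[plucker_num 1 n]} :=
  pf 0%N 2 - (w 0 0 *: pf 0%N 1%N + w 0 1 *: pf 2 3 + w 0 2 *: pf 4 5).
have gF : fano_ideal (d := 1) (linear_ideal L) g.
  move=> S M _ /(linear_ideal_factor L_free)[N ->].
  have wE : cross L (o 0) (o 2) = w 0 0 *: cross L (o 0) (o 1) + w 0 1 *: cross L (o 2) (o 3)
      + w 0 2 *: cross L (o 4) (o 5).
    rewrite wW mulmx_sum_row sum_ord3; have [-> -> ->] := cross_mx_rows L (o 0) (o 1) (o 2) (o 3) (o 4) (o 5).
    by [].
  rewrite /g mmapB !mmapD !mmapZ !mmap_plucker_form !det_pair_cols.
  set c := cross N^T 0 1; pose ev (x : 'rV[k]_3) : S := (c *m (map_mx (in_alg S) x)^T) 0 0.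
  have evD x y : ev (x + y) = ev x + ev y by rewrite /ev map_mxD linearD mulmxDr mxE.
  have evZ a x : ev (a *: x) = in_alg S a * ev x.
    by rewrite /ev map_mxZ linearZ -scalemxAr mxE.
  by rewrite -!/(ev _) wE !evD !evZ subrr.
have pc0 i j : plucker_coord tripod (pair_cols (o i) (o j) @: 'I_2)%SET =
    if leaf_class (o i) == leaf_class (o j) then +oo%E else 0%E.
  rewrite -tripod_coord; congr plucker_coord; apply/setP => l; rewrite !inE.
  apply/imsetP/orP => [[a _ ->]|[/eqP ->|/eqP ->]]; [|by exists 0|by exists 1].
  have : a \in [:: 0; 1 : 'I_2] by case: a => -[|[|m]] lt_m.
  by rewrite !inE => /orP[] /eqP ->; rewrite eqxx; [left | right].
have [|m iso1] := @plucker_form_isolated k 1 n R v tripod tripod_neqNy (pair_cols (o 0) (o 2)) 0.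
  by rewrite pc0 !o_class.
have pf_oo i j a m' : leaf_class (o i) = leaf_class (o j) ->
    trop_term v tripod (a *: pf i j) m' = +oo%E.
  move=> ij; rewrite trop_termZ.
  have := plucker_form_ge v tripod_neqNy (pair_cols (o i) (o j)) m'.
  by rewrite pc0 ij eqxx leye_eq => /eqP ->; rewrite addey ?vfun_neqNy.
apply: (trop_not_isolated tF gF (m := m) (c := 0)).
  apply: (dhomog_orbit_homog _ tripod_neqNy (e := 1)).
  by rewrite /g; apply: rpredB; rewrite ?plucker_form_homog //; apply: rpredD;
    [apply: rpredD|]; apply: dhomogZ; exact: plucker_form_homog.
apply: isolatedD => // m'; rewrite trop_termE mcoeffN vfunN -trop_termE.
have oo_up (x y : \bar R) : (x <= y)%E -> (0 < x)%E -> (0 < y)%E.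
  by move=> xy x0; exact: lt_le_trans xy.
apply: (trop_termD oo_up); first apply: (trop_termD oo_up);
  by rewrite pf_oo ?ltry // !o_class.
Qed.

Lemma trop_fano_plane_proper :
  trop v (fano_ideal (d := 1) (linear_ideal L)) `<`
  trop_fano v (d := 1) (trop v (linear_ideal L)).
Proof.
split; first exact: trop_fano_ideal_sub.
move=> sub; apply: tripod_not_fano; apply: sub.
split; [exact: trop_tripod | exact: tripod_sub].
Qed.

End StrictInclusion.

Theorem theorem3 (R : realType) (k : fieldType) (v : valuation k R)
    (hv : surjective_valuation v) :
  (forall n : nat, (5 <= n)%N ->
     (exists U : set 'M[k]_(3, n.+1),
        [/\ zariski_open (d := 2) U, U !=set0 &
            forall M, U M -> generic_lines M]) /\
     (forall L : 'M[k]_(3, n.+1), row_free L ->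
        (forall s, v (plucker (d := 2) L s) = 0%E) ->
        generic_lines L ->
        trop v (fano_ideal (d := 1) (linear_ideal (d := 2) L))
          `<` trop_fano v (d := 1) (trop v (linear_ideal (d := 2) L)))) /\
  (forall (n d r : nat) (a : 'I_n.+1 -> 'rV[int]_r.+1),
     (d <= n)%N -> injective a -> (forall i, a i 0 ord_max = 1) ->
     trop_fano v (d := d) (trop v (@toric_ideal k r n a))
       = trop v (fano_ideal (d := d) (@toric_ideal k r n a))).
Proof.
split=> [n n5|n d r a _ _ a_last].
  split; first by apply: (exists_generic_open hv); apply: leq_trans n5.
  by move=> L L_free vL L_generic; exact: trop_fano_plane_proper.
apply/seteqP; split=> p; last exact: trop_fano_ideal_sub.
by move=> [pG pX]; exact: trop_fano_toric_sub.
Qed.
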